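(* The variety $\mathrm{SO}^\star(5)\subseteq\mathbb{R}^{25}$ is the union of $64$ irreducible surfaces (its irreducible components): $32$ tori of degree four and $32$ copies of $\mathrm{SO}^\circ(3)\times\mathrm{SO}(1)\times\mathrm{SO}(1)$ of degree eight. These $64$ components may be grouped into $16$ quadruples based on their zero pattern (i.e. each quadruple consists of the components having the same set of identically vanishing matrix entries). There exists a bijection between these $16$ quadruples and the $16$ facets of the polytope $\mathcal{P}$ satisfying the following: 1. The eight quadruples of tori correspond to the eight quadrilateral facets with three degree four vertices. 2. The eight quadruples of copies of $\mathrm{SO}^\circ(3)\times\mathrm{SO}(1)\times\mathrm{SO}(1)$ correspond to the other facets. 3. Two distinct quadruples intersect in curves if and only if their corresponding facets share an edge. 4. Two distinct quadruples intersect in isolated points if and only if their corresponding facets meet in a vertex (i.e. intersect exactly in a vertex). 5. Curve intersections of components are copies of $\mathrm{SO}(2)\times\mathrm{SO}(1)\times\mathrm{SO}(1)\times\mathrm{SO}(1)\cong\mathbb{S}^1$. 6. Point intersections of components are signed permutation matrices of determinant one.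
   Context: $\mathrm{SO}(n)$ is the group of real $n\times n$ orthogonal matrices of determinant $1$. $\mathrm{SO}^\star(5)$ is the set of $M=(m_{ij})\in\mathrm{SO}(5)$ satisfying the eight-zero pattern $$m_{11}=m_{12}=m_{22}=m_{23}=m_{33}=m_{34}=m_{44}=m_{41}=0,$$ i.e. for $i\in\{1,2,3,4\}$ the entries in positions $(i,i)$ and $(i,i+1 \bmod 4)$ vanish (with $4+1$ read as $1$), while the fifth row and fifth column are unconstrained. $\mathrm{SO}^\circ(3)$ denotes a copy of $\mathrm{SO}(3)$ with a single zero in some entry, i.e. $\{N\in\mathrm{SO}(3)\mid n_{kl}=0\}$ for one fixed position $(k,l)$. ''Copies'' are understood as block embeddings: a torus is a set of $5\times5$ matrices which, after fixed permutations of rows and columns and fixed sign changes of rows, is $\{\mathrm{diag}(A,B,1)\mid A,B\in\mathrm{SO}(2)\}\cong\mathrm{SO}(2)\times\mathrm{SO}(2)\times \mathrm{SO}(1)$; a copy of $\mathrm{SO}^\circ(3)\times\mathrm{SO}(1)\times\mathrm{SO}(1)$ is likewise $\{\mathrm{diag}(N,1,1)\mid N\in\mathrm{SO}^\circ(3)\}$ after such operations; a copy of $\mathrm{SO}(2)\times\mathrm{SO}(1)\times\mathrm{SO}(1)\times\mathrm{SO}(1)$ is $\{\mathrm{diag}(A,1,1,1)\mid A\in\mathrm{SO}(2)\}$ after such operations. The degree of a real algebraic set is the degree of the Zariski closure in complex affine space. The intersection of two quadruples means the intersection of the union of the components in one with the union of the components in the other; it is ''in curves'' if it has dimension one and ''in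 isolated points'' if it is nonempty and finite. The polytope $\mathcal{P}$ is the $3$-polytope (determined up to combinatorial equivalence) with $18$ vertices labelled $0,\dots,17$, $32$ edges, and $16$ facets, all quadrilaterals, with the following vertex cycles: $(17,6,16,7)$, $(17,6,11,0)$, $(17,7,12,1)$, $(17,0,9,1)$, $(14,5,10,3)$, $(14,5,15,4)$, $(14,3,13,2)$, $(14,4,8,2)$, $(6,11,10,16)$, $(7,16,13,12)$, $(0,11,15,9)$, $(1,12,8,9)$, $(5,10,11,15)$, $(3,10,16,13)$, $(4,15,9,8)$, $(2,13,12,8)$. The degree of a vertex is the number of edges containing it. A signed permutation matrix has exactly one nonzero entry, equal to $\pm1$, in each row and column. *)

(* Defs.v *)
From HB Require Import structures.
From mathcomp Require Import all_boot all_order all_algebra all_fingroup.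
From mathcomp Require Import boolp classical_sets functions cardinality reals.
From mathcomp Require Import complex.
From mathcomp Require Import mpoly.

Set Implicit Arguments.
Unset Strict Implicit.
Unset Printing Implicit Defensive.

Import Order.TTheory GRing.Theory Num.Theory.
Local Open Scope ring_scope.
Local Open Scope classical_set_scope.

Section AffineAlgebraicSets.
Context (K : fieldType) (m n : nat).
Implicit Types (X Y : set 'M[K]_(m, n)) (p : {mpoly K[m * n]}).

(* Affine space is the space of m x n matrices; its coordinates are numbered
   row by row by [mxvec]. *)
Definition mxeval p (M : 'M[K]_(m, n)) : K := p.@[fun i => mxvec M 0 i].

Definition vanishes_on p X := forall M, X M -> mxeval p M = 0.

Definition zeros (S : set {mpoly K[m * n]}) : set 'M[K]_(m, n) :=
  [set M | forall p, S p -> mxeval p M = 0].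

Definition zclosed X := exists S, X = zeros S.

Definition zclosure X : set 'M[K]_(m, n) := zeros [set p | vanishes_on p X].

Definition zirreducible X := X !=set0 /\
  forall Y1 Y2, zclosed Y1 -> zclosed Y2 -> X `<=` Y1 `|` Y2 ->
    X `<=` Y1 \/ X `<=` Y2.

Definition irr_closed_in X Y := [/\ zclosed Y, zirreducible Y & Y `<=` X].

Definition irr_components X : set (set 'M[K]_(m, n)) :=
  [set C | irr_closed_in X C /\
           forall Y, irr_closed_in X Y -> C `<=` Y -> Y = C].

(* Strictly increasing chains Z 0 < ... < Z d of irreducible closed subsets. *)
Definition has_chain X (d : nat) := exists Z : nat -> set 'M[K]_(m, n),
  (forall i, (i <= d)%N -> irr_closed_in X (Z i)) /\
  (forall i, (i < d)%N -> Z i `<` Z i.+1).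

Definition dimension X (d : nat) := has_chain X d /\ ~ has_chain X d.+1.

(* The polynomials of degree <= s, modulo those vanishing on X, form a vector
   space of dimension k: b is a basis of it.  Recall msize = degree + 1. *)
Definition hilbert_value X (s k : nat) :=
  exists b : 'I_k -> {mpoly K[m * n]},
    [/\ forall i, (msize (b i) <= s.+1)%N,
        forall c : 'I_k -> K,
          vanishes_on (\sum_i c i *: b i) X -> forall i, c i = 0
      & forall p, (msize p <= s.+1)%N ->
          exists c : 'I_k -> K, vanishes_on (p - \sum_i c i *: b i) X].

Definition hilbert_polynomial X (H : {poly rat}) :=
  exists s0 : nat, forall s : nat, (s0 <= s)%N ->
    exists2 k : nat, hilbert_value X s k & H.[s%:R] = k%:R.

(* The affine Hilbert polynomial of X is the Hilbert polynomial of its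
   projective closure, whose leading term is (degree / d!) s ^ d. *)
Definition has_degree X (e : nat) := exists2 H : {poly rat},
  hilbert_polynomial X H & lead_coef H * ((size H).-1)`!%:R = e%:R.

End AffineAlgebraicSets.

Definition real_degree (R : realType) (m n : nat) (X : set 'M[R]_(m, n)) :=
  has_degree (zclosure [set map_mx (real_complex R) M | M in X]).

Definition polynomial_map (K : fieldType) (m n p q : nat)
    (f : 'M[K]_(m, n) -> 'M[K]_(p, q)) :=
  exists F : 'I_p -> 'I_q -> {mpoly K[m * n]},
    forall M i j, f M i j = mxeval (F i j) M.

Definition isomorphic (K : fieldType) (m n p q : nat)
    (X : set 'M[K]_(m, n)) (Y : set 'M[K]_(p, q)) :=
  exists (f : 'M[K]_(m, n) -> 'M[K]_(p, q)) (g : 'M[K]_(p, q) -> 'M[K]_(m, n)),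
    [/\ polynomial_map f, polynomial_map g,
        forall M, X M -> Y (f M) /\ g (f M) = M
      & forall N, Y N -> X (g N) /\ f (g N) = N].

Section OrthogonalMatrices.
Context (R : realType).

Definition SO (n : nat) : set 'M[R]_n :=
  [set A | A *m A^T = 1%:M /\ \det A = 1].

(* Rows and columns are indexed from 0; [forced_zero] is the eight-zero
   pattern (i, i), (i, i + 1 mod 4) for i < 4. *)
Definition forced_zero (i j : 'I_5) : bool :=
  (i < 4)%N && ((j == i :> nat) || (j == i.+1 %% 4 :> nat)%N).

Definition SOstar : set 'M[R]_5 :=
  [set M | SO M /\ forall i j, forced_zero i j -> M i j = 0].

Definition SOcirc (k l : 'I_3) : set 'M[R]_3 := [set N | SO N /\ N k l = 0].

Definition signed_relabel (s t : 'S_5) (e : 'I_5 -> bool) (M : 'M[R]_5) :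
  'M[R]_5 := \matrix_(i, j) ((-1) ^+ e i * M (s i) (t j)).

Definition is_copy_of (X Y : set 'M[R]_5) :=
  exists s t e, Y = signed_relabel s t e @` X.

Definition diag221 (A B : 'M[R]_2) : 'M[R]_5 :=
  block_mx A 0 0 (block_mx B 0 0 (1%:M : 'M[R]_1)).

Definition diag311 (N : 'M[R]_3) : 'M[R]_5 :=
  block_mx N 0 0 (1%:M : 'M[R]_2).

Definition diag2111 (A : 'M[R]_2) : 'M[R]_5 :=
  block_mx A 0 0 (1%:M : 'M[R]_3).

Definition torus (Y : set 'M[R]_5) :=
  is_copy_of [set diag221 A B | A in @SO 2 & B in @SO 2] Y.

Definition SOcirc_copy (Y : set 'M[R]_5) :=
  exists k l, is_copy_of [set diag311 N | N in SOcirc k l] Y.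

Definition SO2_copy (Y : set 'M[R]_5) :=
  is_copy_of [set diag2111 A | A in @SO 2] Y.

Definition unit_circle : set 'rV[R]_2 :=
  [set v | v 0 0 ^+ 2 + v 0 1 ^+ 2 = 1].

Definition signed_permutation (M : 'M[R]_5) :=
  [/\ forall i, exists! j, M i j != 0,
      forall j, exists! i, M i j != 0
    & forall i j, M i j != 0 -> M i j = 1 \/ M i j = -1].

Definition zero_pattern (X : set 'M[R]_5) : set ('I_5 * 'I_5) :=
  [set ij | forall M, X M -> M ij.1 ij.2 = 0].

Definition components : set (set 'M[R]_5) := irr_components SOstar.

Definition quadruples : set (set (set 'M[R]_5)) :=
  [set [set D | components D /\ zero_pattern D = zero_pattern C]
    | C in components].

Definition torus_quadruples : set (set (set 'M[R]_5)) :=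
  [set Q | quadruples Q /\ Q `<=` torus].

Definition SOcirc_quadruples : set (set (set 'M[R]_5)) :=
  [set Q | quadruples Q /\ Q `<=` SOcirc_copy].

Definition union_of (Q : set (set 'M[R]_5)) : set 'M[R]_5 := \bigcup_(C in Q) C.

Definition in_curves (X : set 'M[R]_5) := dimension X 1.

Definition in_points (X : set 'M[R]_5) := X !=set0 /\ finite_set X.

End OrthogonalMatrices.

Arguments SO R n : clear implicits.
Arguments SOstar R : clear implicits.
Arguments unit_circle R : clear implicits.
Arguments components R : clear implicits.
Arguments quadruples R : clear implicits.
Arguments torus_quadruples R : clear implicits.
Arguments SOcirc_quadruples R : clear implicits.

(* The polytope P, given by the vertex cycles of its facets. *)
Definition facets : seq (seq nat) :=
  [:: [:: 17; 6; 16; 7]; [:: 17; 6; 11; 0]; [:: 17; 7; 12; 1];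
      [:: 17; 0; 9; 1]; [:: 14; 5; 10; 3]; [:: 14; 5; 15; 4];
      [:: 14; 3; 13; 2]; [:: 14; 4; 8; 2]; [:: 6; 11; 10; 16];
      [:: 7; 16; 13; 12]; [:: 0; 11; 15; 9]; [:: 1; 12; 8; 9];
      [:: 5; 10; 11; 15]; [:: 3; 10; 16; 13]; [:: 4; 15; 9; 8];
      [:: 2; 13; 12; 8] ]%N.

(* Edges are unordered pairs, stored with the smaller vertex first. *)
Definition facet_edges (F : seq nat) : seq (nat * nat) :=
  [seq (minn e.1 e.2, maxn e.1 e.2) | e <- zip F (rot 1 F)].

Definition edges : seq (nat * nat) := undup (flatten (map facet_edges facets)).

Definition vertex_degree (v : nat) : nat :=
  count (fun e : nat * nat => (v == e.1) || (v == e.2)) edges.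

Definition three_degree_four (F : seq nat) : bool :=
  count (fun v => vertex_degree v == 4)%N F == 3%N.

Definition share_edge (F G : seq nat) : bool :=
  has (fun e => e \in facet_edges G) (facet_edges F).

Definition meet_in_vertex (F G : seq nat) : bool :=
  size [seq v <- F | v \in G] == 1%N.

Lemma polytope_counts :
  [/\ size (undup (flatten facets)) = 18%N, size edges = 32%N,
      uniq facets && (size facets == 16%N), all uniq facets
    & all (fun e => count (fun F => e \in facet_edges F) facets == 2%N) edges].
Proof. by vm_compute. Qed.

(* Main.v *)
Require Import Defs.
From mathcomp Require Import all_boot all_order all_algebra all_fingroup.
From mathcomp Require Import boolp classical_sets functions cardinality reals.
From mathcomp Require Import complex mpoly zify ring.

(** A component of SO*(5) is, up to signs and permutations of rows and columns,
    [diag(A, B, 1)] with [A, B] rotations, or [diag(N, 1, 1)] with [N] a rotation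
    with vanishing last entry, i.e. an Euler product [Rz(a) Rx(pi/2) Rz(b)].  Both
    are parametrized by the torus [T = S^1 x S^1]: the entries are zero or signed
    monomials in [cos a, sin a, cos b, sin b].

    On [T], with [z = exp(i a)] and [w = exp(i b)], polynomials of degree [<= s] in
    the entries restrict exactly to the span of the [z^p w^q] with [|p| + |q| <= s]
    for the tori ([2 s^2 + 2 s + 1] monomials, degree 4) and with
    [max(|p|, |q|) <= s] for the others ([(2 s + 1)^2] monomials, degree 8).
    Irreducibility is the absence of zero divisors among Laurent polynomials, and
    dimension is bounded because a chain [Z_0 < ... < Z_d] yields d polynomials
    whose monomials are independent on [Z_d], against [O(s^(d-1))] growth.

    Conversely, in an orthogonal matrix no scalar product of two rows or columns has
    exactly one nonzero term; with the eight prescribed zeros this forces one of 16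
    zero patterns, each of which splits the matrix into small orthogonal blocks.

    Cut each circle at the multiples of [pi / 2].  This divides T into 25 cells, on
    each of which membership of the matrix in another component can be decided on
    the signed monomials, so all intersections are found by computation. *)

Set Implicit Arguments.
Unset Strict Implicit.
Unset Printing Implicit Defensive.

(** * Signed monomials on the torus *)

(* [None] is 0, and [Some (b, (i, j), (k, l))] is
   (-1)^b (cos a)^i (sin a)^j (cos b)^k (sin b)^l. *)
Definition entry := option (bool * (nat * nat) * (nat * nat)).

Definition eone : entry := Some (false, (0, 0), (0, 0)).
Definition cos1 : entry := Some (false, (1, 0), (0, 0)).
Definition sin1 : entry := Some (false, (0, 1), (0, 0)).
Definition cos2 : entry := Some (false, (0, 0), (1, 0)).
Definition sin2 : entry := Some (false, (0, 0), (0, 1)).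

Definition eqe (x y : entry) : bool :=
  match x, y with
  | None, None => true
  | Some (s, (i, j), (k, l)), Some (s', (i', j'), (k', l')) =>
      [&& eqb s s', eqn i i', eqn j j', eqn k k' & eqn l l']
  | _, _ => false
  end.
Definition enull (x : entry) := if x is None then true else false.

Definition emul (x y : entry) : entry :=
  match x, y with
  | Some (s, (i, j), (k, l)), Some (s', (i', j'), (k', l')) =>
      Some (s (+) s', (i + i', j + j'), (k + k', l + l'))
  | _, _ => None
  end.

Definition eopp (b : bool) (x : entry) : entry :=
  if x is Some (s, p, q) then Some (b (+) s, p, q) else None.

Fixpoint epow (x : entry) n : entry := if n is n'.+1 then emul x (epow x n') else eone.

(* ((cos a, sin a), (cos b, sin b)) *)
Definition quad (T : Type) : Type := ((T * T) * (T * T))%type.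

Definition esubst (t : quad entry) (x : entry) : entry :=
  if x is Some (b, (i, j), (k, l)) then
    eopp b (emul (emul (epow t.1.1 i) (epow t.1.2 j))
                 (emul (epow t.2.1 k) (epow t.2.2 l)))
  else None.

Definition smx := seq (seq entry).
Definition sget (S : smx) i j : entry := nth None (nth [::] S i) j.
Definition smap (f : entry -> entry) (S : smx) : smx := map (map f) S.
Definition smake (f : nat -> nat -> entry) : smx := mkseq (fun i => mkseq (f i) 5) 5.

Definition torus_smx : smx :=
  [:: [:: cos1; eopp true sin1; None; None; None];
      [:: sin1; cos1; None; None; None];
      [:: None; None; cos2; eopp true sin2; None];
      [:: None; None; sin2; cos2; None];
      [:: None; None; None; None; eone]].

Definition SOcirc_smx : smx :=
  [:: [:: emul cos1 cos2; eopp true (emul cos1 sin2); sin1; None; None];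
      [:: emul sin1 cos2; eopp true (emul sin1 sin2); eopp true cos1; None; None];
      [:: sin2; cos2; None; None; None];
      [:: None; None; None; eone; None];
      [:: None; None; None; None; eone]].

Definition swaps := seq (nat * nat).
Definition sapply (l : swaps) (i : nat) : nat :=
  foldl (fun i p => if i == p.1 then p.2 else if i == p.2 then p.1 else i) i l.

Definition srelabel (s t : swaps) (e : nat -> bool) (S : smx) : smx :=
  smake (fun i j => eopp (e i) (sget S (sapply s i) (sapply t j))).

(* One block type per facet of P, in the order of [facets]: whether it is of type
   SOcirc, and row and column permutations as products of transpositions. *)
Definition block_data : seq (bool * swaps * swaps) :=
 [:: (true, [:: (0, 3); (1, 4); (2, 0)], [:: (0, 2); (1, 0); (1, 3); (1, 4)]);
     (true, [:: (0, 3); (1, 0); (1, 4)], [:: (1, 4); (2, 3)]);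
     (true, [:: (0, 2); (1, 3); (0, 4); (1, 0)], [:: (0, 4); (1, 2); (1, 0)]);
     (true, [:: (1, 2); (1, 3); (1, 4)], [:: (0, 3); (1, 4)]);
     (true, [:: (1, 3); (2, 4); (1, 2)], [:: (0, 3); (1, 4); (2, 0)]);
     (true, [:: (0, 3); (1, 4)], [:: (0, 4); (1, 0)]);
     (true, [:: (0, 2); (1, 0); (1, 3); (1, 4)], [:: (0, 2); (1, 3); (0, 4); (1, 0)]);
     (true, [:: (0, 3); (1, 2); (1, 0); (1, 4)], [:: (1, 2); (1, 4)]);
     (false, [:: (0, 4); (1, 0)], [:: (1, 2); (1, 4); (3, 1)]);
     (false, [:: (1, 4); (3, 1)], [:: (0, 2); (1, 3); (1, 4)]);
     (false, [:: (1, 2); (1, 3); (1, 4)], [:: (0, 2); (1, 4); (3, 1)]);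
     (false, [:: (2, 4); (3, 2)], [:: (0, 4); (1, 2); (1, 3); (1, 0)]);
     (false, [:: (1, 4)], [:: (0, 4); (1, 2); (1, 0); (3, 1)]);
     (false, [:: (1, 2); (1, 4); (3, 1)], [:: (0, 2); (1, 4)]);
     (false, [:: (0, 4); (1, 0); (2, 1); (3, 2)], [:: (1, 2); (1, 3); (1, 4)]);
     (false, [:: (3, 4)], [:: (0, 2); (1, 3); (0, 4); (1, 0)])].

Definition btype q := (nth (true, [::], [::]) block_data q).1.1.
Definition brow q := (nth (true, [::], [::]) block_data q).1.2.
Definition bcol q := (nth (true, [::], [::]) block_data q).2.

Definition bsign (ty : bool) (x y z : bool) : seq bool :=
  if ty then [:: x; x; x; y; z] else [:: false; x; false; y; z].

Definition btemplate (ty : bool) := if ty then SOcirc_smx else torus_smx.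

Definition bsmx ty s t (x y z : bool) : smx :=
  srelabel s t (fun i => nth false (bsign ty x y z) (sapply s i)) (btemplate ty).

(* The determinant fixes the first sign bit. *)
Definition qsmx q (y z : bool) : smx :=
  bsmx (btype q) (brow q) (bcol q)
    (odd (size (brow q) + size (bcol q)) (+) (y (+) z)) y z.

Definition csmx k : smx := qsmx (k %/ 4) (odd (k %/ 2)) (odd k).

Definition same_up_to_sign (x y : entry) : bool := eqe x y || eqe x (eopp true y).

Definition slocate (S : smx) (m : entry) : bool * nat * nat :=
  let i := find (has (same_up_to_sign m)) S in
  let j := find (same_up_to_sign m) (nth [::] S i) in
  (~~ eqe (sget S i j) m, i, j).

Definition sread (S : smx) (r : bool * nat * nat) : entry := eopp r.1.1 (sget S r.1.2 r.2).

Definition qmap A B (f : A -> B) (q : quad A) : quad B :=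
  ((f q.1.1, f q.1.2), (f q.2.1, f q.2.2)).

Definition gen : quad entry := ((cos1, sin1), (cos2, sin2)).

Definition angle_slots (S : smx) : quad (bool * nat * nat) := qmap (slocate S) gen.

Definition readable (S : smx) : bool :=
  let t := qmap (sread S) (angle_slots S) in
  [&& eqe t.1.1 cos1, eqe t.1.2 sin1, eqe t.2.1 cos2, eqe t.2.2 sin2
    & let sl := angle_slots S in
      all (fun r : bool * nat * nat => (r.1.2 < 5) && (r.2 < 5))
        [:: sl.1.1; sl.1.2; sl.2.1; sl.2.2]].

(* An angle is generic ([None]), or one of the multiples of pi / 2, with
   (cos, sin) = (+-1, 0) for [Some (false, _)] and (0, +-1) for [Some (true, _)]. *)
Definition quarter := option (bool * bool).
Definition quarters : seq quarter :=
  [:: Some (false, false); Some (false, true); Some (true, false); Some (true, true); None].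
Definition quarter_subst (g : entry * entry) (a : quarter) : entry * entry :=
  if a is Some (b, s) then if b then (None, eopp s eone) else (eopp s eone, None) else g.
Definition cell : Type := (quarter * quarter)%type.
Definition cells : seq cell := allpairs pair quarters quarters.
Definition cell_subst (c : cell) : quad entry :=
  (quarter_subst gen.1 c.1, quarter_subst gen.2 c.2).
Definition cell_smx (S : smx) (c : cell) : smx := smap (esubst (cell_subst c)) S.

Definition in_region (r c : cell) : bool :=
  ((r.1 == None) || (r.1 == c.1)) && ((r.2 == None) || (r.2 == c.2)).

Definition unit_pair (x y : entry) : bool :=
  [|| same_up_to_sign x eone && enull y, same_up_to_sign y eone && enull x
    | has (fun g => same_up_to_sign x g.1 && same_up_to_sign y g.2 ||
                    same_up_to_sign x g.2 && same_up_to_sign y g.1) [:: gen.1; gen.2]].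

Definition surely_differ (x y : entry) : bool :=
  if x is None then ~~ enull y else enull y || eqe x (eopp true y).

Definition all5 (P : nat -> nat -> bool) : bool :=
  let I := [:: 0; 1; 2; 3; 4] in all (fun i => all (P i) I) I.

Definition smx_in (S : smx) (sl : quad (bool * nat * nat)) (M : smx) : bool :=
  let t := qmap (sread M) sl in
  [&& unit_pair t.1.1 t.1.2, unit_pair t.2.1 t.2.2 &
      all5 (fun i j => eqe (sget M i j) (esubst t (sget S i j)))].

Definition smx_out (S : smx) (sl : quad (bool * nat * nat)) (M : smx) : bool :=
  let t := qmap (sread M) sl in
  ~~ all5 (fun i j => ~~ surely_differ (sget M i j) (esubst t (sget S i j))) ||
  ((enull t.1.1 && enull t.1.2) || (enull t.2.1 && enull t.2.2)).

Definition csmxs : seq smx := Eval vm_compute in map csmx (iota 0 64).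

Definition located_csmxs : seq (smx * quad (bool * nat * nat)) :=
  [seq (A, angle_slots A) | A <- csmxs].

(* The intersection of two components, as the closure of a cell of the first. *)
Definition itable : seq (seq (option cell)) := Eval vm_compute in
  [seq let Ms := [seq (c, cell_smx A c) | c <- cells] in
       [seq last None [seq Some cM.1 | cM <- Ms & smx_in D.1 D.2 cM.2] | D <- located_csmxs]
  | A <- csmxs].

Definition itab k l : option cell := nth None (nth [::] itable k) l.

Lemma csmxsE : csmxs = map csmx (iota 0 64).
Proof. by vm_compute. Qed.

Lemma readable_csmxs : all readable csmxs.
Proof. by vm_compute. Qed.

Lemma itable_correct :
  all (fun Sr : smx * seq (option cell) =>
    all (fun c => let M := cell_smx Sr.1 c in
      all (fun Do : smx * quad (bool * nat * nat) * option cell =>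
        if (if Do.2 is Some r then in_region r c else false)
        then smx_in Do.1.1 Do.1.2 M else smx_out Do.1.1 Do.1.2 M)
      (zip located_csmxs Sr.2)) cells)
  (zip csmxs itable).
Proof. by vm_compute. Qed.

Definition support_compatible (u v : seq bool) : bool :=
  count (fun ab => ab.1 && ab.2) (zip u v) != 1.

Definition bits5 : seq (seq bool) :=
  let f (s : seq (seq bool)) := [seq b :: x | b <- [:: true; false], x <- s] in
  f (f (f (f (f [:: [::]])))).

Definition forced i j : bool := (i < 4) && ((j == i) || (j == i.+1 %% 4)).

Definition row_supports i : seq (seq bool) :=
  [seq u <- bits5 | has id u && all (fun j => forced i j ==> ~~ nth false u j) (iota 0 5)].

Definition orthogonal_supports (rs : seq (seq bool)) : bool :=
  let cs := [seq [seq nth false r j | r <- rs] | j <- iota 0 5] in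
  all (has id) cs && pairwise support_compatible cs.

Definition block_support q (rs : seq (seq bool)) : bool :=
  all5 (fun i j => enull (sget (qsmx q false false) i j) ==> ~~ nth false (nth [::] rs i) j).

Lemma supports_in_blocks :
  all (fun r0 => all (fun r1 => if support_compatible r0 r1 then
  all (fun r2 => if support_compatible r0 r2 && support_compatible r1 r2 then
  all (fun r3 => if [&& support_compatible r0 r3, support_compatible r1 r3
                    & support_compatible r2 r3] then
  all (fun r4 => if [&& support_compatible r0 r4, support_compatible r1 r4,
                    support_compatible r2 r4 & support_compatible r3 r4] then
      let rs := [:: r0; r1; r2; r3; r4] in
      if orthogonal_supports rs then has (block_support^~ rs) (iota 0 16) else true
    else true) (row_supports 4)
    else true) (row_supports 3)
    else true) (row_supports 2)
    else true) (row_supports 1)) (row_supports 0).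
Proof. by vm_compute. Qed.

Definition is_line (o : option cell) : bool :=
  if o is Some r then (r.1 == None) (+) (r.2 == None) else false.
Definition is_point (o : option cell) : bool :=
  if o is Some r then (r.1 != None) && (r.2 != None) else false.

Lemma itab_proper :
  all (fun k => all (fun l => (k == l) || (itab k l == None) || is_line (itab k l) || is_point (itab k l))
    (iota 0 64)) (iota 0 64).
Proof. by vm_compute. Qed.

Lemma itab_facets :
  all (fun q => all (fun r => (q == r) ||
    let ks := [seq itab (4 * q + i) (4 * r + j) | i <- iota 0 4, j <- iota 0 4] in
    let F := nth [::] facets q in let G := nth [::] facets r in
    (has is_line ks == share_edge F G) &&
    (~~ has is_line ks && has is_point ks == meet_in_vertex F G)) (iota 0 16)) (iota 0 16).
Proof. by vm_compute. Qed.

Lemma three_degree_four_facets :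
  all (fun q => three_degree_four (nth [::] facets q) == ~~ btype q) (iota 0 16).
Proof. by vm_compute. Qed.

Lemma block_zeros_distinct :
  all (fun q => all (fun r => (q == r) ||
    ~~ all5 (fun i j => enull (sget (qsmx q false false) i j) ==
                        enull (sget (qsmx r false false) i j))) (iota 0 16)) (iota 0 16).
Proof. by vm_compute. Qed.

Lemma block_zeros_sign :
  all (fun q => all (fun yz =>
    all5 (fun i j => enull (sget (qsmx q yz.1 yz.2) i j) == enull (sget (qsmx q false false) i j))
    && all5 (fun i j => forced i j ==> enull (sget (qsmx q yz.1 yz.2) i j)))
    [:: (false, false); (false, true); (true, false); (true, true)]) (iota 0 16).
Proof. by vm_compute. Qed.

Import Order.TTheory GRing.Theory Num.Theory.
Local Open Scope ring_scope.
Local Open Scope classical_set_scope.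

Lemma eqeP x y : reflect (x = y) (eqe x y).
Proof.
apply: (iffP idP) => [|->]; last first.
  by case: y => [[[[] [i j]] [k l]]|] //=; rewrite !eqnE !eqxx.
case: x y => [[[s [i j]] [k l]]|] [[[s' [i' j']] [k' l']]|] //=.
by case/and5P => ss /eqnP -> /eqnP -> /eqnP -> /eqnP ->; case: s s' ss => [] [].
Qed.

Lemma enullP x : reflect (x = None) (enull x).
Proof. by case: x => [x|]; constructor. Qed.

Lemma sget_smap f S i j : f None = None -> sget (smap f S) i j = f (sget S i j).
Proof.
move=> f0; rewrite /sget /smap; have [iS|Si] := ltnP i (size S); last first.
  by rewrite !(nth_default [::]) ?size_map // !nth_nil f0.
rewrite (nth_map [::]) //; have [jS|Sj] := ltnP j (size (nth [::] S i)).
  by rewrite (nth_map None).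
by rewrite !(nth_default None) ?size_map.
Qed.

Lemma sget_smake f i j : (i < 5)%N -> (j < 5)%N -> sget (smake f) i j = f i j.
Proof. by move=> hi hj; rewrite /sget /smake nth_mkseq // nth_mkseq. Qed.

Lemma all5P (P : nat -> nat -> bool) :
  reflect (forall i j, (i < 5)%N -> (j < 5)%N -> P i j) (all5 P).
Proof.
pose I := [:: 0; 1; 2; 3; 4]%N.
have mem5 k : (k \in I) = (k < 5)%N by case: k => [|[|[|[|[|]]]]].
apply: (iffP idP) => [/(allP (s := I)) h i j|h].
  by rewrite -!mem5 => /h /(allP (s := I)) hi /hi.
by apply/(allP (s := I)) => i; rewrite mem5 => hi; apply/(allP (s := I)) => j; rewrite mem5 => hj; exact: h.
Qed.

Section Evaluation.
Context (R : realType).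
Implicit Types (x y : entry) (th : quad R) (S : smx).

Definition eval th x : R :=
  if x is Some (b, (i, j), (k, l)) then
    (-1) ^+ b * (th.1.1 ^+ i * th.1.2 ^+ j * (th.2.1 ^+ k * th.2.2 ^+ l))
  else 0.

Definition mxval th S : 'M[R]_5 := \matrix_(i, j) eval th (sget S i j).

Definition circle : set (R * R) := [set u | u.1 ^+ 2 + u.2 ^+ 2 = 1].
Definition torus2 : set (quad R) := [set th | circle th.1 /\ circle th.2].

Definition simage S : set 'M[R]_5 := [set mxval th S | th in torus2].

Lemma evalM th x y : eval th (emul x y) = eval th x * eval th y.
Proof.
case: x y => [[[s [i j]] [k l]]|] [[[s' [i' j']] [k' l']]|] /=; rewrite ?mul0r ?mulr0 //.
by rewrite signr_addb !exprD; ring.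
Qed.

Lemma evalN th b x : eval th (eopp b x) = (-1) ^+ b * eval th x.
Proof.
case: x => [[[s [i j]] [k l]]|] /=; last by rewrite mulr0.
by rewrite signr_addb -mulrA.
Qed.

Lemma eval1 th : eval th eone = 1.
Proof. by rewrite /= !expr0 !mulr1. Qed.

Lemma evalX th x n : eval th (epow x n) = eval th x ^+ n.
Proof. by elim: n => [|n ih]; [exact: eval1|rewrite /= evalM ih exprS]. Qed.

Lemma eval_subst th t x : eval th (esubst t x) = eval (qmap (eval th) t) x.
Proof.
by case: x => [[[s [i j]] [k l]]|] //; rewrite evalN !evalM !evalX.
Qed.

Lemma eval_cos1 th : eval th cos1 = th.1.1.
Proof. by rewrite /= expr1 !expr0; ring. Qed.
Lemma eval_sin1 th : eval th sin1 = th.1.2.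
Proof. by rewrite /= expr1 !expr0; ring. Qed.
Lemma eval_cos2 th : eval th cos2 = th.2.1.
Proof. by rewrite /= expr1 !expr0; ring. Qed.
Lemma eval_sin2 th : eval th sin2 = th.2.2.
Proof. by rewrite /= expr1 !expr0; ring. Qed.

Arguments eval : simpl never.
Arguments eopp : simpl never.

Lemma eval_gen th : qmap (eval th) gen = th.
Proof.
case: th => -[a b] [c d].
by rewrite /qmap [gen.1.1]/= [gen.1.2]/= [gen.2.1]/= [gen.2.2]/= eval_cos1 eval_sin1 eval_cos2 eval_sin2.
Qed.

Lemma mxvalE th S (i j : 'I_5) : mxval th S i j = eval th (sget S i j).
Proof. by rewrite mxE. Qed.

Lemma mxval_subst th t S : mxval th (smap (esubst t) S) = mxval (qmap (eval th) t) S.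
Proof. by apply/matrixP => i j; rewrite !mxvalE sget_smap // eval_subst. Qed.

Definition mxread (r : bool * nat * nat) (M : 'M[R]_5) : R :=
  (-1) ^+ r.1.1 * M (inord r.1.2) (inord r.2).

Definition angles (sl : quad (bool * nat * nat)) (M : 'M[R]_5) : quad R :=
  qmap (mxread^~ M) sl.

Definition valid_slot (r : bool * nat * nat) := ((r.1.2 < 5) && (r.2 < 5))%N.
Definition valid_slots (sl : quad (bool * nat * nat)) :=
  all valid_slot [:: sl.1.1; sl.1.2; sl.2.1; sl.2.2].

Lemma mxread_mxval th S r : valid_slot r -> mxread r (mxval th S) = eval th (sread S r).
Proof. by case/andP => h1 h2; rewrite /mxread mxvalE !inordK // -evalN. Qed.

Lemma angles_mxval th S sl : valid_slots sl ->
  angles sl (mxval th S) = qmap (eval th) (qmap (sread S) sl).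
Proof. by case/and5P => h1 h2 h3 h4 _; rewrite /angles /qmap /= !mxread_mxval. Qed.

Lemma readable_slots S : readable S -> valid_slots (angle_slots S).
Proof. by case/and5P. Qed.

Lemma angles_readable th S : readable S -> angles (angle_slots S) (mxval th S) = th.
Proof.
move=> rS; rewrite angles_mxval ?readable_slots //.
have -> : qmap (sread S) (angle_slots S) = gen.
  case/and5P: rS => /eqeP h1 /eqeP h2 /eqeP h3 /eqeP h4 _.
  by case: (qmap _ _) h1 h2 h3 h4 => [[? ?] [? ?]] /= -> -> -> ->.
exact: eval_gen.
Qed.

Lemma simageP S M : readable S ->
  simage S M <-> torus2 (angles (angle_slots S) M) /\ M = mxval (angles (angle_slots S) M) S.
Proof.
move=> rS; split=> [[th hth <-]|[h ->]]; first by rewrite angles_readable.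
by exists (angles (angle_slots S) M).
Qed.

Lemma mxval_inj S th th' : readable S -> mxval th S = mxval th' S -> th = th'.
Proof. by move=> rS e; rewrite -(angles_readable th rS) e angles_readable. Qed.

Definition quarter_of (u : R * R) : quarter :=
  if u.2 == 0 then Some (false, u.1 == -1)
  else if u.1 == 0 then Some (true, u.2 == -1) else None.
Definition cell_of th : cell := (quarter_of th.1, quarter_of th.2).

Lemma sqr_circle1 (a : R) : a ^+ 2 = 1 -> a = (-1) ^+ (a == -1).
Proof.
move/eqP; rewrite sqrf_eq1 => /orP [/eqP ->|/eqP ->]; last by rewrite eqxx.
by rewrite -subr_eq0 opprK (pnatr_eq0 R 2).
Qed.

Lemma quarter_of_subst th g (u := (eval th g.1, eval th g.2)) : circle u ->
  (eval th (quarter_subst g (quarter_of u)).1, eval th (quarter_subst g (quarter_of u)).2) = u.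
Proof.
rewrite /circle /quarter_of /= => hu.
have [s0|s0] := eqVneq (eval th g.2) 0.
  rewrite /= evalN eval1 mulr1 /u s0 -sqr_circle1 //.
  by move: hu; rewrite s0 expr0n addr0.
have [c0|c0] //= := eqVneq (eval th g.1) 0.
rewrite evalN eval1 mulr1 /u c0 -sqr_circle1 //.
by move: hu; rewrite c0 expr0n add0r.
Qed.

Lemma in_region_subst r th : torus2 th -> in_region r (cell_of th) ->
  qmap (eval th) (cell_subst r) = th.
Proof.
move=> [h1 h2] /andP [e1 e2].
have E1 : (eval th gen.1.1, eval th gen.1.2) = th.1.
  by rewrite eval_cos1 eval_sin1; case: (th.1).
have E2 : (eval th gen.2.1, eval th gen.2.2) = th.2.
  by rewrite eval_cos2 eval_sin2; case: (th.2).
have F g u a : (eval th g.1, eval th g.2) = u -> circle u ->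
    (a == None) || (a == quarter_of u) ->
    (eval th (quarter_subst g a).1, eval th (quarter_subst g a).2) = u.
  by move=> <- hu /orP [/eqP -> //|/eqP ->]; apply: quarter_of_subst.
rewrite /qmap [(cell_subst r).1]/= [(cell_subst r).2]/= (F _ th.1) // (F _ th.2) //.
by case: (th).
Qed.

Definition faithful th x := eval th x = 0 -> x = None.

Lemma faithfulM th x y : faithful th x -> faithful th y -> faithful th (emul x y).
Proof.
move=> fx fy /eqP; rewrite evalM mulf_eq0 => /orP [/eqP/fx ->|/eqP/fy ->] //.
by case: (x) => [[[s [i j]] [k l]]|].
Qed.

Lemma faithfulN th b x : faithful th x -> faithful th (eopp b x).
Proof. by move=> fx /eqP; rewrite evalN mulf_eq0 signr_eq0 /= => /eqP/fx ->. Qed.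

Lemma faithful1 th : faithful th eone.
Proof. by move=> /eqP; rewrite eval1 oner_eq0. Qed.

Lemma faithfulX th x n : faithful th x -> faithful th (epow x n).
Proof.
by move=> fx; elim: n => [|n ih]; [apply: faithful1|apply: faithfulM].
Qed.

Definition qfaithful th (t : quad entry) :=
  [/\ faithful th t.1.1, faithful th t.1.2, faithful th t.2.1 & faithful th t.2.2].

Lemma faithful_subst th t x : qfaithful th t -> faithful th (esubst t x).
Proof.
case=> h1 h2 h3 h4; case: x => [[[s [i j]] [k l]]|] //.
by apply: faithfulN; apply: faithfulM; apply: faithfulM; apply: faithfulX.
Qed.

Lemma faithful_cell th : qfaithful th (cell_subst (cell_of th)).
Proof.
have F g u : (eval th g.1, eval th g.2) = u ->
    faithful th (quarter_subst g (quarter_of u)).1 /\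
    faithful th (quarter_subst g (quarter_of u)).2.
  rewrite /quarter_of => <- /=.
  have [s0|s0] := eqVneq; first by split=> //; apply: faithfulN; apply: faithful1.
  have [c0|c0] := eqVneq; first by split=> //; apply: faithfulN; apply: faithful1.
  by split=> /eqP; rewrite (negPf s0, negPf c0).
have [|h1 h2] := F gen.1 th.1; first by rewrite eval_cos1 eval_sin1; case: (th.1).
have [|h3 h4] := F gen.2 th.2; first by rewrite eval_cos2 eval_sin2; case: (th.2).
by [].
Qed.

Lemma qfaithful_read th t S sl : qfaithful th t ->
  qfaithful th (qmap (sread (smap (esubst t) S)) sl).
Proof.
move=> ft; have F r : faithful th (sread (smap (esubst t) S) r).
  by rewrite /sread sget_smap //; apply: faithfulN; apply: faithful_subst.
by split; apply: F.
Qed.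

Lemma surely_differP th x y : faithful th x -> faithful th y ->
  surely_differ x y -> eval th x <> eval th y.
Proof.
rewrite /surely_differ => fx fy; case: x fx => [x|] fx; last first.
  by move=> /enullP ny /esym /fy.
case/orP => [/enullP ->|/eqeP]; first by move=> /fx.
move=> e; rewrite [in RHS](_ : y = eopp true (Some x)); last first.
  by rewrite [Some x]e; case: y {e fy} => [[[[] p] q]|].
rewrite evalN expr1 mulN1r => /eqP; rewrite -subr_eq0 opprK -mulr2n mulrn_eq0 /=.
by move=> /eqP /fx.
Qed.

Lemma same_up_to_sign_sqr th x y : same_up_to_sign x y -> eval th x ^+ 2 = eval th y ^+ 2.
Proof. by case/orP => /eqeP -> //; rewrite evalN expr1 mulN1r sqrrN. Qed.

Lemma unit_pair_circle th x y : torus2 th -> unit_pair x y -> circle (eval th x, eval th y).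
Proof.
move=> [h1 h2]; rewrite /unit_pair /circle /= orbF.
have g1 : eval th cos1 ^+ 2 + eval th sin1 ^+ 2 = 1 by rewrite eval_cos1 eval_sin1.
have g2 : eval th cos2 ^+ 2 + eval th sin2 ^+ 2 = 1 by rewrite eval_cos2 eval_sin2.
case/or4P.
- by case/andP => /(same_up_to_sign_sqr th) -> /enullP ->; rewrite eval1 expr1n expr0n addr0.
- by case/andP => /(same_up_to_sign_sqr th) -> /enullP ->; rewrite eval1 expr1n expr0n add0r.
- case/orP => /andP [/(same_up_to_sign_sqr th) -> /(same_up_to_sign_sqr th) ->] //.
  by rewrite addrC.
- case/orP => /andP [/(same_up_to_sign_sqr th) -> /(same_up_to_sign_sqr th) ->] //.
  by rewrite addrC.
Qed.

Lemma smx_inP th S T : torus2 th -> readable S -> smx_in S (angle_slots S) T ->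
  simage S (mxval th T).
Proof.
move=> hth rS /and3P [u1 u2 /all5P e]; set t := qmap _ _ in u1 u2 e.
exists (qmap (eval th) t); first by split; apply: unit_pair_circle.
apply/matrixP => i j; have /eqeP eij := e _ _ (ltn_ord i) (ltn_ord j).
by rewrite !mxvalE eij eval_subst.
Qed.

Lemma circle_neq0 th x y : circle (eval th x, eval th y) -> x = None -> y = None -> False.
Proof.
by rewrite /circle /= => + x0 y0; rewrite x0 y0 /eval expr0n addr0 => /eqP; rewrite eq_sym oner_eq0.
Qed.

Lemma smx_outP th S T (M := cell_smx T (cell_of th)) : readable S ->
  smx_out S (angle_slots S) M -> ~ simage S (mxval th M).
Proof.
move=> rS out /(simageP _ rS); rewrite angles_mxval ?readable_slots //.
have := qfaithful_read T (angle_slots S) (faithful_cell th); rewrite -/(cell_smx _ _) -/M.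
move: out; rewrite /smx_out; set t := qmap _ _ => + ft [tt eM].
case/or3P => [|/andP [/enullP n1 /enullP n2]|/andP [/enullP n1 /enullP n2]]; last 2 first.
- exact: (circle_neq0 tt.1 n1 n2).
- exact: (circle_neq0 tt.2 n1 n2).
case/negP; apply/all5P => i j hi hj; apply/negP.
have fM : faithful th (sget M i j).
  by rewrite sget_smap //; apply: faithful_subst; apply: faithful_cell.
move/(surely_differP fM (faithful_subst (x := _) ft)); apply.
have /matrixP /(_ (Ordinal hi) (Ordinal hj)) := eM.
by rewrite !mxvalE /= eval_subst.
Qed.

End Evaluation.

(** * Zariski-closed sets and chains *)

Section AffineGeometry.
Context (K : fieldType) (m n : nat).
Implicit Types (X Y : set 'M[K]_(m, n)) (p q : {mpoly K[m * n]}) (M : 'M[K]_(m, n)).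

Lemma mxevalD p q M : mxeval (p + q) M = mxeval p M + mxeval q M.
Proof. exact: mevalD. Qed.
Lemma mxevalB p q M : mxeval (p - q) M = mxeval p M - mxeval q M.
Proof. exact: mevalB. Qed.
Lemma mxevalM p q M : mxeval (p * q) M = mxeval p M * mxeval q M.
Proof. exact: mevalM. Qed.
Lemma mxevalZ a p M : mxeval (a *: p) M = a * mxeval p M.
Proof. exact: mevalZ. Qed.
Lemma mxevalC a M : mxeval a%:MP M = a.
Proof. exact: mevalC. Qed.
Lemma mxeval1 M : mxeval 1 M = 1.
Proof. exact: meval1. Qed.
Lemma mxeval_sum I (r : seq I) (P : pred I) (F : I -> {mpoly K[m * n]}) M :
  mxeval (\sum_(i <- r | P i) F i) M = \sum_(i <- r | P i) mxeval (F i) M.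
Proof. exact: (raddf_sum (meval _)). Qed.
Lemma mxevalXn p k M : mxeval (p ^+ k) M = mxeval p M ^+ k.
Proof. exact: (rmorphXn (meval _)). Qed.

Definition coordX (i : 'I_m) (j : 'I_n) : {mpoly K[m * n]} := 'X_(mxvec_index i j).
Lemma mxevalX i j M : mxeval (coordX i j) M = M i j.
Proof. by rewrite /mxeval mevalXU mxvecE. Qed.

Lemma msize_scale a p s : (msize p <= s)%N -> (msize (a *: p) <= s)%N.
Proof. by apply: leq_trans; rewrite msizeZ_le. Qed.
Lemma msize_add p q s : (msize p <= s)%N -> (msize q <= s)%N -> (msize (p + q) <= s)%N.
Proof. by move=> hp hq; apply: leq_trans (msizeD_le _ _) _; rewrite geq_max hp. Qed.
Lemma msize_mul p q s t :
  (msize p <= s.+1)%N -> (msize q <= t.+1)%N -> (msize (p * q) <= (s + t).+1)%N.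
Proof.
move=> hp hq; have [->|p0] := eqVneq p 0; first by rewrite mul0r msize0.
have [->|q0] := eqVneq q 0; first by rewrite mulr0 msize0.
rewrite msizeM //; move: (msize p) (msize q) hp hq => a b.
by lia.
Qed.

Definition polynomial_fun (f : 'M[K]_(m, n) -> K) := exists p, forall M, f M = mxeval p M.

Lemma polynomial_entry i j : polynomial_fun (fun M => M i j).
Proof. by exists (coordX i j) => M; rewrite mxevalX. Qed.
Lemma polynomial_cst a : polynomial_fun (fun=> a).
Proof. by exists a%:MP => M; rewrite mxevalC. Qed.
Lemma polynomialD f g : polynomial_fun f -> polynomial_fun g -> polynomial_fun (fun M => f M + g M).
Proof. by move=> [p hp] [q hq]; exists (p + q) => M; rewrite mxevalD hp hq. Qed.
Lemma polynomialM f g : polynomial_fun f -> polynomial_fun g -> polynomial_fun (fun M => f M * g M).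
Proof. by move=> [p hp] [q hq]; exists (p * q) => M; rewrite mxevalM hp hq. Qed.
Lemma polynomialX f k : polynomial_fun f -> polynomial_fun (fun M => f M ^+ k).
Proof. by move=> [p hp]; exists (p ^+ k) => M; rewrite mxevalXn hp. Qed.

Lemma zclosed_eq f g : polynomial_fun f -> polynomial_fun g -> zclosed [set M | f M = g M].
Proof.
move=> [p hp] [q hq]; exists [set (p - q)]; apply/seteqP; split=> M /=.
  by move=> e r ->; rewrite mxevalB -hp -hq e subrr.
by move=> /(_ _ erefl) /eqP; rewrite mxevalB -hp -hq subr_eq0 => /eqP.
Qed.

Lemma zclosedI X Y : zclosed X -> zclosed Y -> zclosed (X `&` Y).
Proof.
move=> [S ->] [S' ->]; exists (S `|` S'); apply/seteqP; split=> M /=.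
  by move=> [h h'] p [/h|/h'].
by move=> h; split=> p hp; apply: h; [left|right].
Qed.

Lemma zclosed_forall I (F : I -> set 'M[K]_(m, n)) :
  (forall i, zclosed (F i)) -> zclosed [set M | forall i, F i M].
Proof.
move=> hF; have [S hS] := choice hF.
exists (\bigcup_i S i); apply/seteqP; split=> M /= h.
  by move=> p [i _ hp]; have := h i; rewrite hS => /(_ _ hp).
by move=> i; rewrite hS => p hp; apply: h; exists i.
Qed.

Lemma zclosed0 : zclosed (set0 : set 'M[K]_(m, n)).
Proof.
exists [set 1]; apply/seteqP; split=> M //= /(_ _ erefl) /eqP.
by rewrite mxeval1 oner_eq0.
Qed.

Lemma zclosedU X Y : zclosed X -> zclosed Y -> zclosed (X `|` Y).
Proof.
move=> [S ->] [S' ->]; exists [set pq.1 * pq.2 | pq in S `*` S'].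
apply/seteqP; split=> M /=.
  by move=> [h|h] _ [[p q] /= [hp hq] <-]; rewrite mxevalM; [rewrite (h p hp) mul0r|rewrite (h q hq) mulr0].
move=> h; have [|/existsNP [p /not_implyP [hp np]]] := EM (zeros S M); first by left.
right=> q hq; apply/eqP; have /eqP := h _ (ex_intro2 _ _ (p, q) (conj hp hq) erefl).
by rewrite mxevalM mulf_eq0 => /orP[/eqP/np|].
Qed.

Lemma zclosed_bigU (I : eqType) (r : seq I) (F : I -> set 'M[K]_(m, n)) :
  (forall i, zclosed (F i)) -> zclosed [set M | exists2 i, i \in r & F i M].
Proof.
move=> hF; elim: r => [|i r ih].
  rewrite [X in zclosed X](_ : _ = set0); first exact: zclosed0.
  by apply/seteqP; split=> M // [].
rewrite [X in zclosed X](_ : _ = F i `|` [set M | exists2 i, i \in r & F i M]).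
  exact: zclosedU.
apply/seteqP; split=> M /=.
  by move=> [j]; rewrite inE => /predU1P [->|jr] h; [left|right; exists j].
by move=> [h|[j jr h]]; [exists i; rewrite ?mem_head|exists j; rewrite // inE jr orbT].
Qed.

Lemma zirreducible_sub_bigU (I : eqType) (r : seq I) (F : I -> set 'M[K]_(m, n)) Y :
  (forall i, zclosed (F i)) -> zirreducible Y ->
  Y `<=` [set M | exists2 i, i \in r & F i M] -> exists2 i, i \in r & Y `<=` F i.
Proof.
move=> hF [Y0 irrY]; elim: r => [|i r ih] sub.
  by have [M /sub []] := Y0.
have [|sYi|/ih [j jr sYj]] := irrY _ _ (hF i) (zclosed_bigU r hF).
- move=> M /sub /= [j]; rewrite inE => /predU1P [->|jr] h; [by left|by right; exists j].
- by exists i; rewrite ?mem_head.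
- by exists j; rewrite // inE jr orbT.
Qed.

Lemma zirreducibleP Y : Y !=set0 ->
  (forall p q, vanishes_on (p * q) Y -> vanishes_on p Y \/ vanishes_on q Y) <-> zirreducible Y.
Proof.
move=> Y0; split=> [dom|[_ irr] p q pq].
  split=> // _ _ [S1 ->] [S2 ->] sub.
  have [|/existsNP[M1 /not_implyP[YM1 /existsNP[p /not_implyP[S1p np]]]]] :=
    EM (Y `<=` zeros S1); first by left.
  right=> M YM q S2q; have [|vp|vq] := dom p q; last exact: vq.
    move=> N YN; rewrite mxevalM; have [/(_ _ S1p)->|/(_ _ S2q)->] := sub _ YN.
      by rewrite mul0r.
    by rewrite mulr0.
  by case: np; apply: vp.
have zc (r : {mpoly K[m * n]}) : @zclosed K m n [set M | mxeval r M = 0].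
  exact: (@zclosed_eq (mxeval r) (fun=> 0) (ex_intro _ r (fun=> erefl)) (polynomial_cst 0)).
apply: (irr _ _ (zc p) (zc q)) => M /pq /= /eqP; rewrite mxevalM mulf_eq0.
by case/orP=> /eqP; [left|right].
Qed.

Lemma zirreducible_mul Y p q : zirreducible Y ->
  vanishes_on (p * q) Y -> vanishes_on p Y \/ vanishes_on q Y.
Proof. by move=> irr; apply: (zirreducibleP irr.1).2. Qed.

Lemma zclosed_separation Y Y' : zclosed Y -> Y `<` Y' ->
  exists2 p, vanishes_on p Y & ~ vanishes_on p Y'.
Proof.
move=> [S ->] [_ /existsNP[M /not_implyP[Y'M /existsNP[p /not_implyP[Sp np]]]]].
by exists p => [N /(_ _ Sp)|/(_ _ Y'M)].
Qed.

(* If f vanishes on Y but not on the irreducible Y', restricting a relation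
   \sum f^a h_a = 0 on Y' to Y kills h_0, after which f can be cancelled. *)
Lemma independent_powers Y Y' (U : finType) (g : U -> {mpoly K[m * n]}) f k :
  Y `<=` Y' -> zirreducible Y' -> vanishes_on f Y -> ~ vanishes_on f Y' ->
  (forall c : U -> K, vanishes_on (\sum_u c u *: g u) Y -> forall u, c u = 0) ->
  forall c : U * 'I_k -> K,
    vanishes_on (\sum_ua c ua *: (g ua.1 * f ^+ ua.2)) Y' -> forall ua, c ua = 0.
Proof.
move=> sub irr fY fY' gind; elim: k => [|k ih] c hc [u a]; first by case: a.
pose h0 := \sum_u c (u, ord0) *: g u.
pose h1 := \sum_(ua : U * 'I_k) c (ua.1, lift ord0 ua.2) *: (g ua.1 * f ^+ ua.2).
have E : \sum_ua c ua *: (g ua.1 * f ^+ ua.2) = h0 + f * h1.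
  have pairE l (c' : U * 'I_l -> K) : \sum_ua c' ua *: (g ua.1 * f ^+ ua.2) =
      \sum_u \sum_a c' (u, a) *: (g u * f ^+ a).
    by rewrite pair_bigA; apply: eq_bigr => -[].
  rewrite pairE /h1 (pairE _ (fun ua => c (ua.1, lift ord0 ua.2))).
  rewrite mulr_sumr -big_split; apply: eq_bigr => v _.
  rewrite big_ord_recl expr0 mulr1 mulr_sumr; congr (_ + _); apply: eq_bigr => b _.
  by rewrite /= -scalerAr /bump leq0n add1n exprS mulrCA.
have h0Y : vanishes_on h0 Y.
  by move=> M YM; have := hc _ (sub _ YM); rewrite E mxevalD mxevalM (fY _ YM) mul0r addr0.
have c0 v : c (v, ord0) = 0 := gind (fun u => c (u, ord0)) h0Y v.
have h0E : h0 = 0 by rewrite /h0 big1 // => v _; rewrite c0 scale0r.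
have [|/fY' //|h1Y] := @zirreducible_mul Y' f h1 irr; first by rewrite -[f * _]add0r -{1}h0E -E.
have [b ->|->] := unliftP ord0 a; last by apply: c0.
exact: (ih (fun ub => c (ub.1, lift ord0 ub.2)) h1Y (u, b)).
Qed.

Lemma chain_independent (Z : nat -> set 'M[K]_(m, n)) d :
  (forall i, (i <= d)%N -> zclosed (Z i) /\ zirreducible (Z i)) ->
  (forall i, (i < d)%N -> Z i `<` Z i.+1) ->
  exists D, forall k, exists (U : finType) (g : U -> {mpoly K[m * n]}),
    [/\ #|U| = (k ^ d)%N, forall u, (msize (g u) <= (D * k).+1)%N
      & forall c : U -> K, vanishes_on (\sum_u c u *: g u) (Z d) -> forall u, c u = 0].
Proof.
elim: d => [|d ih] hZ sZ.
  have [_ [[M0 hM0] _]] := hZ 0 (leqnn 0).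
  exists 0%N => k; exists unit, (fun=> 1); split.
  - by rewrite card_unit.
  - by move=> _; rewrite msize1.
  - move=> c /(_ _ hM0); rewrite mxeval_sum (bigD1 tt) //= big1 ?addr0; last by case.
    by rewrite mxevalZ mxeval1 mulr1 => + [].
have [D hD] := ih (fun i hi => hZ i (leqW hi)) (fun i hi => sZ i (leqW hi)).
have [f fY fY'] := zclosed_separation (hZ d (leqW (leqnn d))).1 (sZ d (leqnn _)).
exists (D + msize f)%N => k; have [U [g [cU gs gind]]] := hD k.
exists (U * 'I_k)%type, (fun ua : U * 'I_k => g ua.1 * f ^+ ua.2); split.
- by rewrite card_prod cU card_ord expnSr.
- move=> [u a] /=; rewrite mulnDl; apply: msize_mul (gs u) _.
  have sf e : (msize (f ^+ e) <= (e * msize f).+1)%N.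
    elim: e => [|e ihe]; first by rewrite expr0 msize1.
    by rewrite exprS mulSn; apply: msize_mul ihe; apply: leqnSn.
  by apply: leq_trans (sf _) _; rewrite ltnS mulnC leq_mul2l ltnW ?orbT.
- by apply: independent_powers gind => //; [case: (sZ d (leqnn _))|case: (hZ d.+1 (leqnn _))].
Qed.

Definition growth X (d : nat) := exists A : nat, forall s : nat,
  exists (k : nat) (b : 'I_k -> 'M[K]_(m, n) -> K), (k <= A * s.+1 ^ d)%N /\
    forall p, (msize p <= s.+1)%N ->
      exists c : 'I_k -> K, forall M, X M -> mxeval p M = \sum_i c i * b i M.

Lemma growth_no_chain X d : growth X d -> ~ has_chain X d.+1.
Proof.
move=> [A hA] [Z [hZ sZ]].
have [||D hD] := @chain_independent Z d.+1.
- by move=> i /hZ [].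
- exact: sZ.
pose k := (A * D.+1 ^ d).+1.
have [U [g [cU gs gind]]] := hD k.
have [N [b [leN hb]]] := hA (D * k)%N.
have ltN : (N < #|U|)%N.
  rewrite cU; apply: leq_ltn_trans leN _.
  apply: (@leq_ltn_trans (A * (D.+1 * k) ^ d)%N).
    rewrite leq_mul2l; apply/orP; right.
    have le : ((D * k).+1 <= D.+1 * k)%N by rewrite mulSn /k addSn ltnS leq_addl.
    by case: (d) => [|d']; rewrite ?expn0 // leq_exp2r.
  by rewrite expnMn mulnA expnS ltn_mul2r expn_gt0 /= /k ltnS leqnn.
have /choice [c hc] u := hb (g u) (gs u).
pose C := \matrix_(i < #|U|, j < N) c (enum_val i) j.
have : kermx C != 0.
  rewrite kermx_eq0; apply: contraTN ltN => /eqP rk.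
  by rewrite -leqNgt -rk rank_leq_col.
case/matrix0Pn => i [j].
pose v u := kermx C i (enum_rank u).
have vC l : \sum_u v u * c u l = 0.
  transitivity ((kermx C *m C) i l); last by rewrite mulmx_ker mxE.
  rewrite mxE.
  rewrite [RHS](reindex enum_rank) /=; last by apply: onW_bij; exact: enum_rank_bij.
  by apply: eq_bigr => u _; rewrite [C _ _]mxE enum_rankK.
have /(_ (enum_val j)) : forall u, v u = 0.
  apply: gind => M ZM; rewrite mxeval_sum.
  have XM : X M by have [_ _] := hZ _ (leqnn d.+1); apply.
  under eq_bigr => u _ do rewrite mxevalZ hc // mulr_sumr.
  rewrite exchange_big /= big1 // => l _.
  by under eq_bigr => u _ do rewrite mulrA; rewrite -mulr_suml vC mul0r.
by rewrite /v enum_valK => ->; rewrite eqxx.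
Qed.

Lemma growthU X Y d : growth X d -> growth Y d -> growth (X `|` Y) d.
Proof.
move=> [A hA] [B hB]; exists (A + B)%N => s.
have [k [b [hk hb]]] := hA s; have [l [b' [hl hb']]] := hB s.
exists (k + l)%N, (fun (i : 'I_(k + l)) M => match fintype.split i with
  | inl j => if `[<X M>] then b j M else 0
  | inr j => if `[<X M>] then 0 else b' j M end).
split=> [|p hp]; first by rewrite mulnDl leq_add.
have [c hc] := hb p hp; have [c' hc'] := hb' p hp.
exists (fun i : 'I_(k + l) => match fintype.split i with inl j => c j | inr j => c' j end) => M XYM.
rewrite big_split_ord /=.
under eq_bigr => i _ do rewrite -[lshift l i]/(unsplit (inl i)) unsplitK.
under [X in _ + X]eq_bigr => i _ do rewrite -[rshift k i]/(unsplit (inr i)) unsplitK.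
case: asboolP => [XM|nXM].
  by rewrite hc // [X in _ + X]big1 ?addr0 // => i _; rewrite mulr0.
rewrite [X in X + _]big1 ?add0r => [|i _]; last by rewrite mulr0.
by apply: hc'; case: XYM => [/nXM|].
Qed.

Lemma growth0 d : growth set0 d.
Proof. by exists 0%N => s; exists 0%N, (fun _ _ => 0); split=> // p _; exists (fun=> 0). Qed.

Lemma growth1 M d : growth [set M] d.
Proof.
exists 1%N => s; exists 1%N, (fun _ _ => 1); split; first by rewrite mul1n expn_gt0.
by move=> p _; exists (fun=> mxeval p M) => N ->; rewrite big_ord1 mulr1.
Qed.

Lemma growth_bigU (I : eqType) (r : seq I) (F : I -> set 'M[K]_(m, n)) d :
  (forall i, i \in r -> growth (F i) d) -> growth [set M | exists2 i, i \in r & F i M] d.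
Proof.
elim: r => [|i r ih] hF.
  rewrite [X in growth X](_ : _ = set0); first exact: growth0.
  by apply/seteqP; split=> M // [].
rewrite [X in growth X](_ : _ = F i `|` [set M | exists2 i, i \in r & F i M]).
  apply: growthU; first by apply: hF; rewrite mem_head.
  by apply: ih => j jr; apply: hF; rewrite inE jr orbT.
apply/seteqP; split=> M /=.
  by move=> [j]; rewrite inE => /predU1P [->|jr] h; [left|right; exists j].
by move=> [h|[j jr h]]; [exists i; rewrite ?mem_head|exists j; rewrite // inE jr orbT].
Qed.

Lemma growth_finite X : finite_set X -> growth X 0.
Proof.
move=> /finite_seqP [r ->].
rewrite [X in growth X](_ : _ = [set M | exists2 N, N \in r & [set N] M]).
  by apply: growth_bigU => N _; exact: growth1.
by apply/seteqP; split=> M /=; [exists M|move=> [N + ->]].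
Qed.

Lemma has_chain_sub X Y d : X `<=` Y -> has_chain X d -> has_chain Y d.
Proof.
move=> sub [Z [hZ sZ]]; exists Z; split=> // i /hZ [? ? ZX]; split=> //.
exact: subset_trans sub.
Qed.

Lemma finite_no_curve X : finite_set X -> ~ has_chain X 1.
Proof. by move=> /growth_finite /growth_no_chain. Qed.

End AffineGeometry.

(** * Laurent polynomials on the torus *)

Section Laurent.
Context (R : realType).
Local Notation C := (complex R).
Implicit Types (u v : R * R) (th : quad R).

Local Notation C2 := {poly {poly complex R}}.

Definition zof u : C := Complex u.1 u.2.

Lemma zof_inj : injective zof.
Proof. by move=> [a b] [c d] [-> ->]. Qed.

Lemma zof_conj u : circle u -> zof u * Complex u.1 (- u.2) = 1.
Proof.
rewrite /circle /= => hu; apply/eqP; rewrite eq_complex /=; apply/andP; split; apply/eqP.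
  by rewrite -hu; ring.
by ring.
Qed.

Lemma zof_neq0 u : circle u -> zof u != 0.
Proof. by move=> /zof_conj e; apply/eqP => z0; move/eqP: e; rewrite z0 mul0r eq_sym oner_eq0. Qed.

Lemma zofV u : circle u -> (zof u)^-1 = Complex u.1 (- u.2).
Proof. by move=> hu; apply: (mulfI (zof_neq0 hu)); rewrite zof_conj // mulfV ?zof_neq0. Qed.

Definition circle_pt (n : nat) : R * R :=
  ((1 - n%:R ^+ 2) / (1 + n%:R ^+ 2), 2 * n%:R / (1 + n%:R ^+ 2)).

Lemma circle_ptP n : circle (circle_pt n).
Proof.
have h : 1 + n%:R ^+ 2 != 0 :> R by rewrite gt_eqF // ltr_wpDr ?sqr_ge0.
by rewrite /circle /=; field.
Qed.

Lemma circle_pt_inj : injective circle_pt.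
Proof.
have h (n : nat) : 1 + n%:R ^+ 2 != 0 :> R by rewrite gt_eqF // ltr_wpDr ?sqr_ge0.
move=> n k e.
have E (i : nat) : (circle_pt i).2 / (1 + (circle_pt i).1) = i%:R.
  have ? := h i; have -> : 1 + (circle_pt i).1 = 2 / (1 + i%:R ^+ 2) by rewrite /=; field.
  by rewrite /=; field.
by apply/eqP; rewrite -(eqr_nat R) -(E n) -(E k) e.
Qed.

Lemma poly_circle_eq0 (p : {poly C}) : (forall u, circle u -> p.[zof u] = 0) -> p = 0.
Proof.
move=> h; apply/eqP; apply/negP => /negP p0.
have := @max_poly_roots _ p [seq zof (circle_pt n) | n <- iota 0 (size p)] p0.
rewrite size_map size_iota ltnn => F; apply: notF; apply: F.
  by apply/allP => _ /mapP [n _ ->]; rewrite /root h //; exact: circle_ptP.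
by rewrite map_inj_uniq ?iota_uniq //; apply: inj_comp circle_pt_inj; apply: zof_inj.
Qed.

Definition eval2 (Q : C2) th : C := (Q.[(zof th.2)%:P]).[zof th.1].

Lemma eval2D Q Q' th : eval2 (Q + Q') th = eval2 Q th + eval2 Q' th.
Proof. by rewrite /eval2 !hornerD. Qed.
Lemma eval2M Q Q' th : eval2 (Q * Q') th = eval2 Q th * eval2 Q' th.
Proof. by rewrite /eval2 !hornerM. Qed.
Definition monomial2 (a : C) (i j : nat) : C2 := (a *: 'X^i) *: 'X^j.
Lemma eval2_monomial a i j th : eval2 (monomial2 a i j) th = a * (zof th.1 ^+ i * zof th.2 ^+ j).
Proof.
by rewrite /eval2 /monomial2 hornerZ hornerXn -polyC_exp hornerM hornerC hornerZ hornerXn mulrA.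
Qed.

Lemma eval2_eq0 (Q : C2) : (forall th, torus2 th -> eval2 Q th = 0) -> Q = 0.
Proof.
move=> h.
have hQ u : circle u -> Q.[(zof u)%:P] = 0.
  by move=> hu; apply: poly_circle_eq0 => v hv; exact: (h (v, u) (conj hv hu)).
apply/polyP => j; rewrite coef0; apply/polyP => i; rewrite coef0.
have : \poly_(j < size Q) Q`_j`_i = 0 :> {poly C}.
  apply: poly_circle_eq0 => u /hQ /(congr1 (fun p : {poly C} => p`_i)).
  rewrite coef0 => e; rewrite -[RHS]e horner_poly horner_coef coef_sum.
  by apply: eq_bigr => k _; rewrite -polyC_exp coefMC.
move/(congr1 (fun p : {poly C} => p`_j)); rewrite coef0 coef_poly.
by case: ltnP => // hj _; rewrite [Q`_j]nth_default // coef0.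
Qed.

Definition laurent (g : quad R -> C) := exists N (Q : C2),
  forall th, torus2 th -> g th * (zof th.1 ^+ N * zof th.2 ^+ N) = eval2 Q th.

Lemma zpow_neq0 th i j : torus2 th -> zof th.1 ^+ i * zof th.2 ^+ j != 0.
Proof. by move=> [h1 h2]; rewrite mulf_neq0 ?expf_neq0 ?zof_neq0. Qed.

Lemma laurent_mul_eq0 g h : laurent g -> laurent h ->
  (forall th, torus2 th -> g th * h th = 0) ->
  (forall th, torus2 th -> g th = 0) \/ (forall th, torus2 th -> h th = 0).
Proof.
move=> [N [Q hQ]] [N' [Q' hQ']] gh.
have : Q * Q' = 0.
  apply: eval2_eq0 => th hth; rewrite eval2M -hQ // -hQ' //.
  by rewrite mulrACA gh // mul0r.
move/eqP; rewrite mulf_eq0 => /orP [/eqP Q0|/eqP Q0]; [left|right] => th hth; apply/eqP.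
  have /eqP := hQ th hth; rewrite Q0 /eval2 !horner0 mulf_eq0.
  by rewrite (negPf (zpow_neq0 _ _ hth)) orbF.
have /eqP := hQ' th hth; rewrite Q0 /eval2 !horner0 mulf_eq0.
by rewrite (negPf (zpow_neq0 _ _ hth)) orbF.
Qed.

Definition lmon (x : int * int) th : C := zof th.1 ^ x.1 * zof th.2 ^ x.2.

Lemma lmonD x y th : torus2 th -> lmon (x + y) th = lmon x th * lmon y th.
Proof. by move=> [h1 h2]; rewrite /lmon !expfzDr ?zof_neq0 // mulrACA. Qed.

Lemma lmon0 th : lmon 0 th = 1.
Proof. by rewrite /lmon !expr0z mulr1. Qed.

Definition bounded_exponents (N : nat) (x : int * int) := (`|x.1| <= N)%N && (`|x.2| <= N)%N.

Lemma lmon_shift N x th : torus2 th -> bounded_exponents N x ->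
  lmon x th * (zof th.1 ^+ N * zof th.2 ^+ N) =
  zof th.1 ^+ (absz (x.1 + N%:Z)%R) * zof th.2 ^+ (absz (x.2 + N%:Z)%R).
Proof.
move=> [h1 h2] /andP [b1 b2].
have e1 : (absz (x.1 + N%:Z)%R) = x.1 + N%:Z :> int by lia.
have e2 : (absz (x.2 + N%:Z)%R) = x.2 + N%:Z :> int by lia.
by rewrite /lmon mulrACA !exprnP e1 e2 !expfzDr ?zof_neq0.
Qed.

Lemma exponents_bounded (E : seq (int * int)) : exists N, all (bounded_exponents N) E.
Proof.
exists (\sum_(x <- E) (`|x.1| + `|x.2|))%N; apply/allP => x xE.
by rewrite /bounded_exponents (big_rem _ xE) /=; lia.
Qed.

Definition spanL (E : seq (int * int)) (g : quad R -> C) := exists c : int * int -> C,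
  forall th, torus2 th -> g th = \sum_(x <- E) c x * lmon x th.

Definition shift_poly N (E : seq (int * int)) (c : int * int -> C) : C2 :=
  \sum_(x <- E) monomial2 (c x) (absz (x.1 + N%:Z)%R) (absz (x.2 + N%:Z)%R).

Lemma eval2_shift_poly N E c th : torus2 th -> all (bounded_exponents N) E ->
  (\sum_(x <- E) c x * lmon x th) * (zof th.1 ^+ N * zof th.2 ^+ N) =
  eval2 (shift_poly N E c) th.
Proof.
move=> hth; rewrite /shift_poly; elim: E => [|x E ih] /=.
  by rewrite !big_nil mul0r /eval2 !horner0.
case/andP => bx bE; rewrite !big_cons mulrDl eval2D -ih // eval2_monomial; congr (_ + _).
by rewrite -mulrA lmon_shift.
Qed.

Lemma spanL_laurent E g : spanL E g -> laurent g.
Proof.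
move=> [c hc]; have [N bN] := exponents_bounded E; exists N, (shift_poly N E c) => th hth.
by rewrite hc // eval2_shift_poly.
Qed.

Lemma absz_shift_inj (N : nat) (a b : int) : (`|a| <= N)%N -> (`|b| <= N)%N ->
  absz (a + N%:Z) = absz (b + N%:Z) -> a = b.
Proof. by lia. Qed.

Lemma lmon_independent E (c : int * int -> C) : uniq E ->
  (forall th, torus2 th -> \sum_(x <- E) c x * lmon x th = 0) -> forall x, x \in E -> c x = 0.
Proof.
move=> uE h x xE; have [N bN] := exponents_bounded E.
have : shift_poly N E c = 0.
  by apply: eval2_eq0 => th hth; rewrite -eval2_shift_poly // h // mul0r.
move/(congr1 (fun Q : C2 => Q`_(absz (x.2 + N%:Z)%R)`_(absz (x.1 + N%:Z)%R))); rewrite !coef0 => <-.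
rewrite /shift_poly coef_sum coef_sum (bigD1_seq x) //= /monomial2.
rewrite !coefZ coefXn eqxx mulr1 coefZ coefXn eqxx mulr1 big1_seq ?addr0 // => y /andP [yx yE].
rewrite !coefZ coefXn; case: eqP => e2; last by rewrite mulr0 coef0.
rewrite mulr1 coefZ coefXn; case: eqP => e1; last by rewrite mulr0.
have [/andP [bx1 bx2] /andP [by1 by2]] := (allP bN x xE, allP bN y yE).
case/eqP: yx; rewrite [LHS]surjective_pairing [RHS]surjective_pairing.
by congr pair; [apply: (absz_shift_inj by1 bx1)|apply: (absz_shift_inj by2 bx2)].
Qed.

Lemma spanL_ext E g h : (forall th, torus2 th -> g th = h th) -> spanL E g -> spanL E h.
Proof. by move=> e [c hc]; exists c => th hth; rewrite -e ?hc. Qed.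

Lemma spanL0 E : spanL E (fun=> 0).
Proof. by exists (fun=> 0) => th _; rewrite big1 // => x _; rewrite mul0r. Qed.

Lemma spanLD E g h : spanL E g -> spanL E h -> spanL E (fun th => g th + h th).
Proof.
move=> [c hc] [d hd]; exists (fun x => c x + d x) => th hth.
by rewrite hc // hd // -big_split; apply: eq_bigr => x _; rewrite mulrDl.
Qed.

Lemma spanLZ E a g : spanL E g -> spanL E (fun th => a * g th).
Proof.
move=> [c hc]; exists (fun x => a * c x) => th hth.
by rewrite hc // mulr_sumr; apply: eq_bigr => x _; rewrite mulrA.
Qed.

Lemma spanL_sum E I (r : seq I) (F : I -> quad R -> C) :
  (forall i, spanL E (F i)) -> spanL E (fun th => \sum_(i <- r) F i th).
Proof.
move=> hF; elim: r => [|i r ih].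
  by apply: spanL_ext (spanL0 E) => th _; rewrite big_nil.
by apply: spanL_ext (spanLD (hF i) ih) => th _; rewrite big_cons.
Qed.

Lemma spanL_lmon E x : uniq E -> x \in E -> spanL E (lmon x).
Proof.
move=> uE xE; exists (fun y => (y == x)%:R) => th _.
rewrite (bigD1_seq x) //= eqxx mul1r big1 ?addr0 // => y /negPf ->.
by rewrite mul0r.
Qed.

Lemma spanL_sub E E' g : uniq E' -> {subset E <= E'} -> spanL E g -> spanL E' g.
Proof.
move=> uE' sE [c hc].
have h x : spanL E' (fun th => if x \in E then c x * lmon x th else 0).
  case xE: (x \in E); last exact: spanL0.
  by apply: spanLZ; apply: spanL_lmon => //; apply: sE.
by apply: spanL_ext (spanL_sum E h) => th hth; rewrite hc // [RHS]big_seq [RHS]big_mkcond.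
Qed.

Lemma spanLM E E' E'' g h : uniq E'' ->
  (forall x y, x \in E -> y \in E' -> x + y \in E'') ->
  spanL E g -> spanL E' h -> spanL E'' (fun th => g th * h th).
Proof.
move=> uE sE [c hc] [d hd].
have H x y : spanL E'' (fun th => if (x \in E) && (y \in E') then c x * d y * lmon (x + y) th else 0).
  case xy: (_ && _); last exact: spanL0.
  case/andP: xy => xE yE; by apply: spanLZ; apply: spanL_lmon => //; apply: sE.
apply: spanL_ext (spanL_sum E (fun x => spanL_sum E' (H x))) => th hth.
rewrite hc // hd // big_distrlr /= big_seq [RHS]big_seq; apply: eq_bigr => x xE.
rewrite big_seq [RHS]big_seq; apply: eq_bigr => y yE.
by rewrite xE yE /= lmonD // mulrACA.
Qed.

End Laurent.

Definition range (N : nat) : seq int := [seq (k%:Z - N%:Z)%R | k <- iota 0 N.*2.+1].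
Definition box (a b : nat) : seq (int * int) := [seq (i, j) | i <- range a, j <- range b].
Definition diamond (s : nat) : seq (int * int) :=
  [seq ((i + j)%:Z - s%:Z, i%:Z - j%:Z) | i <- iota 0 s.+1, j <- iota 0 s.+1] ++
  [seq ((i + j).+1%:Z - s%:Z, i%:Z - j%:Z) | i <- iota 0 s, j <- iota 0 s].

Lemma mem_range N (a : int) : (a \in range N) = (`|a| <= N)%N.
Proof.
apply/mapP/idP => [[k] + ->|h]; first by rewrite mem_iota; lia.
by exists (absz (a + N%:Z)); rewrite ?mem_iota; lia.
Qed.

Lemma range_uniq N : uniq (range N).
Proof. by rewrite map_inj_uniq ?iota_uniq // => i j; lia. Qed.

Lemma mem_box a b (x : int * int) : (x \in box a b) = (`|x.1| <= a)%N && (`|x.2| <= b)%N.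
Proof.
rewrite -!mem_range; apply/allpairsP/idP => [[[i j] /= [hi hj ->]]|/andP [h1 h2]].
  by rewrite /= hi hj.
by exists x; split=> //; case: (x).
Qed.

Lemma box_uniq a b : uniq (box a b).
Proof. by apply: allpairs_uniq; rewrite ?range_uniq // => -[i j] [i' j'] _ _ [-> ->]. Qed.

Lemma size_box a b : size (box a b) = (a.*2.+1 * b.*2.+1)%N.
Proof. by rewrite size_allpairs !size_map !size_iota. Qed.

Lemma mem_diamond s (x : int * int) : (x \in diamond s) = (`|x.1| + `|x.2| <= s)%N.
Proof.
rewrite /diamond mem_cat; case: x => a b; apply/orP/idP.
  by case=> /allpairsP [[i j] []]; rewrite !mem_iota /= => hi hj [-> ->]; lia.
move=> h0; have h : (`|a| + `|b| <= s)%N := h0; have [k [e|e]] : exists k : int, a + b + s%:Z = 2 * k \/ a + b + s%:Z = 2 * k + 1.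
- by exists ((a + b + s%:Z) %/ 2)%Z; lia.
- left; apply/allpairsP; exists (absz k, absz (k - b)).
  by rewrite !mem_iota /=; split; [lia|lia|congr pair; lia].
- right; apply/allpairsP; exists (absz k, absz (k - b)).
  by rewrite !mem_iota /=; split; [lia|lia|congr pair; lia].
Qed.

Lemma diamond_uniq s : uniq (diamond s).
Proof.
rewrite cat_uniq; apply/and3P; split.
- by apply: allpairs_uniq; rewrite ?iota_uniq // => -[i j] [i' j'] _ _ /= [e1 e2]; congr pair; lia.
- apply/hasPn => x /allpairsP [[i j] [_ _ ->]]; apply/negP => h.
  have /allpairsP [[i' j'] [_ _ /= []]] : _ \in _ := h.
  by lia.
- by apply: allpairs_uniq; rewrite ?iota_uniq // => -[i j] [i' j'] _ _ /= [e1 e2]; congr pair; lia.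
Qed.

Lemma size_diamond s : size (diamond s) = (s.+1 * s.+1 + s * s)%N.
Proof. by rewrite size_cat !size_allpairs !size_iota. Qed.

Record exponent_filtration (E : nat -> seq (int * int)) : Prop := ExponentFiltration {
  filtration_uniq : forall s, uniq (E s);
  filtration0 : forall s, 0 \in E s;
  filtrationD : forall s t x y, x \in E s -> y \in E t -> x + y \in E (s + t)%N }.

Lemma box_filtration a b : exponent_filtration (fun s => box (a * s) (b * s)).
Proof.
split=> [s|s|s t x y]; rewrite ?box_uniq ?mem_box //=.
by rewrite !mulnDr; case: x y => [x1 x2] [y1 y2] /=; lia.
Qed.

Lemma diamond_filtration : exponent_filtration diamond.
Proof.
split=> [s|s|s t [x1 x2] [y1 y2]]; rewrite ?diamond_uniq ?mem_diamond //=.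
by lia.
Qed.

Section TorusFunctions.
Context (R : realType).
Local Notation C := (complex R).
Implicit Types (th : quad R) (S : smx) (x : entry).

Definition cmx m n (M : 'M[R]_(m, n)) : 'M[C]_(m, n) := map_mx (real_complex R) M.

Lemma spanL_cst (a : C) E : uniq E -> 0 \in E -> @spanL R E (fun=> a).
Proof.
move=> uE E0; apply: spanL_ext (spanLZ a (spanL_lmon R uE E0)) => th _.
by rewrite lmon0 mulr1.
Qed.

Lemma zofX1 th : torus2 th ->
  [/\ zof th.1 ^ 1 = Complex th.1.1 th.1.2, zof th.1 ^ (-1) = Complex th.1.1 (- th.1.2),
      zof th.2 ^ 1 = Complex th.2.1 th.2.2 & zof th.2 ^ (-1) = Complex th.2.1 (- th.2.2)].
Proof.
move=> [h1 h2]; split; rewrite ?expr1z //.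
  by rewrite -[RHS](zofV h1).
by rewrite -[RHS](zofV h2).
Qed.

Lemma spanL_angles :
  [/\ @spanL R (box 1 0) (fun th => (th.1.1)%:C%C), @spanL R (box 1 0) (fun th => (th.1.2)%:C%C),
      @spanL R (box 0 1) (fun th => (th.2.1)%:C%C) & @spanL R (box 0 1) (fun th => (th.2.2)%:C%C)].
Proof.
have L a b (k : R * R) (x : int * int) : x \in box a b ->
    spanL (box a b) (fun th => Complex k.1 k.2 * lmon x th).
  by move=> h; apply: spanLZ; apply: spanL_lmon => //; apply: box_uniq.
split.
- apply: spanL_ext (spanLD (@L 1 0 (2^-1, 0) (1, 0) isT) (@L 1 0 (2^-1, 0) (-1, 0) isT)).
  move=> th /zofX1 [e1 e2 _ _]; rewrite /lmon e1 e2 expr0z !mulr1.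
  by apply/eqP; rewrite eq_complex /=; apply/andP; split; apply/eqP; field.
- apply: spanL_ext (spanLD (@L 1 0 (0, - 2^-1) (1, 0) isT) (@L 1 0 (0, 2^-1) (-1, 0) isT)).
  move=> th /zofX1 [e1 e2 _ _]; rewrite /lmon e1 e2 expr0z !mulr1.
  by apply/eqP; rewrite eq_complex /=; apply/andP; split; apply/eqP; field.
- apply: spanL_ext (spanLD (@L 0 1 (2^-1, 0) (0, 1) isT) (@L 0 1 (2^-1, 0) (0, -1) isT)).
  move=> th /zofX1 [_ _ e1 e2]; rewrite /lmon e1 e2 expr0z !mul1r.
  by apply/eqP; rewrite eq_complex /=; apply/andP; split; apply/eqP; field.
- apply: spanL_ext (spanLD (@L 0 1 (0, - 2^-1) (0, 1) isT) (@L 0 1 (0, 2^-1) (0, -1) isT)).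
  move=> th /zofX1 [_ _ e1 e2]; rewrite /lmon e1 e2 expr0z !mul1r.
  by apply/eqP; rewrite eq_complex /=; apply/andP; split; apply/eqP; field.
Qed.

Lemma spanL_boxM a b a' b' (g h : quad R -> C) :
  spanL (box a b) g -> spanL (box a' b') h -> spanL (box (a + a') (b + b')) (fun th => g th * h th).
Proof.
apply: spanLM; first exact: box_uniq.
by move=> [x1 x2] [y1 y2]; rewrite !mem_box /=; lia.
Qed.

Lemma spanL_boxX a b (g : quad R -> C) n :
  spanL (box a b) g -> spanL (box (a * n) (b * n)) (fun th => g th ^+ n).
Proof.
move=> hg; elim: n => [|n ih].
  by rewrite !muln0; apply: spanL_ext (spanL_cst 1 (box_uniq 0 0) _) => // th; rewrite expr0.
rewrite !mulnS; apply: spanL_ext (spanL_boxM hg ih) => th _; by rewrite exprS.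
Qed.

Definition degrees x : nat * nat :=
  if x is Some (_, (i, j), (k, l)) then (i + j, k + l)%N else (0, 0)%N.

Lemma spanL_eval x :
  spanL (box (degrees x).1 (degrees x).2) (fun th => (eval th x)%:C%C).
Proof.
case: x => [[[b [i j]] [k l]]|] /=; last exact: spanL0.
have [c1 s1 c2 s2] := spanL_angles.
have := spanL_boxM (spanL_boxM (spanL_boxX i c1) (spanL_boxX j s1))
                   (spanL_boxM (spanL_boxX k c2) (spanL_boxX l s2)).
rewrite !mul0n !mul1n !addn0 !add0n => /(spanLZ ((-1) ^+ b)); apply: spanL_ext => th _.
by rewrite /eval !(rmorphM, rmorphXn) /= rmorphN1.
Qed.

Definition within S (E : seq (int * int)) :=
  forall i j, (i < 5)%N -> (j < 5)%N ->
  {subset box (degrees (sget S i j)).1 (degrees (sget S i j)).2 <= E}.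

Lemma spanL_mxval S E (i j : 'I_5) : uniq E -> within S E ->
  spanL E (fun th => (mxval th S i j)%:C%C).
Proof.
move=> uE sE; apply: spanL_ext (spanL_sub uE (sE i j _ _) (spanL_eval _)) => // th _.
by rewrite mxvalE.
Qed.

Section Pullback.
Variables (S : smx) (E : nat -> seq (int * int)).
Hypotheses (fE : exponent_filtration E) (wS : within S (E 1%N)).
Let uE := filtration_uniq fE.

Lemma spanL_monomial s (m : 'X_{1.. 5 * 5}) : (mdeg m <= s)%N ->
  spanL (E s) (fun th => \prod_k mxvec (cmx (mxval th S)) 0 k ^+ m k).
Proof.
move=> dm; pose v th (k : 'I_(5 * 5)) : C := mxvec (cmx (mxval th S)) 0 k.
have hv k : spanL (E 1%N) (v^~ k).
  case/mxvec_indexP: k => i j; apply: spanL_ext (spanL_mxval i j (uE 1%N) wS) => th _.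
  by rewrite /v mxvecE [RHS]mxE.
have hX k n : spanL (E n) (fun th => v th k ^+ n).
  elim: n => [|n ih].
    apply: spanL_ext (spanL_cst 1 (uE 0%N) (filtration0 fE 0)) => th _.
    by rewrite expr0.
  apply: spanL_ext (spanLM (uE n.+1) _ (hv k) ih) => [th _|x y]; first by rewrite exprS.
  exact: (@filtrationD _ fE 1 n).
have hmon (r : seq 'I_(5 * 5)) :
    spanL (E (\sum_(k <- r) m k)%N) (fun th => \prod_(k <- r) v th k ^+ m k).
  elim: r => [|k r ih].
    rewrite big_nil; apply: spanL_ext (spanL_cst 1 (uE 0%N) (filtration0 fE 0)) => th _.
    by rewrite big_nil.
  rewrite big_cons; apply: spanL_ext (spanLM (uE _) _ (hX k (m k)) ih) => [th _|x y].
    by rewrite big_cons.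
  exact: filtrationD.
apply: spanL_sub (uE s) _ (hmon _) => x xE; rewrite -mdegE in xE.
have := filtrationD fE xE (filtration0 fE (s - mdeg m)).
by rewrite addr0 subnKC.
Qed.

Lemma spanL_mxeval (p : {mpoly C[5 * 5]}) s : (msize p <= s.+1)%N ->
  spanL (E s) (fun th => mxeval p (cmx (mxval th S))).
Proof.
move=> sp; pose F m th := \prod_k mxvec (cmx (mxval th S)) 0 k ^+ m k : C.
have h m : spanL (E s) (fun th => if m \in msupp p then p@_m * F m th else 0).
  case mp: (m \in msupp p); last exact: spanL0.
  by apply: spanLZ; apply: spanL_monomial; rewrite -ltnS; apply: leq_trans (msize_mdeg_lt mp) sp.
apply: spanL_ext (spanL_sum (msupp p) h) => th _.
by rewrite /mxeval mevalE [RHS]big_seq [RHS]big_mkcond.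
Qed.

Lemma spanL_mxeval_real (p : {mpoly R[5 * 5]}) s : (msize p <= s.+1)%N ->
  spanL (E s) (fun th => (mxeval p (mxval th S))%:C%C).
Proof.
move=> sp; pose F m th := \prod_k mxvec (cmx (mxval th S)) 0 k ^+ m k : C.
have h m : spanL (E s) (fun th => if m \in msupp p then (p@_m)%:C%C * F m th else 0).
  case mp: (m \in msupp p); last exact: spanL0.
  by apply: spanLZ; apply: spanL_monomial; rewrite -ltnS; apply: leq_trans (msize_mdeg_lt mp) sp.
apply: spanL_ext (spanL_sum (msupp p) h) => th _.
rewrite /mxeval mevalE rmorph_sum [RHS]big_seq [RHS]big_mkcond; apply: eq_bigr => m _.
case: ifP => // _; rewrite rmorphM rmorph_prod; congr (_ * _); apply: eq_bigr => k _.
by rewrite rmorphXn; case/mxvec_indexP: k => i j; rewrite !mxvecE [in LHS]mxE.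
Qed.

Lemma growth_simage A d : (forall s, size (E s) <= A * s.+1 ^ d)%N -> growth (@simage R S) d.
Proof.
move=> sizeE; exists (A + A)%N => s; pose k := size (E s).
have /choice [th0 hth0] : forall M, exists th, @simage R S M -> torus2 th /\ mxval th S = M.
  move=> M; have [[th h1 h2]|nM] := EM (@simage R S M); first by exists th.
  by exists ((0, 0), (0, 0)) => /nM.
pose f i M := lmon (nth 0 (E s) i) (th0 M).
exists (k + k)%N, (fun (i : 'I_(k + k)) M => match fintype.split i with
  inl j => complex.Re (f j M) | inr j => - complex.Im (f j M) end).
split=> [|p sp]; first by rewrite mulnDl leq_add ?sizeE.
have [c hc] := spanL_mxeval_real sp; pose c' i := c (nth 0 (E s) i).
exists (fun i : 'I_(k + k) => match fintype.split i with
  inl j => complex.Re (c' j) | inr j => complex.Im (c' j) end) => M /hth0 [tM eM].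
rewrite big_split_ord /=.
under eq_bigr => i _ do rewrite -[lshift k i]/(unsplit (inl i)) unsplitK.
under [X in _ + X]eq_bigr => i _ do rewrite -[rshift k i]/(unsplit (inr i)) unsplitK.
have := congr1 (@complex.Re R) (hc _ tM); rewrite eM /= => ->.
rewrite (big_nth 0) big_mkord -/k (raddf_sum (@complex.Re R : {additive C -> R})).
rewrite -big_split; apply: eq_bigr => i _.
by rewrite /f /c'; case: (c _) (lmon _ _) => [a b] [a' b'] /=; ring.
Qed.

End Pullback.

Definition max_degree S : nat :=
  \max_(i < 5) \max_(j < 5) ((degrees (sget S i j)).1 + (degrees (sget S i j)).2).

Lemma within_max_degree S : within S (box (max_degree S * 1) (max_degree S * 1)).
Proof.
move=> i j hi hj x; rewrite !mem_box !muln1 => /andP [h1 h2].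
have h : ((degrees (sget S i j)).1 + (degrees (sget S i j)).2 <= max_degree S)%N.
  apply: leq_trans (leq_bigmax (F := fun i : 'I_5 => \max_(j < 5) _) (Ordinal hi)) => /=.
  exact: (leq_bigmax (F := fun j : 'I_5 => (_ + _)%N) (Ordinal hj)).
by rewrite (leq_trans h1) ?(leq_trans h2) //; apply: leq_trans h; rewrite ?leq_addl ?leq_addr.
Qed.

Lemma quarter_turn_torus : @torus2 R ((1, 0), (1, 0)).
Proof. by split; rewrite /circle /= expr1n expr0n addr0. Qed.

Lemma simage_irreducible S : zirreducible (@simage R S).
Proof.
apply/zirreducibleP.
  by exists (mxval ((1, 0), (1, 0)) S), ((1, 0), (1, 0)) => //; exact: quarter_turn_torus.
have L (p : {mpoly R[5 * 5]}) : laurent (fun th => (mxeval p (mxval th S))%:C%C).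
  have h := spanL_mxeval_real (box_filtration _ _) (@within_max_degree S) (leqnSn (msize p)).
  exact: (spanL_laurent h).
move=> p q pq; have [th hth||] := laurent_mul_eq0 (L p) (L q).
- by rewrite -rmorphM -mxevalM pq //; exists th.
- by move=> h; left=> _ [th hth <-]; have [] := h th hth.
- by move=> h; right=> _ [th hth <-]; have [] := h th hth.
Qed.

Lemma simage_growth2 S : growth (@simage R S) 2.
Proof.
pose D := (2 * max_degree S).+1.
apply: (growth_simage (A := (D ^ 2)%N) (box_filtration _ _) (@within_max_degree S)) => s.
rewrite size_box -expnMn -mulnn.
have h : ((max_degree S * s).*2.+1 <= D * s.+1)%N by rewrite /D; nia.
exact: (leq_mul h h).
Qed.

End TorusFunctions.

Lemma vanishes_on_zclosure (K : fieldType) m n (p : {mpoly K[m * n]}) (Y : set 'M[K]_(m, n)) :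
  vanishes_on p (zclosure Y) <-> vanishes_on p Y.
Proof.
split=> [h M YM|h M /(_ p)]; last by apply.
by apply: h => q; apply.
Qed.

(** * Degrees *)

Section Degree.
Context (R : realType).
Local Notation C := (complex R).
Implicit Types (th : quad R).
Variables (S : smx) (E : nat -> seq (int * int)).

Definition linear_on_torus (g : quad R -> C) := exists2 p : {mpoly C[5 * 5]},
  (msize p <= 2)%N & forall th, torus2 th -> mxeval p (cmx (mxval th S)) = g th.

Lemma linear_on_torus_ext g h : (forall th, torus2 th -> g th = h th) ->
  linear_on_torus g -> linear_on_torus h.
Proof. by move=> e [p sp hp]; exists p => // th hth; rewrite -e ?hp. Qed.

Lemma linear_on_torus_cst (a : C) : linear_on_torus (fun=> a).
Proof.
by exists a%:MP => [|th _]; [rewrite msizeC; case: eqP|rewrite mxevalC].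
Qed.

Lemma linear_on_torusD g h : linear_on_torus g -> linear_on_torus h ->
  linear_on_torus (fun th => g th + h th).
Proof.
move=> [p sp hp] [q sq hq]; exists (p + q) => [|th hth]; first exact: msize_add.
by rewrite mxevalD hp ?hq.
Qed.

Lemma linear_on_torusZ a g : linear_on_torus g -> linear_on_torus (fun th => a * g th).
Proof.
move=> [p sp hp]; exists (a *: p) => [|th hth]; first exact: msize_scale.
by rewrite mxevalZ hp.
Qed.

Definition readable_entry x :=
  let r := slocate S x in valid_slot r && eqe (sread S r) x.

Lemma linear_entry x : readable_entry x -> linear_on_torus (fun th => (eval th x)%:C%C).
Proof.
move=> /andP [vr /eqeP e]; set r := slocate S x in vr e.
exists ((-1) ^+ r.1.1 *: coordX C (inord r.1.2) (inord r.2)).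
  by apply: msize_scale; rewrite msizeX mdeg1.
move=> th _; rewrite mxevalZ mxevalX -e -mxread_mxval // /mxread [cmx _ _ _]mxE.
by rewrite rmorphM rmorphXn rmorphN1.
Qed.

Hypotheses (fE : exponent_filtration E) (wS : within S (E 1%N)).
Hypothesis (E0 : forall x : int * int, x \in E 0%N -> x = 0).
Hypothesis (ES : forall s (x : int * int), x \in E s.+1 -> exists2 y, y \in E 1%N & x - y \in E s).
Hypothesis (linE : forall x : int * int, x \in E 1%N -> linear_on_torus (lmon x)).

Lemma lmon_polynomial s (x : int * int) : x \in E s -> exists2 p : {mpoly C[5 * 5]},
  (msize p <= s.+1)%N & forall th, torus2 th -> mxeval p (cmx (mxval th S)) = lmon x th.
Proof.
elim: s x => [|s ih] x.
  by move=> /E0 ->; exists 1 => [|th _]; rewrite ?msize1 // mxeval1 lmon0.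
move=> /ES [y /linE [p sp hp] /ih [q sq hq]]; exists (p * q).
  exact: (@msize_mul _ _ _ p q 1 s).
by move=> th hth; rewrite mxevalM hp // hq // -lmonD // addrC subrK.
Qed.

Lemma vanishes_on_cmx (p : {mpoly C[5 * 5]}) :
  vanishes_on p (zclosure [set cmx M | M in simage S]) <->
  forall th, torus2 th -> mxeval p (cmx (mxval th S)) = 0.
Proof.
split=> [/vanishes_on_zclosure h th hth|h].
  by apply: h; exists (mxval th S) => //; exists th.
by apply/vanishes_on_zclosure => _ [_ [th hth <-] <-]; apply: h.
Qed.

Lemma hilbert_value_simage s :
  hilbert_value (zclosure [set cmx M | M in @simage R S]) s (size (E s)).
Proof.
have uE := filtration_uniq fE s; set k := size (E s).
have /choice [b hb] : forall i : 'I_k, exists p : {mpoly C[5 * 5]}, (msize p <= s.+1)%N /\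
    forall th, torus2 th -> mxeval p (cmx (mxval th S)) = lmon (nth 0 (E s) i) th.
  move=> i; have [p sp hp] := lmon_polynomial (mem_nth 0 (ltn_ord i)).
  by exists p.
have sumE (c : 'I_k -> C) th : torus2 th ->
    mxeval (\sum_i c i *: b i) (cmx (mxval th S)) = \sum_i c i * lmon (nth 0 (E s) i) th.
  by move=> hth; rewrite mxeval_sum; apply: eq_bigr => i _; rewrite mxevalZ (hb i).2.
exists b; split=> [i|c /vanishes_on_cmx hc i|p sp]; first exact: (hb i).1.
  pose c' x := if insub (index x (E s)) is Some j then c j else 0.
  have c'E (j : 'I_k) : c' (nth 0 (E s) j) = c j by rewrite /c' index_uniq // valK.
  rewrite -c'E; apply: (lmon_independent uE) (mem_nth 0 (ltn_ord i)) => th hth.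
  rewrite -[RHS](hc th hth) sumE // (big_nth 0) big_mkord.
  by apply: eq_bigr => j _; rewrite c'E.
have [c hc] := spanL_mxeval fE wS sp.
exists (fun i => c (nth 0 (E s) i)); apply/vanishes_on_cmx => th hth.
by rewrite mxevalB sumE // hc // (big_nth 0) big_mkord subrr.
Qed.

Lemma real_degree_simage (a b e : nat) :
  (0 < a)%N -> (a * 2 = e)%N -> (forall s, size (E s) = a * s ^ 2 + b * s + 1)%N ->
  real_degree (@simage R S) e.
Proof.
move=> a0 ae sizeE; pose H : {poly rat} := Poly [:: 1; b%:R; a%:R].
have HE : H = [:: 1; b%:R; a%:R] :> seq rat.
  by rewrite /H (PolyK (c := 0)) //= pnatr_eq0 -lt0n.
exists H; last by rewrite lead_coefE HE /= -natrM ae.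
exists 0%N => s _; exists (size (E s)); first exact: hilbert_value_simage.
by rewrite /H horner_Poly /= sizeE !natrD !natrM; ring.
Qed.

End Degree.

Section Shapes.
Context (R : realType).
Variable S : smx.

Lemma within_by (P : nat -> nat -> bool) (E : seq (int * int)) :
  (forall (d1 d2 : nat) (x : int * int), P d1 d2 -> (`|x.1| <= d1)%N -> (`|x.2| <= d2)%N -> x \in E) ->
  all5 (fun i j => P (degrees (sget S i j)).1 (degrees (sget S i j)).2) -> within S E.
Proof.
move=> hP /all5P h i j hi hj x; rewrite mem_box => /andP [h1 h2].
exact: hP (h i j hi hj) h1 h2.
Qed.

Definition linear_degrees (d1 d2 : nat) := (d1 + d2 <= 1)%N.
Definition bilinear_degrees (d1 d2 : nat) := (d1 <= 1)%N && (d2 <= 1)%N.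
Definition degrees_satisfy P := all5 (fun i j => P (degrees (sget S i j)).1 (degrees (sget S i j)).2).

Definition readable_products :=
  all (readable_entry S) [:: emul cos1 cos2; emul cos1 sin2; emul sin1 cos2; emul sin1 sin2].
Definition readable_angles := all (readable_entry S) [:: cos1; sin1; cos2; sin2].

Lemma linear_angles (k1 k2 k3 k4 : complex R) : readable_angles ->
  linear_on_torus S (fun th => k1 * (th.1.1)%:C%C + k2 * (th.1.2)%:C%C + k3 * (th.2.1)%:C%C + k4 * (th.2.2)%:C%C).
Proof.
case/and5P => h1 h2 h3 h4 _.
have L k x (h : readable_entry S x) := linear_on_torusZ k (linear_entry R h).
apply: linear_on_torus_ext (linear_on_torusD (linear_on_torusD (linear_on_torusD (L k1 _ h1) (L k2 _ h2)) (L k3 _ h3)) (L k4 _ h4)).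
by move=> th _; rewrite eval_cos1 eval_sin1 eval_cos2 eval_sin2.
Qed.

Lemma linear_products (k1 k2 k3 k4 : complex R) : readable_products ->
  linear_on_torus S (fun th => k1 * (th.1.1 * th.2.1)%:C%C + k2 * (th.1.1 * th.2.2)%:C%C +
     k3 * (th.1.2 * th.2.1)%:C%C + k4 * (th.1.2 * th.2.2)%:C%C).
Proof.
case/and5P => h1 h2 h3 h4 _.
have L k x (h : readable_entry S x) := linear_on_torusZ k (linear_entry R h).
apply: linear_on_torus_ext (linear_on_torusD (linear_on_torusD (linear_on_torusD (L k1 _ h1) (L k2 _ h2)) (L k3 _ h3)) (L k4 _ h4)).
by move=> th _; rewrite !evalM eval_cos1 eval_sin1 eval_cos2 eval_sin2.
Qed.

Ltac complex_eq := apply/eqP; rewrite eq_complex /=; apply/andP; split; apply/eqP; ring.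

Lemma linear_lmon_diamond x : readable_angles -> x \in diamond 1 -> linear_on_torus S (@lmon R x).
Proof.
case: x => a b rS; rewrite mem_diamond => h0; have {h0} h : (`|a| + `|b| <= 1)%N := h0.
have L k := linear_angles k.1.1 k.1.2 k.2.1 k.2.2 rS.
have [a0|a1] := eqVneq a 0; [have [b0|b1] := eqVneq b 0|].
- by apply: linear_on_torus_ext (linear_on_torus_cst S 1) => th _; rewrite a0 b0 lmon0.
- have [e|e] : b = 1 \/ b = -1 by lia.
    apply: linear_on_torus_ext (L ((0, 0), (1, Complex 0 1))) => th /zofX1 [_ _ e3 e4].
    by rewrite /lmon a0 e /= e3 expr0z; complex_eq.
  apply: linear_on_torus_ext (L ((0, 0), (1, Complex 0 (-1)))) => th /zofX1 [_ _ e3 e4].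
  by rewrite /lmon a0 e /= e4 expr0z; complex_eq.
have b0 : b = 0 by lia.
have [e|e] : a = 1 \/ a = -1 by lia.
  apply: linear_on_torus_ext (L ((1, Complex 0 1), (0, 0))) => th /zofX1 [e1 e2 _ _].
  by rewrite /lmon b0 e /= e1 expr0z; complex_eq.
apply: linear_on_torus_ext (L ((1, Complex 0 (-1)), (0, 0))) => th /zofX1 [e1 e2 _ _].
by rewrite /lmon b0 e /= e2 expr0z; complex_eq.
Qed.

Lemma linear_lmon_box x : readable_angles -> readable_products ->
  x \in box 1 1 -> linear_on_torus S (@lmon R x).
Proof.
case: x => a b rS rP xE.
have [xD|xD] := boolP ((a, b) \in diamond 1); first exact: linear_lmon_diamond.
move: xE xD; rewrite mem_box mem_diamond => /andP [ha0 hb0] hab0.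
have ha : (`|a| <= 1)%N := ha0; have hb : (`|b| <= 1)%N := hb0.
have hab : ~~ (`|a| + `|b| <= 1)%N := hab0.
have Ea : a = 1 \/ a = -1 by lia.
have Eb : b = 1 \/ b = -1 by lia.
have L k := linear_products k.1.1 k.1.2 k.2.1 k.2.2 rP.
case: Ea Eb => -> [] ->.
- apply: linear_on_torus_ext (L ((1, Complex 0 1), (Complex 0 1, -1))) => th /zofX1 [e1 e2 e3 e4].
  by rewrite /lmon /= ?e1 ?e2 ?e3 ?e4; complex_eq.
- apply: linear_on_torus_ext (L ((1, Complex 0 (-1)), (Complex 0 1, 1))) => th /zofX1 [e1 e2 e3 e4].
  by rewrite /lmon /= ?e1 ?e2 ?e3 ?e4; complex_eq.
- apply: linear_on_torus_ext (L ((1, Complex 0 1), (Complex 0 (-1), 1))) => th /zofX1 [e1 e2 e3 e4].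
  by rewrite /lmon /= ?e1 ?e2 ?e3 ?e4; complex_eq.
- apply: linear_on_torus_ext (L ((1, Complex 0 (-1)), (Complex 0 (-1), -1))) => th /zofX1 [e1 e2 e3 e4].
  by rewrite /lmon /= ?e1 ?e2 ?e3 ?e4; complex_eq.
Qed.

Lemma diamond_step s x : x \in diamond s.+1 -> exists2 y, y \in diamond 1 & x - y \in diamond s.
Proof.
case: x => a b; rewrite mem_diamond => h0; have {h0} h : (`|a| + `|b| <= s.+1)%N := h0.
have [a0|a0] := eqVneq a 0.
  exists (0, Num.sg b); rewrite mem_diamond /=; first by lia.
  by rewrite a0 sub0r oppr0; lia.
exists (Num.sg a, 0); rewrite mem_diamond /=; first by lia.
by rewrite subr0; lia.
Qed.

Lemma box_step s x : x \in box s.+1 s.+1 -> exists2 y, y \in box 1 1 & x - y \in box s s.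
Proof.
case: x => a b; rewrite mem_box => h0; have {h0} /andP [h1 h2] : (`|a| <= s.+1)%N && (`|b| <= s.+1)%N := h0.
by exists (Num.sg a, Num.sg b); rewrite mem_box /=; lia.
Qed.

Lemma degree4_linear : readable_angles -> degrees_satisfy linear_degrees ->
  real_degree (@simage R S) 4.
Proof.
move=> rS dS; apply: (@real_degree_simage R S diamond _ _ _ _ _ 2 2) => //.
- exact: diamond_filtration.
- by apply: within_by dS => d1 d2 x; rewrite /linear_degrees mem_diamond; lia.
- by move=> [a b]; rewrite mem_diamond /= => h; congr pair; lia.
- exact: diamond_step.
- by move=> x; apply: linear_lmon_diamond.
- by move=> s; rewrite size_diamond; nia.
Qed.

Lemma degree8_bilinear : readable_angles -> readable_products -> degrees_satisfy bilinear_degrees ->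
  real_degree (@simage R S) 8.
Proof.
move=> rS rP dS; apply: (@real_degree_simage R S (fun s => box s s) _ _ _ _ _ 4 4) => //.
- have := box_filtration 1 1; congr exponent_filtration; apply/funext => s.
  by rewrite mul1n.
- by apply: within_by dS => d1 d2 x; rewrite /bilinear_degrees mem_box; lia.
- by move=> [a b]; rewrite mem_box /= => h; congr pair; lia.
- exact: box_step.
- by move=> x; apply: linear_lmon_box.
- by move=> s; rewrite size_box; nia.
Qed.

Lemma growth1_line1 : degrees_satisfy (fun d1 d2 => (d1 <= 1)%N && (d2 == 0)%N) ->
  growth (@simage R S) 1.
Proof.
move=> dS; have wS : within S (box (1 * 1) (0 * 1)).
  by apply: within_by dS => d1 d2 x; rewrite mem_box; lia.
apply: (growth_simage R (box_filtration _ _) wS (A := 2)) => s.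
by rewrite size_box; lia.
Qed.

Lemma growth1_line2 : degrees_satisfy (fun d1 d2 => (d1 == 0)%N && (d2 <= 1)%N) ->
  growth (@simage R S) 1.
Proof.
move=> dS; have wS : within S (box (0 * 1) (1 * 1)).
  by apply: within_by dS => d1 d2 x; rewrite mem_box; lia.
apply: (growth_simage R (box_filtration _ _) wS (A := 2)) => s.
by rewrite size_box; lia.
Qed.

End Shapes.

(** * Orthogonal block matrices *)

Definition valid_swaps (l : swaps) := all (fun p => [&& p.1 < 5, p.2 < 5 & p.1 != p.2])%N l.

Definition sperm (l : swaps) : 'S_5 := (\prod_(p <- l) tperm (inord p.1) (inord p.2))%g.

Lemma sapplyE l (i : 'I_5) : valid_swaps l -> sperm l i = sapply l i :> nat.
Proof.
rewrite /sperm; elim: l i => [|[a b] l ih] i /=; first by rewrite big_nil perm1.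
case/andP => /and3P [/= ha hb ab] vl; rewrite big_cons permM ih //; congr (sapply l _).
have [->|ia] := eqVneq i (inord a); first by rewrite tpermL !inordK // eqxx.
have [->|ib] := eqVneq i (inord b).
  by rewrite tpermR !inordK // eq_sym (negPf ab) eqxx.
have neq c (hc : (c < 5)%N) : i != inord c -> (i == c :> nat) = false.
  by move=> ic; apply/negP => /eqP e; case/eqP: ic; apply/val_inj; rewrite /= inordK.
by rewrite (neq a ha ia) (neq b hb ib) tpermD // eq_sym.
Qed.

Lemma odd_sperm l : valid_swaps l -> odd_perm (sperm l) = odd (size l).
Proof.
rewrite /sperm; elim: l => [|[a b] l ih] /=; first by rewrite big_nil odd_perm1.
case/andP => /and3P [/= ha hb ab] vl; rewrite big_cons odd_permM ih // odd_tperm.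
by rewrite -val_eqE /= !inordK // ab.
Qed.

Section SignedRelabel.
Context (R : realType).
Implicit Types (M : 'M[R]_5) (s t : 'S_5) (e : 'I_5 -> bool).

Lemma orthogonal_rows n (A : 'M[R]_n) : A *m A^T = 1%:M ->
  forall i j, \sum_k A i k * A j k = (i == j)%:R.
Proof.
move=> /matrixP h i j; have := h i j; rewrite !mxE => <-.
by apply: eq_bigr => k _; rewrite mxE.
Qed.

Lemma orthogonal_cols n (A : 'M[R]_n) : A *m A^T = 1%:M ->
  forall i j, \sum_k A k i * A k j = (i == j)%:R.
Proof.
move=> /mulmx1C /matrixP h i j; have := h i j; rewrite !mxE => <-.
by apply: eq_bigr => k _; rewrite mxE.
Qed.

Lemma signed_relabelE s t e M i j : signed_relabel s t e M i j = (-1) ^+ e i * M (s i) (t j).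
Proof. by rewrite mxE. Qed.

Lemma signed_relabel_comp s t e s' t' e' M :
  signed_relabel s t e (signed_relabel s' t' e' M) =
  signed_relabel (s * s')%g (t * t')%g (fun i => e i (+) e' (s i)) M.
Proof.
by apply/matrixP => i j; rewrite !signed_relabelE mulrA -signr_addb !permM.
Qed.

Lemma orthogonal_relabel s t e M : M *m M^T = 1%:M ->
  signed_relabel s t e M *m (signed_relabel s t e M)^T = 1%:M.
Proof.
move=> orth; apply/matrixP => i j; rewrite [LHS]mxE [RHS]mxE.
under eq_bigr => k _ do rewrite [_^T _ _]mxE !signed_relabelE mulrACA.
rewrite -mulr_sumr -(reindex_inj (@perm_inj _ t) (P := predT) (F := fun k => M (s i) k * M (s j) k)).
rewrite (orthogonal_rows orth) (inj_eq perm_inj).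
by case: eqP => [->|_]; rewrite ?mulr0 // -signr_addb addbb expr0 mulr1.
Qed.

Lemma det_signed_relabel s t e M :
  \det (signed_relabel s t e M) = (\prod_i (-1) ^+ e i) * ((-1) ^+ s * \det M * (-1) ^+ t).
Proof.
have -> : signed_relabel s t e M = diag_mx (\row_i (-1) ^+ e i) *m row_perm s (col_perm t M).
  apply/matrixP => i j; rewrite signed_relabelE mul_diag_mx !mxE //.
rewrite det_mulmx det_diag row_permE col_permE !det_mulmx !det_perm odd_permV.
congr (_ * _); last by rewrite mulrA.
by apply: eq_bigr => i _; rewrite mxE.
Qed.

End SignedRelabel.

Section SmallOrthogonal.
Context (R : realType).

Definition ord2_0 : 'I_2 := ord0.
Definition ord2_1 : 'I_2 := lift ord0 ord0.
Definition ord3_0 : 'I_3 := ord0.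
Definition ord3_1 : 'I_3 := lift ord0 ord0.
Definition ord3_2 : 'I_3 := lift ord0 (lift ord0 ord0).

Lemma ord2P (P : 'I_2 -> Prop) : P ord2_0 -> P ord2_1 -> forall i, P i.
Proof. by move=> h0 h1 i; case: (unliftP ord0 i) => [j|] -> //; rewrite ord1. Qed.

Lemma ord3P (P : 'I_3 -> Prop) : P ord3_0 -> P ord3_1 -> P ord3_2 -> forall i, P i.
Proof.
by move=> h0 h1 h2 i; case: (unliftP ord0 i) => [j|] -> //; elim/ord2P: j.
Qed.

Lemma det_mx22 (A : 'M[R]_2) :
  \det A = A ord2_0 ord2_0 * A ord2_1 ord2_1 - A ord2_0 ord2_1 * A ord2_1 ord2_0.
Proof.
rewrite (expand_det_row _ ord0) !big_ord_recl big_ord0 /cofactor !det_mx11 !mxE.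
have l0 : lift (lift ord0 ord0) ord0 = ord2_0 by apply/val_inj.
rewrite /= ?lift0 !ord1 -/ord2_0 -/ord2_1 l0 /=.
by rewrite /bump /= expr0 expr1; ring.
Qed.

Definition rot_entry (u : R * R) (i j : nat) : R :=
  if (i == j)%N then u.1 else if (i == 0)%N then - u.2 else u.2.

Definition rot (u : R * R) : 'M[R]_2 := \matrix_(i, j) rot_entry u i j.

Lemma orthogonal2 (A : 'M[R]_2) : A *m A^T = 1%:M ->
  exists (x : bool) (u : R * R), circle u /\
    forall i j, A i j = (-1) ^+ (x && (i == 1%N :> nat)) * rot_entry u i j.
Proof.
move=> oA; have Rw := orthogonal_rows oA; have Cl := orthogonal_cols oA.
have := Cl ord2_0 ord2_0; have := Rw ord2_0 ord2_0; have := Rw ord2_0 ord2_1.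
have := Rw ord2_1 ord2_1.
rewrite !big_ord_recl !big_ord0 /= -!/ord2_0 -!/ord2_1 !addr0 ?mulr1n ?mulr0n.
set a := A ord2_0 ord2_0; set b := A ord2_0 ord2_1.
set c := A ord2_1 ord2_0; set d := A ord2_1 ord2_1 => e11 e01 e00 f00.
pose w := a * d - b * c.
have hd : w * a = d.
  have -> : w * a = d * (a * a + b * b) - b * (a * c + b * d) by rewrite /w; ring.
  by rewrite e00 e01 mulr0 mulr1 subr0.
have hc : w * b = - c.
  have -> : w * b = a * (a * c + b * d) - c * (a * a + b * b) by rewrite /w; ring.
  by rewrite e01 e00 mulr0 mulr1 sub0r.
have w2 : w ^+ 2 = 1.
  have -> : w ^+ 2 = (a * a + b * b) * (c * c + d * d) - (a * c + b * d) ^+ 2 by rewrite /w; ring.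
  by rewrite e00 e11 e01 expr0n subr0 mulr1.
exists (w == -1), (a, - b); split.
  by rewrite /circle /= sqrrN -e00; ring.
have wE := sqr_circle1 w2; elim/ord2P; elim/ord2P; rewrite /rot_entry /= ?andbF ?andbT ?expr0 ?mul1r //.
- by rewrite opprK.
- by rewrite -wE mulrN hc opprK.
- by rewrite -wE hd.
Qed.

Lemma orthogonal3 (A : 'M[R]_3) : A *m A^T = 1%:M -> A ord3_2 ord3_2 = 0 ->
  exists (x : bool) (th : quad R), torus2 th /\
    forall i j, A i j = (-1) ^+ x * eval th (sget SOcirc_smx i j).
Proof.
move=> oA n22; have Rw := orthogonal_rows oA; have Cl := orthogonal_cols oA.
have := Rw ord3_0 ord3_0; have := Rw ord3_1 ord3_1; have := Rw ord3_2 ord3_2.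
have := Rw ord3_0 ord3_2; have := Rw ord3_1 ord3_2.
have := Cl ord3_2 ord3_2; have := Cl ord3_0 ord3_2; have := Cl ord3_1 ord3_2.
rewrite !big_ord_recl !big_ord0 /= -!/ord3_0 -!/ord3_1 -!/ord3_2 n22 !addr0 !mulr0 !addr0 ?mulr1n ?mulr0n.
set a := A ord3_0 ord3_0; set b := A ord3_0 ord3_1; set s1 := A ord3_0 ord3_2.
set c := A ord3_1 ord3_0; set d := A ord3_1 ord3_1; set c1 := A ord3_1 ord3_2.
set s2 := A ord3_2 ord3_0; set c2 := A ord3_2 ord3_1.
move=> f12 f02 f22 e12 e02 e22 e11 e00.
pose l0 := a * c2 - b * s2; pose l1 := c * c2 - d * s2.
have ha : a = l0 * c2.
  have -> : l0 * c2 = a * (s2 * s2 + c2 * c2) - s2 * (a * s2 + b * c2) by rewrite /l0; ring.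
  by rewrite e22 e02 mulr1 mulr0 subr0.
have hb : b = - (l0 * s2).
  have -> : l0 * s2 = c2 * (a * s2 + b * c2) - b * (s2 * s2 + c2 * c2) by rewrite /l0; ring.
  by rewrite e22 e02 mulr1 mulr0 sub0r opprK.
have hc : c = l1 * c2.
  have -> : l1 * c2 = c * (s2 * s2 + c2 * c2) - s2 * (c * s2 + d * c2) by rewrite /l1; ring.
  by rewrite e22 e12 mulr1 mulr0 subr0.
have hd : d = - (l1 * s2).
  have -> : l1 * s2 = c2 * (c * s2 + d * c2) - d * (s2 * s2 + c2 * c2) by rewrite /l1; ring.
  by rewrite e22 e12 mulr1 mulr0 sub0r opprK.
have el : l0 * s1 + l1 * c1 = 0.
  have -> : l0 * s1 + l1 * c1 = c2 * (a * s1 + c * c1) - s2 * (b * s1 + d * c1).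
    by rewrite /l0 /l1; ring.
  by rewrite f02 f12 !mulr0 subr0.
(* (l0, l1) is orthogonal to the unit vector (s1, c1), hence equal to w (- c1, s1) *)
pose w := l1 * s1 - l0 * c1.
have hl0 : l0 = - (w * c1).
  have -> : w * c1 = s1 * (l0 * s1 + l1 * c1) - l0 * (s1 * s1 + c1 * c1) by rewrite /w; ring.
  by rewrite el f22 mulr1 mulr0 sub0r opprK.
have hl1 : l1 = w * s1.
  have -> : w * s1 = l1 * (s1 * s1 + c1 * c1) - c1 * (l0 * s1 + l1 * c1) by rewrite /w; ring.
  by rewrite el f22 mulr1 mulr0 subr0.
have w2 : w ^+ 2 = 1.
  have : (a * a + (b * b + s1 * s1)) + (c * c + (d * d + c1 * c1)) = 1 + 1 by rewrite e00 e11.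
  have -> : a * a + (b * b + s1 * s1) + (c * c + (d * d + c1 * c1)) =
     w ^+ 2 * (s1 * s1 + c1 * c1) * (s2 * s2 + c2 * c2) + (s1 * s1 + c1 * c1).
    by rewrite ha hb hc hd hl0 hl1; ring.
  by rewrite f22 e22 !mulr1 => /addIr.
have ww : w * w = 1 by rewrite -expr2.
exists (w == -1), ((- (w * c1), w * s1), (w * c2, w * s2)).
have wE := sqr_circle1 w2; split.
  by split; rewrite /circle /= ?sqrrN !exprMn w2 !mul1r; [rewrite -f22|rewrite -e22]; ring.
elim/ord3P; elim/ord3P; rewrite -wE /sget /= ?addn0 ?add0n ?expr0 ?expr1.
- by rewrite -/a ha hl0 -[LHS]mul1r -{1}ww; ring.
- by rewrite -/b hb hl0 -[LHS]mul1r -{1}ww; ring.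
- by rewrite -/s1 -[LHS]mul1r -{1}ww; ring.
- by rewrite -/c hc hl1 -[LHS]mul1r -{1}ww; ring.
- by rewrite -/d hd hl1 -[LHS]mul1r -{1}ww; ring.
- by rewrite -/c1 -[LHS]mul1r -{1}ww; ring.
- by rewrite -/s2 -[LHS]mul1r -{1}ww; ring.
- by rewrite -/c2 -[LHS]mul1r -{1}ww; ring.
- by rewrite mulr0.
Qed.

Lemma orthogonal_diagonal2 (A : 'M[R]_2) : A *m A^T = 1%:M ->
  A ord2_0 ord2_1 = 0 -> A ord2_1 ord2_0 = 0 ->
  exists y z : bool, forall i j, A i j = (-1) ^+ (if (i == 0%N :> nat) then y else z) * (i == j)%:R.
Proof.
move=> oA h01 h10; have Rw := orthogonal_rows oA.
have := Rw ord2_0 ord2_0; have := Rw ord2_1 ord2_1.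
rewrite !big_ord_recl !big_ord0 /= -!/ord2_0 -!/ord2_1 h01 h10 !addr0 !mulr0 ?add0r ?addr0 ?mulr1n.
rewrite -!expr2 => /sqr_circle1 e1 /sqr_circle1 e0.
exists (A ord2_0 ord2_0 == -1), (A ord2_1 ord2_1 == -1).
elim/ord2P; elim/ord2P; rewrite /= ?h01 ?h10 ?mulr0 ?mulr1 //.
Qed.

End SmallOrthogonal.

Section Blocks.
Context (R : realType).
Implicit Types (th : quad R) (u v : R * R).

Lemma det_mx33 (A : 'M[R]_3) : \det A =
  A ord3_0 ord3_0 * (A ord3_1 ord3_1 * A ord3_2 ord3_2 - A ord3_1 ord3_2 * A ord3_2 ord3_1) -
  A ord3_0 ord3_1 * (A ord3_1 ord3_0 * A ord3_2 ord3_2 - A ord3_1 ord3_2 * A ord3_2 ord3_0) +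
  A ord3_0 ord3_2 * (A ord3_1 ord3_0 * A ord3_2 ord3_1 - A ord3_1 ord3_1 * A ord3_2 ord3_0).
Proof.
rewrite (expand_det_row _ ord0) !big_ord_recl big_ord0 /cofactor !det_mx22 !mxE.
have -> : lift ord3_0 ord2_0 = ord3_1 by apply/val_inj.
have -> : lift ord3_0 ord2_1 = ord3_2 by apply/val_inj.
have -> : lift ord3_1 ord2_0 = ord3_0 by apply/val_inj.
have -> : lift ord3_1 ord2_1 = ord3_2 by apply/val_inj.
have -> : lift ord3_2 ord2_0 = ord3_0 by apply/val_inj.
have -> : lift ord3_2 ord2_1 = ord3_1 by apply/val_inj.
by rewrite /= /bump /= ?addn0 ?add0n ?expr0 ?expr1; ring.
Qed.

Lemma block_mx_congr m n p q (A A' : 'M[R]_(m, n)) (B B' : 'M_(m, p)) (C C' : 'M_(q, n))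
    (D D' : 'M_(q, p)) : A = A' -> B = B' -> C = C' -> D = D' -> block_mx A B C D = block_mx A' B' C' D'.
Proof. by move=> -> -> -> ->. Qed.

Lemma block_matrix_fun m n (f : nat -> nat -> R) :
  block_mx (\matrix_(i < m, j < m) f i j) (\matrix_(i < m, j < n) f i (m + j)%N)
           (\matrix_(i < n, j < m) f (m + i)%N j) (\matrix_(i < n, j < n) f (m + i)%N (m + j)%N)
  = \matrix_(i < m + n, j < m + n) f i j.
Proof.
apply/matrixP => i j; case: (split_ordP i) => i' ->; case: (split_ordP j) => j' ->.
- by rewrite block_mxEul !mxE.
- by rewrite block_mxEur !mxE.
- by rewrite block_mxEdl !mxE.
- by rewrite block_mxEdr !mxE.
Qed.

Lemma block_orthogonal m n (N : 'M[R]_(m + n)) : N *m N^T = 1%:M ->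
  ursubmx N = 0 -> dlsubmx N = 0 ->
  ulsubmx N *m (ulsubmx N)^T = 1%:M /\ drsubmx N *m (drsubmx N)^T = 1%:M.
Proof.
move=> + h1 h2; rewrite -{1 2}[N]submxK h1 h2 tr_block_mx !trmx0 mulmx_block.
rewrite !mul0mx !mulmx0 !addr0 !add0r (scalar_mx_block m n).
by case/eq_block_mx => -> _ _ ->.
Qed.

Lemma orthogonal_block m n (A : 'M[R]_m) (D : 'M[R]_n) : A *m A^T = 1%:M -> D *m D^T = 1%:M ->
  block_mx A 0 0 D *m (block_mx A 0 0 D)^T = 1%:M.
Proof.
move=> hA hD; rewrite tr_block_mx !trmx0 mulmx_block !mul0mx !mulmx0 !addr0 !add0r hA hD.
by rewrite -scalar_mx_block.
Qed.

Definition euler th : 'M[R]_3 := \matrix_(i, j) eval th (sget SOcirc_smx i j).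

Lemma diag221_rot u v : diag221 (rot u) (rot v) = mxval (u, v) torus_smx.
Proof.
pose f i j := eval (u, v) (sget torus_smx i j).
transitivity (\matrix_(i < 2 + (2 + 1), j < 2 + (2 + 1)) f i j); last by [].
rewrite -block_matrix_fun -(@block_matrix_fun 2 1 (fun i j => f (2 + i)%N (2 + j)%N)).
apply: (@block_mx_congr 2 2 (2 + 1) (2 + 1)); [| | |apply: (@block_mx_congr 2 2 1 1)]; apply/matrixP.
- by elim/ord2P; elim/ord2P; rewrite !mxE /rot_entry /f /sget /= ?expr0 ?expr1; ring.
- by elim/ord2P; elim/ord3P; rewrite !mxE.
- by elim/ord3P; elim/ord2P; rewrite !mxE.
- by elim/ord2P; elim/ord2P; rewrite !mxE /rot_entry /f /sget /= ?expr0 ?expr1; ring.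
- by elim/ord2P => j; rewrite !mxE ord1.
- by move=> i; elim/ord2P; rewrite !mxE ord1.
- by move=> i j; rewrite !mxE !ord1 /f /sget /= ?expr0 ?mulr1n; ring.
Qed.

Lemma diag311_euler th : diag311 (euler th) = mxval th SOcirc_smx.
Proof.
pose f i j := eval th (sget SOcirc_smx i j).
transitivity (\matrix_(i < 3 + 2, j < 3 + 2) f i j); last by [].
rewrite -block_matrix_fun; apply: (@block_mx_congr 3 3 2 2) => //; apply/matrixP.
- by elim/ord3P; elim/ord2P; rewrite !mxE.
- by elim/ord2P; elim/ord3P; rewrite !mxE.
- by elim/ord2P; elim/ord2P; rewrite !mxE /f /sget /= ?expr0 ?mulr1n ?mulr0n; ring.
Qed.

Lemma rot_SO2 u : circle u -> SO R 2 (rot u).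
Proof.
rewrite /circle => hu; split; last first.
  by rewrite det_mx22 !mxE /rot_entry /= -hu; ring.
apply/matrixP; elim/ord2P; elim/ord2P; rewrite !mxE !big_ord_recl big_ord0 !mxE /rot_entry /=.
- by rewrite mulr1n -hu; ring.
- by rewrite mulr0n; ring.
- by rewrite mulr0n; ring.
- by rewrite mulr1n -hu; ring.
Qed.

Lemma SO2_rot (A : 'M[R]_2) : SO R 2 A -> exists2 u, circle u & A = rot u.
Proof.
move=> [/orthogonal2 [x [u [hu hA]]] dA]; exists u => //.
suff x0 : x = false by apply/matrixP => i j; rewrite hA x0 /= expr0 mul1r mxE.
move: dA; rewrite det_mx22 !hA /rot_entry /= andbF andbT !expr0 => dA.
have {dA} : (-1) ^+ x = 1 :> R.
  by rewrite -[RHS]dA -[LHS]mulr1 -[X in _ * X = _]hu; ring.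
case: (x) => //; rewrite expr1 => /eqP; rewrite -subr_eq0 -opprD oppr_eq0 (pnatr_eq0 R 2) //.
Qed.

Lemma euler_orthogonal th : torus2 th -> euler th *m (euler th)^T = 1%:M.
Proof.
case: th => [[c1 s1] [c2 s2]] [/= h1 h2]; rewrite /circle /= in h1 h2.
apply/matrixP; elim/ord3P; elim/ord3P; rewrite !mxE !big_ord_recl big_ord0 !mxE /sget /=.
all: rewrite /= ?addn0 ?add0n ?expr0 ?expr1 ?mulr1n ?mulr0n.
all: try ring.
- by transitivity (c1 ^+ 2 * (c2 ^+ 2 + s2 ^+ 2) + s1 ^+ 2); [ring|rewrite h2 mulr1 h1].
- by transitivity (c1 * s1 * (c2 ^+ 2 + s2 ^+ 2 - 1)); [ring|rewrite h2 subrr mulr0].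
- by transitivity (c1 * s1 * (c2 ^+ 2 + s2 ^+ 2 - 1)); [ring|rewrite h2 subrr mulr0].
- by transitivity (s1 ^+ 2 * (c2 ^+ 2 + s2 ^+ 2) + c1 ^+ 2); [ring|rewrite h2 mulr1 addrC h1].
- by transitivity (c2 ^+ 2 + s2 ^+ 2); [ring|rewrite h2].
Qed.

Lemma det_euler th : torus2 th -> \det (euler th) = 1.
Proof.
case: th => [[c1 s1] [c2 s2]] [/= h1 h2]; rewrite /circle /= in h1 h2.
rewrite det_mx33 !mxE /sget /= ?addn0 ?add0n ?expr0 ?expr1.
transitivity ((c1 ^+ 2 + s1 ^+ 2) * (c2 ^+ 2 + s2 ^+ 2)); first ring.
by rewrite h1 h2 mulr1.
Qed.

Lemma SOcirc_euler : @SOcirc R ord3_2 ord3_2 = [set euler th | th in @torus2 R].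
Proof.
apply/seteqP; split=> [A [[oA dA] A0]|_ [th hth <-]]; last first.
  split; first by split; [exact: euler_orthogonal|exact: det_euler].
  by rewrite mxE.
have [x [th [hth hA]]] := orthogonal3 oA A0; exists th => //.
have AE : A = (-1) ^+ x *: euler th by apply/matrixP => i j; rewrite hA !mxE.
move: dA; rewrite AE detZ det_euler // mulr1; case: (x); rewrite /= ?expr0 ?scale1r // expr1.
by rewrite exprS sqrrN expr1n mulr1 => /eqP; rewrite -subr_eq0 -opprD oppr_eq0 (pnatr_eq0 R 2).
Qed.

Lemma det_mxval_template ty th : torus2 th -> \det (mxval th (btemplate ty)) = 1.
Proof.
case: ty => hth /=; first by rewrite -diag311_euler /diag311 (@det_ublock _ 3 2) det_euler // det1 mulr1.
have [[o1 d1] [o2 d2]] := (rot_SO2 hth.1, rot_SO2 hth.2).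
rewrite (_ : th = (th.1, th.2)); last by case: (th).
by rewrite -diag221_rot /diag221 (@det_ublock _ 2 3) (@det_ublock _ 2 1) d1 d2 det1 !mulr1.
Qed.

Lemma orthogonal_mxval_template ty th : torus2 th ->
  mxval th (btemplate ty) *m (mxval th (btemplate ty))^T = 1%:M.
Proof.
have id1 n : (1%:M : 'M[R]_n) *m (1%:M)^T = 1%:M by rewrite trmx1 mulmx1.
case: ty => hth /=.
  by rewrite -diag311_euler; apply: (@orthogonal_block 3 2) => //; apply: euler_orthogonal.
have [[o1 d1] [o2 d2]] := (rot_SO2 hth.1, rot_SO2 hth.2).
rewrite (_ : th = (th.1, th.2)); last by case: (th).
rewrite -diag221_rot; apply: (@orthogonal_block 2 (2 + 1)) => //.
exact: (@orthogonal_block 2 1).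
Qed.

End Blocks.

Definition signed_template ty (x y z : bool) : smx :=
  smake (fun i j => eopp (nth false (bsign ty x y z) i) (sget (btemplate ty) i j)).

Section Copies.
Context (R : realType).
Implicit Types (th : quad R) (M N : 'M[R]_5).

Lemma mxval_signed_template th ty x y z (i j : 'I_5) :
  mxval th (signed_template ty x y z) i j =
  (-1) ^+ nth false (bsign ty x y z) i * eval th (sget (btemplate ty) i j).
Proof. by rewrite mxvalE sget_smake // evalN. Qed.

Lemma mxval_bsmx th ty s t x y z : valid_swaps s -> valid_swaps t ->
  mxval th (bsmx ty s t x y z) =
  signed_relabel (sperm s) (sperm t) (fun i => nth false (bsign ty x y z) (sperm s i))
    (mxval th (btemplate ty)).
Proof.
move=> vs vt; apply/matrixP => i j; rewrite signed_relabelE !mxvalE sget_smake // evalN.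
by rewrite !sapplyE.
Qed.

Lemma mxval_bsmx_template th ty s t x y z : valid_swaps s -> valid_swaps t ->
  mxval th (bsmx ty s t x y z) =
  signed_relabel (sperm s) (sperm t) (fun=> false) (mxval th (signed_template ty x y z)).
Proof.
move=> vs vt; rewrite mxval_bsmx //; apply/matrixP => i j.
by rewrite !signed_relabelE expr0 mul1r mxval_signed_template mxvalE.
Qed.

Lemma det_bsmx th ty s t x y z : valid_swaps s -> valid_swaps t -> torus2 th ->
  \det (mxval th (bsmx ty s t x y z)) = (-1) ^+ (x (+) y (+) z (+) odd (size s + size t)).
Proof.
move=> vs vt hth; rewrite mxval_bsmx // det_signed_relabel det_mxval_template // mulr1.
rewrite -(reindex_inj (@perm_inj _ (sperm s)) (P := predT)
  (F := fun i : 'I_5 => (-1) ^+ nth false (bsign ty x y z) i)) /=.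
rewrite !big_ord_recl big_ord0 mulr1 !odd_sperm // oddD !signr_addb.
have : (-1) ^+ x * (-1) ^+ x = 1 :> R by rewrite -signr_addb addbb.
case: ty; rewrite /= ?expr0; move: ((-1) ^+ x : R) ((-1) ^+ y : R) ((-1) ^+ z : R) => a b c;
move: ((-1) ^+ odd (size s) : R) ((-1) ^+ odd (size t) : R) => p q aa; last by ring.
by transitivity (a * a * (a * b * c * (p * q))); [ring|rewrite aa mul1r].
Qed.

Lemma bsmx_SO th ty s t x y z : valid_swaps s -> valid_swaps t -> torus2 th ->
  x (+) y (+) z = odd (size s + size t) -> SO R 5 (mxval th (bsmx ty s t x y z)).
Proof.
move=> vs vt hth e; split; last by rewrite det_bsmx // e addbb.
by rewrite mxval_bsmx //; apply: orthogonal_relabel; apply: orthogonal_mxval_template.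
Qed.

Lemma orthogonal_template ty N : N *m N^T = 1%:M ->
  (forall i j : 'I_5, sget (btemplate ty) i j = None -> N i j = 0) ->
  exists (x y z : bool) th, torus2 th /\ N = mxval th (signed_template ty x y z).
Proof.
case: ty => oN hz.
  have ur : @ursubmx _ 3 2 3 2 N = 0.
    by apply/matrixP; elim/ord3P; elim/ord2P; rewrite !mxE; apply: hz.
  have dl : @dlsubmx _ 3 2 3 2 N = 0.
    by apply/matrixP; elim/ord2P; elim/ord3P; rewrite !mxE; apply: hz.
  have [oA oD] := @block_orthogonal R 3 2 N oN ur dl.
  have [|x [th [hth hA]]] := orthogonal3 oA; first by rewrite !mxE; apply: hz.
  have [||y [z hD]] := orthogonal_diagonal2 oD; try by rewrite !mxE; apply: hz.
  exists x, y, z, th; split=> //; apply/matrixP => i j; rewrite mxval_signed_template.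
  case: (@split_ordP 3 2 i) => i' ->; case: (@split_ordP 3 2 j) => j' ->.
  - have := hA i' j'; rewrite !mxE => ->; congr (_ * _); congr (_ ^+ nat_of_bool _).
    by elim/ord3P: i' {hA}.
  - have /matrixP /(_ i' j') := ur; rewrite !mxE => ->.
    by elim/ord3P: i'; elim/ord2P: j'; rewrite mulr0.
  - have /matrixP /(_ i' j') := dl; rewrite !mxE => ->.
    by elim/ord2P: i'; elim/ord3P: j'; rewrite mulr0.
  - have := hD i' j'; rewrite !mxE => ->.
    by elim/ord2P: i'; elim/ord2P: j'; rewrite /= ?mulr0 ?expr0 ?mulr1.
have ur : @ursubmx _ 2 (2 + 1) 2 (2 + 1) N = 0.
  by apply/matrixP; elim/ord2P; elim/ord3P; rewrite !mxE; apply: hz.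
have dl : @dlsubmx _ 2 (2 + 1) 2 (2 + 1) N = 0.
  by apply/matrixP; elim/ord3P; elim/ord2P; rewrite !mxE; apply: hz.
have [oA oD] := @block_orthogonal R 2 (2 + 1) N oN ur dl.
set D := @drsubmx _ 2 (2 + 1) 2 (2 + 1) N in oD.
have ur' : @ursubmx _ 2 1 2 1 D = 0.
  by apply/matrixP; elim/ord2P => j; rewrite ord1 !mxE; apply: hz.
have dl' : @dlsubmx _ 2 1 2 1 D = 0.
  by apply/matrixP => i; rewrite ord1; elim/ord2P; rewrite !mxE; apply: hz.
have [oB oC] := @block_orthogonal R 2 1 D oD ur' dl'.
have [x [u [hu hA]]] := orthogonal2 oA.
have [y [v [hv hB]]] := orthogonal2 oB.
have := orthogonal_rows oC 0 0; rewrite big_ord1 -expr2 => /sqr_circle1.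
set z := (_ == -1) => hC.
exists x, y, z, (u, v); split=> //; apply/matrixP => i j; rewrite mxval_signed_template.
case: (@split_ordP 2 (2 + 1) i) => i' ->; case: (@split_ordP 2 (2 + 1) j) => j' ->.
- have := hA i' j'; rewrite !mxE => ->.
  by elim/ord2P: i'; elim/ord2P: j'; rewrite /= ?andbF ?andbT /rot_entry /= ?expr0 ?expr1; ring.
- have /matrixP /(_ i' j') := ur; rewrite !mxE => ->.
  by elim/ord2P: i'; elim/ord3P: j'; rewrite mulr0.
- have /matrixP /(_ i' j') := dl; rewrite !mxE => ->.
  by elim/ord3P: i'; elim/ord2P: j'; rewrite mulr0.
case: (@split_ordP 2 1 i') => i'' ->; case: (@split_ordP 2 1 j') => j'' ->.
- have := hB i'' j''; rewrite !mxE => ->.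
  by elim/ord2P: i''; elim/ord2P: j''; rewrite /= ?andbF ?andbT /rot_entry /= ?expr0 ?expr1; ring.
- have /matrixP /(_ i'' j'') := ur'; rewrite !mxE => ->.
  by rewrite ord1; elim/ord2P: i''; rewrite mulr0.
- have /matrixP /(_ i'' j'') := dl'; rewrite !mxE => ->.
  by rewrite ord1; elim/ord2P: j''; rewrite mulr0.
- have := hC; rewrite !ord1 !mxE => ->.
  by rewrite /= ?expr0 ?mulr1.
Qed.

Lemma SO_bsmx ty s t M : valid_swaps s -> valid_swaps t -> SO R 5 M ->
  (forall i j : 'I_5, sget (bsmx ty s t false false false) i j = None -> M i j = 0) ->
  exists (y z : bool) th, torus2 th /\
    M = mxval th (bsmx ty s t (odd (size s + size t) (+) (y (+) z)) y z).
Proof.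
move=> vs vt [oM dM] hz.
pose N := signed_relabel (sperm s)^-1%g (sperm t)^-1%g (fun=> false) M.
have MN : M = signed_relabel (sperm s) (sperm t) (fun=> false) N.
  apply/matrixP => i j; rewrite !signed_relabelE !expr0 !mul1r.
  by rewrite !permK.
have [||x [y [z [th [hth hN]]]]] := @orthogonal_template ty N.
- exact: orthogonal_relabel.
- move=> i j hij; rewrite signed_relabelE expr0 mul1r; apply: hz.
  by rewrite sget_smake // -!sapplyE // !permKV hij.
exists y, z, th; split=> //; rewrite MN hN -mxval_bsmx_template //; congr (mxval th (bsmx ty s t _ y z)).
move: dM; rewrite MN hN -mxval_bsmx_template // det_bsmx //.
set o := odd _ => d1.
have e : x (+) y (+) z (+) o = false.
  case: (_ (+) o) d1 => //; rewrite expr1 => /eqP.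
  by rewrite -subr_eq0 -opprD oppr_eq0 (pnatr_eq0 R 2).
by move: e; case: (x); case: (y); case: (z); case: (o).
Qed.

Lemma is_copy_of_trans (X Y Z : set 'M[R]_5) : is_copy_of X Y -> is_copy_of Y Z -> is_copy_of X Z.
Proof.
move=> [s [t [e ->]]] [s' [t' [e' ->]]].
exists (s' * s)%g, (t' * t)%g, (fun i => e' i (+) e (s' i)).
rewrite image_comp; congr image; apply/funext => M /=.
by rewrite signed_relabel_comp.
Qed.

Lemma bsmx_copy ty s t x y z : valid_swaps s -> valid_swaps t ->
  is_copy_of (simage (btemplate ty)) (@simage R (bsmx ty s t x y z)).
Proof.
move=> vs vt; exists (sperm s), (sperm t), (fun i => nth false (bsign ty x y z) (sperm s i)).
rewrite /simage image_comp; congr image; apply/funext => th /=.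
by rewrite mxval_bsmx.
Qed.

Lemma torus_template : @simage R torus_smx = [set diag221 A B | A in @SO R 2 & B in @SO R 2].
Proof.
apply/seteqP; split=> [_ [[u v] [hu hv] <-]|_ [A hA [B hB <-]]].
  by exists (rot u); [exact: rot_SO2|exists (rot v); [exact: rot_SO2|rewrite diag221_rot]].
have [[u hu ->] [v hv ->]] := (SO2_rot hA, SO2_rot hB).
by exists (u, v); rewrite ?diag221_rot.
Qed.

Lemma SOcirc_template :
  @simage R SOcirc_smx = [set diag311 N | N in @SOcirc R ord3_2 ord3_2].
Proof.
rewrite SOcirc_euler /simage image_comp; congr image; apply/funext => th /=.
by rewrite diag311_euler.
Qed.

Lemma bsmx_torus s t x y z : valid_swaps s -> valid_swaps t ->
  torus (@simage R (bsmx false s t x y z)).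
Proof. by move=> vs vt; rewrite /torus -torus_template; apply: bsmx_copy. Qed.

Lemma bsmx_SOcirc s t x y z : valid_swaps s -> valid_swaps t ->
  SOcirc_copy (@simage R (bsmx true s t x y z)).
Proof.
by move=> vs vt; exists ord3_2, ord3_2; rewrite -SOcirc_template; apply: bsmx_copy.
Qed.

(* A torus copy has one entry of constant absolute value 1, an SOcirc copy two. *)
Lemma torus_not_SOcirc (C : set 'M[R]_5) : torus C -> SOcirc_copy C -> False.
Proof.
move=> [s [t [e Ct]]] [k [l [s' [t' [e' Cs]]]]].
have unit_entry (i0 : 'I_2) M : C M -> M (s'^-1 (rshift 3 i0))%g (t'^-1 (rshift 3 i0))%g ^+ 2 = 1.
  rewrite Cs => -[_ [N _ <-] <-]; rewrite signed_relabelE !permKV exprMn sqrr_sign mul1r.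
  by rewrite /diag311 (@block_mxEdr _ 3 2 3 2) mxE eqxx expr1n.
pose T (u : R * R) := signed_relabel s t e (diag221 (rot u) (rot u)).
have TC u : circle u -> C (T u).
  move=> hu; rewrite Ct; exists (diag221 (rot u) (rot u)) => //.
  by exists (rot u); [exact: rot_SO2|exists (rot u) => //; exact: rot_SO2].
have h10 : circle (1 : R, 0 : R) by rewrite /circle /= expr1n expr0n addr0.
have h01 : circle (0 : R, 1 : R) by rewrite /circle /= expr1n expr0n add0r.
have n01 (P : Prop) : 0 = 1 :> R -> P by move/eqP; rewrite eq_sym oner_eq0.
have support (i j : 'I_5) : eval ((1, 0), (1, 0)) (sget torus_smx i j) ^+ 2 = 1 :> R ->
    eval ((0, 1), (0, 1)) (sget torus_smx i j) ^+ 2 = 1 :> R -> i = 4%N :> nat.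
  case: i j => [[|[|[|[|[|//]]]]] hi] [[|[|[|[|[|//]]]]] hj] //=;
  by rewrite !(expr1n, expr0, expr1, mulr0, mul0r, mulr1, expr0n) /= => h1 h2; apply: n01.
have last_row (i0 : 'I_2) : s (s'^-1 (@rshift 3 2 i0))%g = 4%N :> nat.
  have h u (hu : circle u) := unit_entry i0 (T u) (TC u hu).
  apply: (@support _ (t (t'^-1 (@rshift 3 2 i0))%g)); [have := h _ h10|have := h _ h01];
  by rewrite /T signed_relabelE exprMn sqrr_sign mul1r diag221_rot mxvalE.
have : s (s'^-1 (@rshift 3 2 ord2_0))%g = s (s'^-1 (@rshift 3 2 ord2_1))%g.
  by apply/val_inj; rewrite /= !last_row.
by move/perm_inj/perm_inj/(congr1 (@nat_of_ord _)).
Qed.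

End Copies.

(** * Cells of a component *)

Section Pieces.
Context (R : realType).
Implicit Types (th : quad R) (S : smx) (r : cell).

Definition piece S r : set 'M[R]_5 := simage (cell_smx S r).

Definition place r th : quad R := qmap (eval th) (cell_subst r).

Lemma mxval_cell th S r : mxval th (cell_smx S r) = mxval (place r th) S.
Proof. exact: mxval_subst. Qed.

Lemma place_None1 th b : (place (None, b) th).1 = th.1.
Proof.
rewrite /place /qmap [(cell_subst _).1]/= [in LHS]/=.
by have := congr1 fst (eval_gen th); rewrite /qmap /= => ->.
Qed.

Lemma place_None2 th a : (place (a, None) th).2 = th.2.
Proof. by have := congr1 snd (eval_gen th); rewrite /place /qmap /= => ->. Qed.

Lemma place_Some1 th th' a b b' : (place (Some a, b) th).1 = (place (Some a, b') th').1.
Proof. by case: a => [[] s]. Qed.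

Lemma place_Some2 th th' a a' b : (place (a, Some b) th).2 = (place (a', Some b) th').2.
Proof. by case: b => [[] s]. Qed.

Lemma place_gen th : place (None, None) th = th.
Proof. by rewrite [LHS]surjective_pairing place_None1 place_None2; case: th. Qed.

Lemma quarter_circle a th b : circle (place (Some a, b) th).1.
Proof.
case: a => -[] s; rewrite /circle /place /qmap /= ?expr0n ?expr0 ?mulr1 ?add0r ?addr0;
by rewrite /eval /= ?expr0n ?expr0 ?mulr1 ?add0r ?addr0 addbF sqrr_sign.
Qed.

Lemma quarter_circle2 b th a : circle (place (a, Some b) th).2.
Proof.
case: b => -[] s; rewrite /circle /place /qmap /= ?expr0n ?expr0 ?mulr1 ?add0r ?addr0;
by rewrite /eval /= ?expr0n ?expr0 ?mulr1 ?add0r ?addr0 addbF sqrr_sign.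
Qed.

Lemma place_torus r th : torus2 th -> torus2 (place r th).
Proof.
case: r => a b [h1 h2]; split.
  by case: a => [a|]; [exact: quarter_circle|rewrite place_None1].
by case: b => [b|]; [exact: quarter_circle2|rewrite place_None2].
Qed.

Lemma piece_gen S : piece S (None, None) = simage S.
Proof.
by rewrite /piece /simage; congr image; apply/funext => th; rewrite mxval_cell place_gen.
Qed.

Lemma place_place r r' th : in_region r r' -> place r (place r' th) = place r' th.
Proof.
case: r r' => [a b] [a' b'] /andP [/= h1 h2].
rewrite [LHS]surjective_pairing [RHS]surjective_pairing; congr pair.
  case/orP: h1 => [/eqP ->|/eqP <-]; first by rewrite place_None1.
  by case: a => [a|]; [exact: place_Some1|rewrite !place_None1].
case/orP: h2 => [/eqP ->|/eqP <-]; first by rewrite place_None2.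
by case: b => [b|]; [exact: place_Some2|rewrite !place_None2].
Qed.

Lemma piece_sub S r r' : in_region r r' -> piece S r' `<=` piece S r.
Proof.
move=> rr' _ [th hth <-]; exists (place r' th); first exact: place_torus.
by rewrite !mxval_cell place_place.
Qed.

Definition generic_pt : R * R := (3 / 5, 4 / 5).
Lemma generic_circle : circle generic_pt.
Proof. by rewrite /circle /=; field. Qed.
Lemma generic_torus : torus2 (generic_pt, generic_pt).
Proof. by split; exact: generic_circle. Qed.

Lemma place_Some1_neq a b th : (place (Some a, b) th).1 <> generic_pt.
Proof.
have h0 (x : R) n : x * n.+1%:R / 5 = 0 -> x = 0.
  by move/eqP; rewrite !mulf_eq0 invr_eq0 !pnatr_eq0 !orbF => /eqP.
case: a => -[] s [e1 e2]; [move: e1|move: e2]; rewrite /eval /= => e;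
by have := h0 1 _ (etrans (congr1 (fun x => x / 5) (mul1r _)) (esym e)) => /eqP; rewrite oner_eq0.
Qed.

Lemma place_Some2_neq b a th : (place (a, Some b) th).2 <> generic_pt.
Proof.
have -> : (place (a, Some b) th).2 = (place (Some b, a) th).1 by case: b => -[].
exact: place_Some1_neq.
Qed.

Definition strictly_inside r' r : bool :=
  ((r.1 == None) && (r'.1 != None)) || ((r.2 == None) && (r'.2 != None)).

Lemma piece_nsub S r r' : readable S -> strictly_inside r' r -> ~ (piece S r `<=` piece S r').
Proof.
move=> rS str sub.
have [th hth] : piece S r' (mxval (generic_pt, generic_pt) (cell_smx S r)).
  by apply: sub; exists (generic_pt, generic_pt) => //; exact: generic_torus.
rewrite !mxval_cell => /(mxval_inj rS) e.
case: r r' str e {sub} => [a b] [a' b'] /orP [] /andP [/eqP /= -> ]; [case: a' => // a'|case: b' => // b'] => _ e.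
  by apply: (@place_Some1_neq a' b' th); rewrite e place_None1.
by apply: (@place_Some2_neq b' a' th); rewrite e place_None2.
Qed.

Lemma piece_proper S r r' : readable S -> in_region r r' -> strictly_inside r' r ->
  piece S r' `<` piece S r.
Proof. by move=> rS rr' str; split; [exact: piece_sub|exact: piece_nsub]. Qed.

Lemma polynomial_eval m n (F : 'M[R]_(m, n) -> quad R) x :
  polynomial_fun (fun M => (F M).1.1) -> polynomial_fun (fun M => (F M).1.2) ->
  polynomial_fun (fun M => (F M).2.1) -> polynomial_fun (fun M => (F M).2.2) ->
  polynomial_fun (fun M => eval (F M) x).
Proof.
move=> h1 h2 h3 h4; case: x => [[[b [i j]] [k l]]|]; last exact: polynomial_cst.
apply: polynomialM; first exact: polynomial_cst.
by do 2?[apply: polynomialM]; apply: polynomialX.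
Qed.

Lemma polynomial_mxread (r : bool * nat * nat) : polynomial_fun (@mxread R r).
Proof. by apply: polynomialM; [exact: polynomial_cst|exact: polynomial_entry]. Qed.

Lemma polynomial_angles sl x : polynomial_fun (fun M => @eval R (angles sl M) x).
Proof. by apply: polynomial_eval; exact: polynomial_mxread. Qed.

Lemma pieceP S r M : readable S -> piece S r M <->
  [/\ torus2 (angles (angle_slots S) M), place r (angles (angle_slots S) M) = angles (angle_slots S) M
    & M = mxval (angles (angle_slots S) M) S].
Proof.
move=> rS; split=> [[th hth <-]|[h1 h2 h3]].
  rewrite mxval_cell angles_readable //; split=> //; first exact: place_torus.
  by rewrite place_place // /in_region !eqxx !orbT.
by exists (angles (angle_slots S) M); rewrite ?mxval_cell ?h2.
Qed.

Lemma piece_closed S r : readable S -> zclosed (piece S r).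
Proof.
move=> rS; pose A := @angles R (angle_slots S).
have pA x : polynomial_fun (fun M => eval (A M) x) := polynomial_angles (angle_slots S) x.
have -> : piece S r =
  ([set M | (A M).1.1 ^+ 2 + (A M).1.2 ^+ 2 = 1] `&` [set M | (A M).2.1 ^+ 2 + (A M).2.2 ^+ 2 = 1]) `&`
  ([set M | eval (A M) (cell_subst r).1.1 = (A M).1.1] `&`
   [set M | eval (A M) (cell_subst r).1.2 = (A M).1.2] `&`
   ([set M | eval (A M) (cell_subst r).2.1 = (A M).2.1] `&`
    [set M | eval (A M) (cell_subst r).2.2 = (A M).2.2])) `&`
  [set M : 'M[R]_5 | forall ij : 'I_5 * 'I_5, M ij.1 ij.2 = eval (A M) (sget S ij.1 ij.2)].
  apply/seteqP; split=> M.
    move/(pieceP _ _ rS); rewrite -/A => -[[h1 h2] e3 h4]; split; first split; first by [].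
      split; split.
      - exact: (congr1 (fun q : quad R => q.1.1) e3).
      - exact: (congr1 (fun q : quad R => q.1.2) e3).
      - exact: (congr1 (fun q : quad R => q.2.1) e3).
      - exact: (congr1 (fun q : quad R => q.2.2) e3).
    by move=> [i j]; rewrite {1}h4 mxvalE.
  move=> [[[h1 h2] [[e1 e2] [e3 e4]]] h4]; apply/(pieceP _ _ rS); rewrite -/A; split.
  - by split.
  - have eta (q : quad R) : q = ((q.1.1, q.1.2), (q.2.1, q.2.2)) by case: q => -[? ?] [? ?].
    by rewrite [RHS]eta; congr pair; congr pair.
  - by apply/matrixP => i j; rewrite mxvalE; exact: (h4 (i, j)).
have zc f g := @zclosed_eq R 5 5 f g.
have px (r' : bool * nat * nat) : polynomial_fun (@mxread R r') := polynomial_mxread r'.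
apply: zclosedI; first apply: zclosedI; first apply: zclosedI.
- by apply: zc; [apply: polynomialD; apply: polynomialX; exact: px|exact: polynomial_cst].
- by apply: zc; [apply: polynomialD; apply: polynomialX; exact: px|exact: polynomial_cst].
- by do 2?apply: zclosedI; (apply: zc; [exact: pA|exact: px]).
- apply: (zclosed_forall (F := fun (ij : 'I_5 * 'I_5) => [set M : 'M[R]_5 | M ij.1 ij.2 = eval (A M) (sget S ij.1 ij.2)])).
  by move=> [i j]; apply: zc; [exact: polynomial_entry|exact: pA].
Qed.

Lemma piece_irreducible S r : zirreducible (piece S r).
Proof. exact: simage_irreducible. Qed.

End Pieces.

Definition circle_smx (c s : entry) : smx :=
  [:: [:: c; eopp true s; None; None; None];
      [:: s; c; None; None; None];
      [:: None; None; eone; None; None];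
      [:: None; None; None; eone; None];
      [:: None; None; None; None; eone]].

Definition line_circle (r : cell) : smx :=
  if r.1 is None then circle_smx cos1 sin1 else circle_smx cos2 sin2.

Definition lines : seq cell :=
  [seq (Some a, None) | a <- [:: (false, false); (false, true); (true, false); (true, true)]] ++
  [seq (None, Some a) | a <- [:: (false, false); (false, true); (true, false); (true, true)]].

Definition line_data (ty : bool) : seq (swaps * swaps * seq bool) :=
  if ty then
   [:: ([:: (1, 2)], [::], [:: false; true; false; false; false]);
       ([:: (1, 2)], [::], [:: true; false; false; false; false]);
       ([:: (0, 2); (1, 0)], [::], [:: false; false; false; false; false]);
       ([:: (0, 2); (1, 0)], [::], [:: true; true; false; false; false]);
       ([:: (0, 1)], [:: (0, 1); (0, 2)], [:: false; true; false; false; false]);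
       ([::], [:: (1, 2)], [:: true; true; true; false; false]);
       ([::], [:: (0, 2); (1, 0)], [:: true; true; false; false; false]);
       ([:: (0, 1)], [:: (0, 2)], [:: false; true; true; false; false])]
  else
   [:: ([:: (0, 2); (1, 3)], [:: (0, 2); (1, 3)], [:: false; false; false; false; false]);
       ([:: (0, 2); (1, 3)], [:: (0, 2); (1, 3)], [:: true; true; false; false; false]);
       ([:: (0, 2); (1, 3)], [:: (0, 3); (1, 2); (1, 0)], [:: true; false; false; false; false]);
       ([:: (0, 2); (1, 3)], [:: (0, 3); (1, 2); (1, 0)], [:: false; true; false; false; false]);
       ([::], [::], [:: false; false; false; false; false]);
       ([::], [::], [:: false; false; true; true; false]);
       ([::], [:: (2, 3)], [:: false; false; true; false; false]);
       ([::], [:: (2, 3)], [:: false; false; false; true; false])]%N.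

Lemma line_data_correct : all (fun ty => all (fun rd : cell * (swaps * swaps * seq bool) =>
    let: (r, (s, t, e)) := rd in [&& valid_swaps s, valid_swaps t &
      all5 (fun i j => eqe (sget (cell_smx (btemplate ty) r) i j)
                           (sget (srelabel s t (nth false e) (line_circle r)) i j))])
    (zip lines (line_data ty))) [:: true; false].
Proof. by vm_compute. Qed.

Lemma csmx_line_degrees : all (fun S => all (fun r : cell =>
    if r.1 is None then degrees_satisfy (cell_smx S r) (fun d1 d2 => (d1 <= 1) && (d2 == 0))%N
    else degrees_satisfy (cell_smx S r) (fun d1 d2 => (d1 == 0) && (d2 <= 1))%N) lines) csmxs.
Proof. by vm_compute. Qed.

Lemma csmx_shapes : all (fun kS : nat * smx => readable_angles kS.2 &&
    if (kS.1 < 32)%N then readable_products kS.2 && degrees_satisfy kS.2 bilinear_degrees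
    else degrees_satisfy kS.2 linear_degrees) (zip (iota 0 64) csmxs).
Proof. by vm_compute. Qed.

Lemma mem_lines r : (r \in lines) = is_line (Some r).
Proof. by case: r => [[[[] []]|] [[[] []]|]]. Qed.

Section Lines.
Context (R : realType).
Implicit Types (th : quad R) (S : smx) (r : cell).

Lemma diag2111_rot th c s :
  mxval th (circle_smx c s) = diag2111 (rot (eval th c, eval th s)).
Proof.
pose f i j := eval th (sget (circle_smx c s) i j).
transitivity (\matrix_(i < 2 + 3, j < 2 + 3) f i j); first by [].
rewrite -block_matrix_fun; apply: (@block_mx_congr R 2 2 3 3); apply/matrixP.
- by elim/ord2P; elim/ord2P; rewrite !mxE /rot_entry /f /sget /= ?evalN ?expr1 ?mulN1r.
- by elim/ord2P; elim/ord3P; rewrite !mxE.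
- by elim/ord3P; elim/ord2P; rewrite !mxE.
- by elim/ord3P; elim/ord3P; rewrite !mxE /f /sget /= ?expr0 ?mulr1 ?mulr1n ?mulr0n.
Qed.

Lemma simage_line_circle r : is_line (Some r) ->
  simage (line_circle r) = [set diag2111 A | A in @SO R 2].
Proof.
case: r => -[a|] [b|] //= _; rewrite /line_circle /=.
  apply/seteqP; split=> [_ [th [h1 h2] <-]|_ [A /SO2_rot [u hu ->] <-]].
    by rewrite diag2111_rot // eval_cos2 eval_sin2 -surjective_pairing; exists (rot th.2) => //; exact: rot_SO2.
  by exists (u, u); rewrite ?diag2111_rot // eval_cos2 eval_sin2 -surjective_pairing.
apply/seteqP; split=> [_ [th [h1 h2] <-]|_ [A /SO2_rot [u hu ->] <-]].
  by rewrite diag2111_rot // eval_cos1 eval_sin1 -surjective_pairing; exists (rot th.1) => //; exact: rot_SO2.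
by exists (u, u); rewrite ?diag2111_rot // eval_cos1 eval_sin1 -surjective_pairing.
Qed.

Lemma mxval_srelabel th s t (e : seq bool) S : valid_swaps s -> valid_swaps t ->
  mxval th (srelabel s t (nth false e) S) =
  signed_relabel (sperm s) (sperm t) (fun i => nth false e i) (mxval th S).
Proof.
move=> vs vt; apply/matrixP => i j; rewrite signed_relabelE !mxvalE sget_smake // evalN.
by rewrite !sapplyE.
Qed.

Lemma template_line_copy ty r : is_line (Some r) -> SO2_copy (@piece R (btemplate ty) r).
Proof.
move=> lr; rewrite /SO2_copy -(simage_line_circle lr).
have tyT : ty \in [:: true; false] by case: ty.
have /allP h := allP line_data_correct ty tyT.
have rl : r \in lines by rewrite mem_lines.
have sz : size (line_data ty) = size lines by case: (ty).
pose i := index r lines; have il : (i < size lines)%N by rewrite index_mem.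
have := h (nth (r, ([::], [::], [::])) (zip lines (line_data ty)) i).
rewrite mem_nth ?size_zip ?sz ?minnn // => /(_ isT); rewrite nth_zip ?sz // nth_index //.
case: (nth _ _ _) => -[s t] e /and3P [vs vt /all5P eqS].
exists (sperm s), (sperm t), (fun i => nth false e i).
rewrite /piece /simage image_comp; congr image; apply/funext => th /=.
rewrite -mxval_srelabel //; apply/matrixP => k l; rewrite !mxvalE.
by have /eqeP -> := eqS _ _ (ltn_ord k) (ltn_ord l).
Qed.

Lemma bsmx_line_copy ty s t x y z r : valid_swaps s -> valid_swaps t -> is_line (Some r) ->
  SO2_copy (@piece R (bsmx ty s t x y z) r).
Proof.
move=> vs vt lr; apply: is_copy_of_trans (template_line_copy ty lr) _.
exists (sperm s), (sperm t), (fun i => nth false (bsign ty x y z) (sperm s i)).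
rewrite /piece /simage image_comp; congr image; apply/funext => th.
by rewrite [RHS]/comp !mxval_cell mxval_bsmx.
Qed.

Definition both (v : 'rV[R]_2) : quad R := ((v 0 0, v 0 1), (v 0 0, v 0 1)).

Lemma polynomial_mapP m n p q (f : 'M[R]_(m, n) -> 'M[R]_(p, q)) :
  (forall i j, polynomial_fun (fun M => f M i j)) -> polynomial_map f.
Proof.
move=> h; have [F hF] := choice (fun ij : 'I_p * 'I_q => h ij.1 ij.2).
by exists (fun i j => F (i, j)) => M i j; exact: (hF (i, j)).
Qed.

Definition free_angle r (q : quad R) := if r.1 is None then q.1 else q.2.

Lemma place_free_angle r th (u := free_angle r (place r th)) : is_line (Some r) ->
  place r (u, u) = place r th.
Proof.
case: r @u => -[a|] [b|] // u _; rewrite [LHS]surjective_pairing [RHS]surjective_pairing.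
  by congr pair; [exact: place_Some1|rewrite place_None2].
by congr pair; [rewrite place_None1|exact: place_Some2].
Qed.

Lemma free_angle_place r u : is_line (Some r) -> free_angle r (place r (u, u)) = u.
Proof. by case: r => -[a|] [b|] // _; [exact: place_None2|exact: place_None1]. Qed.

Lemma line_isomorphic S r : readable S -> is_line (Some r) ->
  isomorphic (piece S r) (unit_circle R).
Proof.
move=> rS lr; pose free := free_angle r.
pose f (M : 'M[R]_5) : 'rV[R]_2 :=
  \row_j (let u := free (angles (angle_slots S) M) in if j == 0 then u.1 else u.2).
pose g v := mxval (both v) (cell_smx S r).
have freeE th : place r (free (place r th), free (place r th)) = place r th.
  exact: place_free_angle.
have free_place u : free (place r (u, u)) = u by exact: free_angle_place.
have free_torus th : torus2 th -> circle (free th) by move=> [h1 h2]; rewrite /free /free_angle; case: (r.1).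
have both_f th : both (f (mxval (place r th) S)) = (free (place r th), free (place r th)).
  by rewrite /both /f !mxE /= angles_readable //; case: (free _).
exists f, g; split.
- apply: polynomial_mapP => i j; rewrite /f; have px (sl : bool * nat * nat) : polynomial_fun (@mxread R sl) := @polynomial_mxread R sl.
  have [p hp] : polynomial_fun (fun M => let u := free (angles (angle_slots S) M) in if j == 0 then u.1 else u.2).
    by rewrite /free /free_angle; case: (r.1) => [a|]; case: (j == 0); apply: px.
  by exists p => M; rewrite mxE; exact: hp.
- apply: polynomial_mapP => i j.
  have [p hp] : polynomial_fun (fun v => eval (both v) (sget (cell_smx S r) i j)).
    by apply: polynomial_eval; exact: polynomial_entry.
  by exists p => M; rewrite mxvalE hp.
- move=> _ [th hth <-]; rewrite /g !mxval_cell both_f freeE //; split=> //.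
  have := free_torus _ (place_torus r hth); rewrite /unit_circle /= /f !mxE /= angles_readable //.
- move=> v hv; split.
    by exists (both v) => //; split.
  apply/rowP => j; rewrite /f !mxE /g mxval_cell angles_readable // /both free_place /=.
  by elim/ord2P: j => //=; congr (v _ _); apply/val_inj.
Qed.

Lemma line_growth S r : is_line (Some r) ->
  (if r.1 is None then degrees_satisfy (cell_smx S r) (fun d1 d2 => (d1 <= 1) && (d2 == 0))%N
    else degrees_satisfy (cell_smx S r) (fun d1 d2 => (d1 == 0) && (d2 <= 1))%N) ->
  growth (@piece R S r) 1.
Proof.
by case: r => -[a|] [b|] //= _; [exact: growth1_line2|exact: growth1_line1].
Qed.

Lemma line_chain S r : readable S -> is_line (Some r) -> has_chain (@piece R S r) 1.
Proof.
move=> rS lr; pose q := (false, false).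
pose c := (Some (odflt q r.1), Some (odflt q r.2)) : cell.
have rc : in_region r c by case: r lr @c => -[a|] [b|] //= _; rewrite /in_region /= ?eqxx.
have sc : strictly_inside c r by case: r lr @c {rc} => -[a|] [b|].
exists (fun i => if i is 0%N then piece S c else piece S r); split.
  by move=> [|i] _; split=> //; [exact: piece_closed|exact: piece_irreducible|exact: piece_sub
    |exact: piece_closed|exact: piece_irreducible].
by move=> [|i] // _; exact: piece_proper.
Qed.

Lemma simage_dimension S : readable S -> dimension (@simage R S) 2.
Proof.
move=> rS; split; last first.
  exact: growth_no_chain (@simage_growth2 R S).
pose q := (false, false).
exists (fun i => if i is 0%N then piece S (Some q, Some q)
                 else if i is 1%N then piece S (Some q, None) else piece S (None, None)).
split=> [i _|[|[|i]] // _]; last 2 first.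
- exact: piece_proper.
- exact: piece_proper.
by case: i => [|[|i]]; (split; rewrite -?piece_gen;
  [exact: piece_closed|exact: piece_irreducible|exact: piece_sub]).
Qed.

Definition constant_quad : quad R := ((1, 0), (1, 0)).

Lemma point_piece S a b :
  piece S (Some a, Some b) = [set mxval (place (Some a, Some b) constant_quad) S].
Proof.
have pE th : place (Some a, Some b) th = place (Some a, Some b) constant_quad.
  rewrite [LHS]surjective_pairing [RHS]surjective_pairing.
  by congr pair; [exact: place_Some1|exact: place_Some2].
apply/seteqP; split=> [_ [th hth <-]|_ ->]; first by rewrite mxval_cell pE.
by exists constant_quad; [exact: quarter_turn_torus|rewrite mxval_cell].
Qed.

Definition sign_or_zero (x : R) := [\/ x = 0, x = 1 | x = -1].

Lemma sign_or_zeroM x y : sign_or_zero x -> sign_or_zero y -> sign_or_zero (x * y).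
Proof.
case=> ->; first by rewrite mul0r; constructor 1.
  by rewrite mul1r.
rewrite mulN1r; case=> ->; [constructor 1|constructor 3|constructor 2] => //.
  by rewrite oppr0.
by rewrite opprK.
Qed.

Lemma sign_or_zero_sign (b : bool) : sign_or_zero ((-1) ^+ b).
Proof. by case: b; rewrite ?expr1 ?expr0; [constructor 3|constructor 2]. Qed.

Lemma sign_or_zeroX x n : sign_or_zero x -> sign_or_zero (x ^+ n).
Proof.
move=> hx; elim: n => [|n ih]; first by rewrite expr0; constructor 2.
by rewrite exprS; apply: sign_or_zeroM.
Qed.

Lemma sign_or_zero_eval th x : sign_or_zero th.1.1 -> sign_or_zero th.1.2 ->
  sign_or_zero th.2.1 -> sign_or_zero th.2.2 -> sign_or_zero (eval th x).
Proof.
move=> h1 h2 h3 h4; case: x => [[[b [i j]] [k l]]|]; last by constructor 1.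
apply: sign_or_zeroM; first exact: sign_or_zero_sign.
by do 2?apply: sign_or_zeroM; apply: sign_or_zeroX.
Qed.

Lemma sign_or_zero_place a b th (p := place (Some a, Some b) th) :
  [/\ sign_or_zero p.1.1, sign_or_zero p.1.2, sign_or_zero p.2.1 & sign_or_zero p.2.2].
Proof.
have s1 c : sign_or_zero (eval th (eopp c eone)).
  by rewrite evalN eval1 mulr1; exact: sign_or_zero_sign.
by case: a b @p => [[] c] [[] d] p; split; (exact: s1 || constructor 1).
Qed.

Lemma signed_permutation_of_orthogonal (M : 'M[R]_5) : M *m M^T = 1%:M ->
  (forall i j, sign_or_zero (M i j)) -> signed_permutation M.
Proof.
move=> oM sM.
have unique (F : 'I_5 -> R) : (forall j, sign_or_zero (F j)) -> \sum_j F j * F j = 1 ->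
    exists! j, F j != 0.
  move=> sF sumF; have : (#|[pred j | F j != 0]|)%:R = 1 :> R.
    rewrite -[RHS]sumF -sum1_card natr_sum [LHS]big_mkcond; apply: eq_bigr => j _.
    by rewrite inE; case: (sF j) => ->; rewrite ?mulrNN ?mulr0 ?mulr1 ?oppr_eq0 ?oner_eq0 ?eqxx.
  move/eqP; rewrite (eqr_nat R _ 1) => /card1P [j hj].
  exists j; split=> [|k Fk]; first by have := hj j; rewrite !inE eqxx.
  by have := hj k; rewrite !inE Fk => /esym /eqP.
split=> [i|j|i j].
- by apply: (unique (M i)) => //; rewrite (orthogonal_rows oM) eqxx.
- by apply: (unique (M^~ j)) => //; rewrite (orthogonal_cols oM) eqxx.
- by case: (sM i j) => ->; [rewrite eqxx|left|right].
Qed.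

End Lines.

Lemma block_data_valid :
  all (fun q => valid_swaps (brow q) && valid_swaps (bcol q)) (iota 0 16).
Proof. by vm_compute. Qed.

Lemma btype_lt8 : all (fun q => btype q == (q < 8)%N) (iota 0 16).
Proof. by vm_compute. Qed.

Lemma itable_sizes : all (fun s => size s == 64%N) itable && (size itable == 64%N).
Proof. by vm_compute. Qed.

Lemma mem_cells c : c \in cells.
Proof. by case: c => [[[[] []]|] [[[] []]|]]. Qed.

Lemma enull_eopp b x : enull (eopp b x) = enull x.
Proof. by case: x => [[[]]|]. Qed.

Lemma mem_bits5 s : size s = 5%N -> s \in bits5.
Proof.
case: s => [|a [|b [|c [|d [|e [|]]]]]] //=.
by case: a; case: b; case: c; case: d; case: e.
Qed.

Section Supports.
Context (R : realType).

Lemma sum_neq0_of_count1 (s : seq R) : count (fun x => x != 0) s = 1%N -> \sum_(x <- s) x <> 0.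
Proof.
elim: s => [|x s ih] //=; rewrite big_cons; have [->|x0] := eqVneq x 0.
  by rewrite add0r.
rewrite add1n => -[] c0; rewrite big_seq big1 ?addr0; first exact/eqP.
move=> y ys; apply/eqP; apply: contraTT ys => y0.
apply: contraL (isT) => ys; move/eqP: c0; rewrite -leqn0 leqNgt -has_count.
by move/hasPn/(_ y ys); rewrite y0.
Qed.

Lemma orthogonal_support_compatible (F G : nat -> R) s : \sum_(k <- s) F k * G k = 0 ->
  support_compatible [seq F k != 0 | k <- s] [seq G k != 0 | k <- s].
Proof.
move=> FG; apply/negP; rewrite zip_map count_map => /eqP c1.
apply: (@sum_neq0_of_count1 [seq F k * G k | k <- s]); last by rewrite big_map.
by rewrite count_map -c1; apply: eq_count => k /=; rewrite mulf_eq0 negb_or.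
Qed.

Lemma unit_support (F : nat -> R) s : \sum_(k <- s) F k * F k = 1 -> has id [seq F k != 0 | k <- s].
Proof.
move=> F1; apply: contraPT F1; rewrite has_map => /hasPn h.
rewrite big_seq big1 => [/eqP|k /h /=]; first by rewrite eq_sym oner_eq0.
by rewrite negbK => /eqP ->; rewrite mul0r.
Qed.

Definition entry_at (M : 'M[R]_5) (i j : nat) : R := M (inord i) (inord j).

Definition row_support M i : seq bool := [seq entry_at M i j != 0 | j <- iota 0 5].

Lemma inord5_eq i j : (i < 5)%N -> (j < 5)%N -> (inord i == inord j :> 'I_5) = (i == j).
Proof. by move=> hi hj; rewrite -val_eqE /= !inordK. Qed.

Lemma sum_entries (F : nat -> R) (G : 'I_5 -> R) : (forall k : 'I_5, F k = G k) ->
  \sum_(k <- iota 0 5) F k = \sum_k G k.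
Proof.
move=> FG; rewrite -[iota 0 5]/(index_iota 0 5) big_mkord.
by apply: eq_bigr => k _.
Qed.

Lemma rows_sum M i j : M *m M^T = 1%:M -> (i < 5)%N -> (j < 5)%N ->
  \sum_(k <- iota 0 5) entry_at M i k * entry_at M j k = (i == j)%:R.
Proof.
move=> oM hi hj; rewrite (sum_entries (G := fun k => M (inord i) k * M (inord j) k)).
  by rewrite (orthogonal_rows oM) inord5_eq.
by move=> k; rewrite /entry_at inord_val.
Qed.

Lemma cols_sum M i j : M *m M^T = 1%:M -> (i < 5)%N -> (j < 5)%N ->
  \sum_(k <- iota 0 5) entry_at M k i * entry_at M k j = (i == j)%:R.
Proof.
move=> oM hi hj; rewrite (sum_entries (G := fun k => M k (inord i) * M k (inord j))).
  by rewrite (orthogonal_cols oM) inord5_eq.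
by move=> k; rewrite /entry_at inord_val.
Qed.

Lemma SOstar_block_zeros M : SOstar R M -> exists2 q, (q < 16)%N &
  forall i j : 'I_5, enull (sget (qsmx q false false) i j) -> M i j = 0.
Proof.
move=> [[oM _] zM].
have compat i j : (i < 5)%N -> (j < 5)%N -> i != j ->
    support_compatible (row_support M i) (row_support M j).
  by move=> hi hj /negPf ij; apply: orthogonal_support_compatible; rewrite rows_sum // ij.
have rowP i : (i < 5)%N -> row_support M i \in row_supports i.
  move=> hi; rewrite mem_filter mem_bits5 ?size_map ?size_iota // andbT.
  rewrite unit_support ?rows_sum ?eqxx // andTb; apply/allP => j; rewrite mem_iota => /andP [_ hj].
  apply/implyP => fij; rewrite (nth_map 0%N) ?size_iota // nth_iota // negbK /entry_at.
  by apply/eqP; apply: zM; rewrite /forced_zero !inordK.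
pose rs := [seq row_support M i | i <- iota 0 5].
have : if orthogonal_supports rs then has (block_support^~ rs) (iota 0 16) else true.
  have := supports_in_blocks.
  move=> /allP /(_ _ (rowP 0%N isT)) /allP /(_ _ (rowP 1%N isT)); rewrite compat //.
  move=> /allP /(_ _ (rowP 2 isT)); rewrite !compat //.
  move=> /allP /(_ _ (rowP 3 isT)); rewrite !compat //.
  by move=> /allP /(_ _ (rowP 4 isT)); rewrite !compat.
case: ifP => [_ /hasP [q]|/negP []].
  rewrite mem_iota => /andP [_ hq] /all5P bq; exists q => // i j nij.
  have /implyP /(_ nij) := bq i j (ltn_ord i) (ltn_ord j).
  rewrite (nth_map 0%N) ?size_iota // nth_iota // (nth_map 0%N) ?size_iota // nth_iota //.
  by rewrite negbK /entry_at !add0n !inord_val => /eqP.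
rewrite /orthogonal_supports /rs.
have colE : [seq [seq nth false r j | r <- [seq row_support M i | i <- iota 0 5]] | j <- iota 0 5] =
    [seq [seq entry_at M i j != 0 | i <- iota 0 5] | j <- iota 0 5].
  apply/eq_in_map => j; rewrite mem_iota => /andP [_ hj].
  rewrite -map_comp; apply: eq_map => i.
  by rewrite /comp (nth_map 0%N) ?size_iota // nth_iota.
rewrite [map _ (iota 0 5) in X in all _ X]colE [X in pairwise _ X]colE.
apply/andP; split.
  apply/allP => _ /mapP [j + ->]; rewrite mem_iota => /andP [_ hj].
  by apply: unit_support; rewrite cols_sum ?eqxx.
have ccompat i j : (i < 5)%N -> (j < 5)%N -> i != j ->
    support_compatible [seq entry_at M k i != 0 | k <- iota 0 5]
                       [seq entry_at M k j != 0 | k <- iota 0 5].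
  move=> hi hj /negPf ij.
  apply: (@orthogonal_support_compatible (entry_at M ^~ i) (entry_at M ^~ j)).
  by rewrite cols_sum // ij.
rewrite pairwise_map /= !ccompat //.
Qed.

End Supports.

(** * The 64 components *)

Section Components.
Context (R : realType).
Implicit Types (k l q : nat) (r : cell) (M : 'M[R]_5).

Definition component k : set 'M[R]_5 := simage (csmx k).

Lemma csmx_in k : (k < 64)%N -> csmx k \in csmxs.
Proof. by move=> hk; rewrite csmxsE; apply/mapP; exists k; rewrite ?mem_iota. Qed.

Lemma nth_csmxs k : (k < 64)%N -> nth [::] csmxs k = csmx k.
Proof. by move=> hk; rewrite csmxsE (nth_map 0%N) ?size_iota // nth_iota. Qed.

Lemma csmx_readable k : (k < 64)%N -> readable (csmx k).
Proof. by move/csmx_in; apply/allP; exact: readable_csmxs. Qed.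

Lemma itab_correct k l c (M := cell_smx (csmx k) c) : (k < 64)%N -> (l < 64)%N ->
  if (if itab k l is Some r then in_region r c else false)
  then smx_in (csmx l) (angle_slots (csmx l)) M else smx_out (csmx l) (angle_slots (csmx l)) M.
Proof.
move=> hk hl; have /andP [/allP sz /eqP szt] := itable_sizes.
have szk : size (nth [::] itable k) = 64%N by apply/eqP/sz/mem_nth; rewrite szt.
have szc : size csmxs = 64%N by rewrite csmxsE size_map size_iota.
have := allP itable_correct (nth ([::], [::]) (zip csmxs itable) k).
rewrite mem_nth ?size_zip ?szc ?szt // nth_zip ?szc ?szt // => /(_ isT).
rewrite nth_csmxs // => /allP /(_ c (mem_cells c)) /allP.
pose d := (([::] : smx, angle_slots [::]), None : option cell).
move=> /(_ (nth d (zip located_csmxs (nth [::] itable k)) l)).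
rewrite mem_nth ?size_zip ?size_map ?szc ?szk // nth_zip ?size_map ?szc ?szk // => /(_ isT).
by rewrite (nth_map [::]) ?szc // nth_csmxs.
Qed.

Definition intersection_piece k l : set 'M[R]_5 :=
  if itab k l is Some r then piece (csmx k) r else set0.

Lemma component_intersection k l : (k < 64)%N -> (l < 64)%N ->
  component k `&` component l = intersection_piece k l.
Proof.
move=> hk hl; have [rk rl] := (csmx_readable hk, csmx_readable hl); apply/seteqP; split.
  move=> M [[th hth <-] Ml].
  have cE : mxval th (cell_smx (csmx k) (cell_of th)) = mxval th (csmx k).
    by rewrite mxval_cell /place in_region_subst // /in_region !eqxx !orbT.
  have := itab_correct (cell_of th) hk hl; rewrite /intersection_piece.
  have out : smx_out (csmx l) (angle_slots (csmx l)) (cell_smx (csmx k) (cell_of th)) -> False.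
    by move/(smx_outP rl); rewrite cE.
  case: (itab k l) => [r|/out //]; case: ifP => [rc _|_ /out //].
  by exists th => //; rewrite mxval_cell /place in_region_subst.
rewrite /intersection_piece; case e: (itab k l) => [r|] // M [th hth <-].
split; first by exists (place r th); [exact: place_torus|rewrite mxval_cell].
have rr : in_region r r by rewrite /in_region !eqxx !orbT.
by have := itab_correct r hk hl; rewrite e rr => /(smx_inP hth rl).
Qed.

Lemma itab_cases k l : (k < 64)%N -> (l < 64)%N -> k != l ->
  [\/ itab k l = None, is_line (itab k l) | is_point (itab k l)].
Proof.
move=> hk hl /negPf kl.
have /allP /(_ k) := itab_proper; rewrite mem_iota => /(_ hk) /allP /(_ l).
rewrite mem_iota => /(_ hl); rewrite kl => /orP [/orP [/eqP|]|]; by [constructor 1|constructor 2|constructor 3].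
Qed.

Lemma component_not_sub k l : (k < 64)%N -> (l < 64)%N -> k != l ->
  ~ (component k `<=` component l).
Proof.
move=> hk hl kl sub; have rk := csmx_readable hk.
have : component k `<=` intersection_piece k l.
  by rewrite -component_intersection // => M Mk; split=> //; apply: sub.
rewrite /intersection_piece; have := itab_cases hk hl kl; case: (itab k l) => [r|] h; last first.
  by move/(_ (mxval (generic_pt R, generic_pt R) (csmx k))); apply; exists (generic_pt R, generic_pt R) => //; exact: generic_torus.
rewrite /component -piece_gen; apply: piece_nsub => //.
by case: h => //; case: r => [[a|] [b|]].
Qed.

Lemma component_inj k l : (k < 64)%N -> (l < 64)%N -> component k = component l -> k = l.
Proof.
move=> hk hl e; case: (eqVneq k l) => // kl.
by case: (component_not_sub hk hl kl); rewrite e.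
Qed.

Lemma component_irreducible k : zirreducible (component k).
Proof. exact: simage_irreducible. Qed.

Lemma component_closed k : (k < 64)%N -> zclosed (component k).
Proof. by move=> hk; rewrite /component -piece_gen; exact/piece_closed/csmx_readable. Qed.

Lemma quad_lt k : (k < 64)%N -> (k %/ 4 < 16)%N. Proof. by move=> hk; rewrite ltn_divLR. Qed.

Lemma quad_valid q : (q < 16)%N -> valid_swaps (brow q) /\ valid_swaps (bcol q).
Proof. by move=> hq; apply/andP; apply: (allP block_data_valid); rewrite mem_iota. Qed.

Lemma qsmx_SO q y z th : (q < 16)%N -> torus2 th -> SO R 5 (mxval th (qsmx q y z)).
Proof.
move=> /quad_valid [v1 v2] hth; apply: bsmx_SO => //.
by case: (odd _); case: y; case: z.
Qed.

Lemma component_SO k M : (k < 64)%N -> component k M -> SO R 5 M.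
Proof. by move=> /quad_lt hq [th hth <-]; exact: qsmx_SO. Qed.

Lemma csmx_quad q (y z : bool) : csmx (4 * q + (y * 2 + z)) = qsmx q y z.
Proof.
rewrite /csmx mulnC divnMDl // divn_small ?addn0; last by case: y; case: z.
by congr qsmx; case: y; case: z; rewrite /= ?addn0 ?oddD ?oddM ?andbF //; lia.
Qed.

Lemma block_signs q y z : (q < 16)%N ->
  (forall i j, (i < 5)%N -> (j < 5)%N ->
     enull (sget (qsmx q y z) i j) = enull (sget (qsmx q false false) i j)) /\
  (forall i j, (i < 5)%N -> (j < 5)%N -> forced i j -> sget (qsmx q y z) i j = None).
Proof.
move=> hq; have /allP /(_ q) := block_zeros_sign; rewrite mem_iota => /(_ hq) /allP /(_ (y, z)).
have -> : (y, z) \in [:: (false, false); (false, true); (true, false); (true, true)] by case: y; case: z.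
move=> /(_ isT) /andP [/all5P h1 /all5P h2]; split=> i j hi hj.
  exact/eqP/h1.
by move=> f; apply/enullP; exact: (implyP (h2 i j hi hj)).
Qed.

Lemma SOstar_components M : SOstar R M <-> exists2 k, (k < 64)%N & component k M.
Proof.
split=> [hM|[k hk kM]].
  have [q hq zM] := SOstar_block_zeros hM.
  have [vs vt] := quad_valid hq.
  have [|y [z [th [hth ->]]]] := SO_bsmx (ty := btype q) vs vt hM.1.
    move=> i j e; apply: zM; move: e; rewrite /qsmx /bsmx !sget_smake // => e.
    by rewrite enull_eopp; move/enullP: e; rewrite enull_eopp.
  exists (4 * q + (y * 2 + z))%N; first by move: hq; case: (y); case: (z); lia.
  by exists th => //; rewrite csmx_quad.
split; first exact: component_SO kM.
move=> i j fij; have [_ h] := @block_signs (k %/ 4) (odd (k %/ 2)) (odd k) (quad_lt hk).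
by case: kM => th _ <-; rewrite mxvalE [sget _ _ _]h.
Qed.

Lemma component_in_SOstar k : (k < 64)%N -> irr_closed_in (SOstar R) (component k).
Proof.
move=> hk; split; [exact: component_closed|exact: component_irreducible|].
by move=> M kM; apply/SOstar_components; exists k.
Qed.

Lemma irr_closed_sub_component Y : irr_closed_in (SOstar R) Y ->
  exists2 k, (k < 64)%N & Y `<=` component k.
Proof.
move=> [_ irr sub].
have [|M YM|k hk Yk] := @zirreducible_sub_bigU _ _ _ _ (iota 0 64) (fun k => piece (csmx (k %% 64)) (None, None)) Y _ irr.
- by move=> k; apply: piece_closed; apply: csmx_readable; rewrite ltn_mod.
- have /SOstar_components [k hk kM] := sub _ YM.
  by exists k; rewrite ?mem_iota // modn_small // piece_gen.
rewrite mem_iota in hk; exists k => //; move: Yk; rewrite modn_small // piece_gen //.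
Qed.

Lemma componentsE C : components R C <-> exists2 k, (k < 64)%N & C = component k.
Proof.
split=> [[irrC maxC]|[k hk ->]].
  have [k hk Ck] := irr_closed_sub_component irrC.
  by exists k => //; rewrite (maxC _ (component_in_SOstar hk) Ck).
split; first exact: component_in_SOstar.
move=> Y irrY kY; have [l hl Yl] := irr_closed_sub_component irrY.
have kl : k = l.
  case: (eqVneq k l) => // kl.
  by case: (component_not_sub hk hl kl); apply: subset_trans Yl.
by apply/seteqP; split=> //; rewrite kl.
Qed.

Lemma generic_eval_eq0 (x : entry) : eval (generic_pt R, generic_pt R) x = 0 -> x = None.
Proof.
case: x => [[[b [i j]] [k l]]|] //= /eqP.
by rewrite !mulf_eq0 signr_eq0 !expf_eq0 /= !mulf_eq0 !invr_eq0 !pnatr_eq0 !andbF.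
Qed.

Lemma zero_pattern_component k :
  zero_pattern (component k) = [set ij : 'I_5 * 'I_5 | enull (sget (csmx k) ij.1 ij.2)].
Proof.
apply/seteqP; split=> [[i j] /= h|[i j] /= /enullP h _ [th _ <-]]; last by rewrite mxvalE h.
apply/enullP/generic_eval_eq0; rewrite -mxvalE; apply: h.
by exists (generic_pt R, generic_pt R) => //; exact: generic_torus.
Qed.

Lemma is_true_inj (a b : bool) : is_true a = is_true b -> a == b.
Proof. by move=> e; apply/eqP; apply/idP/idP; rewrite e. Qed.

Lemma zero_pattern_eq k l : (k < 64)%N -> (l < 64)%N ->
  zero_pattern (component k) = zero_pattern (component l) <-> (k %/ 4 = l %/ 4)%N.
Proof.
move=> hk hl; rewrite !zero_pattern_component.
have [sk _] := @block_signs (k %/ 4) (odd (k %/ 2)) (odd k) (quad_lt hk).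
have [sl _] := @block_signs (l %/ 4) (odd (l %/ 2)) (odd l) (quad_lt hl).
split=> [e|e]; last first.
  by apply/seteqP; split=> -[i j] /=; rewrite /csmx sk // sl // e.
apply/eqP; have /allP /(_ (k %/ 4)%N) := block_zeros_distinct; rewrite mem_iota => /(_ (quad_lt hk)).
move=> /allP /(_ (l %/ 4)%N); rewrite mem_iota => /(_ (quad_lt hl)) /orP [//|/negP []].
apply/all5P => i j hi hj; rewrite -sk // -sl //.
by apply: is_true_inj; exact: (congr1 (fun A : set ('I_5 * 'I_5) => A (Ordinal hi, Ordinal hj)) e).
Qed.

Definition quadruple q : set (set 'M[R]_5) := [set component (4 * q + i)%N | i in `I_4].

Lemma quadrupleP q C : quadruple q C <-> exists2 k, (k %/ 4)%N = q & C = component k.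
Proof.
split=> [[i /= hi <-]|[k <- ->]].
  by exists (4 * q + i)%N; rewrite // mulnC divnMDl // divn_small ?addn0.
by exists (k %% 4)%N; [rewrite /= ltn_mod|rewrite mulnC -divn_eq].
Qed.

Lemma quadruplesE Q : quadruples R Q <-> exists2 q, (q < 16)%N & Q = quadruple q.
Proof.
have E k : (k < 64)%N -> [set D | components R D /\ zero_pattern D = zero_pattern (component k)] =
    quadruple (k %/ 4).
  move=> hk; apply/seteqP; split=> D.
    by move=> [/componentsE [l hl ->] /(zero_pattern_eq hl hk) lk]; apply/quadrupleP; exists l.
  move=> /quadrupleP [l lk ->].
  have hl : (l < 64)%N by move: hk lk; lia.
  by split; [apply/componentsE; exists l|apply/zero_pattern_eq].
split=> [[C /componentsE [k hk ->] <-]|[q hq ->]].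
  by exists (k %/ 4)%N; [exact: quad_lt|exact: E].
have hk : (4 * q < 64)%N by lia.
exists (component (4 * q)); first by apply/componentsE; exists (4 * q)%N.
by rewrite E // mulKn.
Qed.

End Components.

Section Quadruples.
Context (R : realType).
Implicit Types (k l q : nat).

Lemma csmx_bsmx k : csmx k = bsmx (btype (k %/ 4)) (brow (k %/ 4)) (bcol (k %/ 4))
  (odd (size (brow (k %/ 4)) + size (bcol (k %/ 4))) (+) (odd (k %/ 2) (+) odd k))
  (odd (k %/ 2)) (odd k).
Proof. by []. Qed.

Lemma btypeE q : (q < 16)%N -> btype q = (q < 8)%N.
Proof. by move=> hq; apply/eqP; apply: (allP btype_lt8); rewrite mem_iota. Qed.

Lemma component_kind k : (k < 64)%N ->
  if (k < 32)%N then SOcirc_copy (@component R k) else torus (@component R k).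
Proof.
move=> hk; have [vs vt] := quad_valid (quad_lt hk).
have e : btype (k %/ 4) = (k < 32)%N by rewrite btypeE ?quad_lt // ltn_divLR.
by rewrite /component csmx_bsmx e; case: (k < 32)%N; [exact: bsmx_SOcirc|exact: bsmx_torus].
Qed.

Lemma component_SOcirc k : (k < 64)%N -> SOcirc_copy (@component R k) <-> (k < 32)%N.
Proof.
move=> hk; have := component_kind hk; case: ifP => _ h; split=> // h'.
by case: (torus_not_SOcirc h h').
Qed.

Lemma component_torus k : (k < 64)%N -> torus (@component R k) <-> (32 <= k)%N.
Proof.
move=> hk; have := component_kind hk; rewrite [(32 <= k)%N]leqNgt; case: ifP => _ h; split=> //= h'.
by case: (torus_not_SOcirc h' h).
Qed.

Lemma component_degree k : (k < 64)%N -> real_degree (@component R k) (if (k < 32)%N then 8 else 4).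
Proof.
move=> hk; have := allP csmx_shapes (nth (0%N, [::]) (zip (iota 0 64) csmxs) k).
have sz : size csmxs = 64%N by rewrite csmxsE size_map size_iota.
rewrite mem_nth ?size_zip ?size_iota ?sz // nth_zip ?size_iota ?sz // => /(_ isT).
rewrite nth_csmxs // nth_iota // add0n [(_, _).1]/= [(_, _).2]/= => /andP [ra].
by case: (k < 32)%N => [/andP [rp dS]|dS]; [apply: degree8_bilinear|apply: degree4_linear].
Qed.

Lemma csmx_line_growth k r : (k < 64)%N -> is_line (Some r) -> growth (@piece R (csmx k) r) 1.
Proof.
move=> hk lr; apply: line_growth => //.
by have /allP /(_ r) := allP csmx_line_degrees _ (csmx_in hk); rewrite mem_lines; apply.
Qed.

Lemma intersection_growth k l : (k < 64)%N -> (l < 64)%N -> k != l ->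
  growth (@intersection_piece R k l) 1.
Proof.
move=> hk hl kl; rewrite /intersection_piece; have := itab_cases hk hl kl.
case: (itab k l) => [r|_]; last exact: growth0.
case=> // h; first exact: csmx_line_growth.
by case: r h => [[a|] [b|]] // _; rewrite point_piece; exact: growth1.
Qed.

Lemma intersection_dimension1 k l : (k < 64)%N -> (l < 64)%N -> k != l ->
  in_curves (@intersection_piece R k l) <-> is_line (itab k l).
Proof.
move=> hk hl kl; split; last first.
  move=> h; split; last exact/growth_no_chain/intersection_growth.
  by move: h; rewrite /intersection_piece; case: (itab k l) => // r; apply: line_chain; exact: csmx_readable.
have := itab_cases hk hl kl; rewrite /intersection_piece; case: (itab k l) => [r|_ [/finite_no_curve h _]].
  case=> // h [ch _]; case: r h ch => [[a|] [b|]] // _.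
  by rewrite point_piece => /finite_no_curve; case; exact: finite_set1.
by case: h.
Qed.

Lemma intersection_points k l : (k < 64)%N -> (l < 64)%N -> k != l ->
  in_points (@intersection_piece R k l) <-> is_point (itab k l).
Proof.
move=> hk hl kl; have := itab_cases hk hl kl; rewrite /intersection_piece.
case: (itab k l) => [r|_]; last by split=> // -[[]].
case=> // h; split=> //.
- by move=> [_ fin]; case: (finite_no_curve fin); apply: line_chain => //; exact: csmx_readable.
- by move: h; case: r => [[a|] [b|]].
- move=> _; case: r h => [[a|] [b|]] // _; rewrite point_piece; split; last exact: finite_set1.
  by exists (mxval (place (Some a, Some b) (constant_quad R)) (csmx k)).
Qed.

Lemma component_curves k l : (k < 64)%N -> (l < 64)%N -> k != l ->
  in_curves (@component R k `&` @component R l) ->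
  SO2_copy (@component R k `&` @component R l) /\
  isomorphic (@component R k `&` @component R l) (unit_circle R).
Proof.
move=> hk hl kl; rewrite component_intersection // intersection_dimension1 //.
rewrite /intersection_piece; case: (itab k l) => // r lr.
have [vs vt] := quad_valid (quad_lt hk).
by split; [exact: bsmx_line_copy|apply: line_isomorphic => //; exact: csmx_readable].
Qed.

Lemma component_points k l : (k < 64)%N -> (l < 64)%N -> k != l ->
  in_points (@component R k `&` @component R l) ->
  exists M : 'M[R]_5, [/\ @component R k `&` @component R l = [set M], signed_permutation M & \det M = 1].
Proof.
move=> hk hl kl; rewrite component_intersection // intersection_points //.
rewrite /intersection_piece; case: (itab k l) => // -[[a|] [b|]] // _.
exists (mxval (place (Some a, Some b) (constant_quad R)) (csmx k)).
have [oM dM] : SO R 5 (mxval (place (Some a, Some b) (constant_quad R)) (csmx k)).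
  apply: qsmx_SO; first exact: quad_lt.
  by apply: place_torus; exact: quarter_turn_torus.
split; rewrite ?point_piece //; apply: signed_permutation_of_orthogonal => // i j.
have [h1 h2 h3 h4] := sign_or_zero_place a b (constant_quad R).
by rewrite mxvalE; exact: sign_or_zero_eval.
Qed.

Lemma quad_index q i : (q < 16)%N -> (i < 4)%N -> (4 * q + i < 64)%N.
Proof. by lia. Qed.

Lemma union_ofI q r : (q < 16)%N -> (r < 16)%N ->
  union_of (@quadruple R q) `&` union_of (@quadruple R r) =
  [set M | exists2 ij, ij \in [seq (i, j) | i <- iota 0 4, j <- iota 0 4] &
           @intersection_piece R (4 * q + ij.1) (4 * r + ij.2) M].
Proof.
move=> hq hr; apply/seteqP; split=> M.
  move=> [[_ [i hi <-] Mi] [_ [j hj <-] Mj]]; exists (i, j).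
    by apply/allpairsP; exists (i, j); rewrite !mem_iota.
  by rewrite -component_intersection ?quad_index.
move=> [_ /allpairsP [[i j] [+ + ->]]]; rewrite !mem_iota /= => hi hj.
rewrite -component_intersection ?quad_index // => -[Mi Mj].
by split; [exists (@component R (4 * q + i)) => //; exists i|exists (@component R (4 * r + j)) => //; exists j].
Qed.

Section Pair.
Variables (q r : nat).
Hypotheses (hq : (q < 16)%N) (hr : (r < 16)%N) (qr : q <> r).
Let X := union_of (@quadruple R q) `&` union_of (@quadruple R r).
Let idx := [seq (i, j) | i <- iota 0 4, j <- iota 0 4].
Let ks := [seq itab (4 * q + i) (4 * r + j) | i <- iota 0 4, j <- iota 0 4].

Let idxP ij : ij \in idx -> [/\ (4 * q + ij.1 < 64)%N, (4 * r + ij.2 < 64)%N &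
  (4 * q + ij.1 != 4 * r + ij.2)%N].
Proof.
move=> /allpairsP [[i j] [+ + ->]]; rewrite !mem_iota /= => hi hj.
by split; [lia|lia|apply/eqP; lia].
Qed.

Let ksE : ks = [seq itab (4 * q + ij.1) (4 * r + ij.2) | ij <- idx].
Proof. by rewrite map_allpairs. Qed.

Let sub ij : ij \in idx -> @intersection_piece R (4 * q + ij.1) (4 * r + ij.2) `<=` X.
Proof. by move=> hij M hM; rewrite /X union_ofI //; exists ij. Qed.

Let growthX : growth X 1.
Proof.
rewrite /X union_ofI //; apply: (growth_bigU (F := fun ij => @intersection_piece R (4 * q + ij.1) (4 * r + ij.2))).
by move=> ij /idxP [h1 h2 h3]; exact: intersection_growth.
Qed.

Let curveX : has is_line ks -> has_chain X 1.
Proof.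
rewrite ksE has_map => /hasP [ij hij /= h]; have [h1 h2 h3] := idxP hij.
apply: has_chain_sub (sub hij) _.
by have [ch _] := (intersection_dimension1 h1 h2 h3).2 h.
Qed.

Let finiteX : ~~ has is_line ks -> finite_set X.
Proof.
rewrite ksE has_map => /hasPn h; rewrite /X union_ofI //.
have -> : [set M | exists2 ij, ij \in idx & @intersection_piece R (4 * q + ij.1) (4 * r + ij.2) M] =
    \bigcup_(ij in [set` idx]) @intersection_piece R (4 * q + ij.1) (4 * r + ij.2).
  by apply/seteqP; split=> M [ij h1 h2]; exists ij.
apply: bigcup_finite => [|ij /= hij]; first exact: finite_seq.
have [h1 h2 h3] := idxP hij; have := itab_cases h1 h2 h3; have := h _ hij.
rewrite /= /intersection_piece; case: (itab _ _) => [c|_ _]; last exact: finite_set0.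
move=> nl; case=> // [lc|]; first by rewrite lc in nl.
by case: c {nl} => [[a|] [b|]] // _; rewrite point_piece; exact: finite_set1.
Qed.

Lemma in_curves_quadruples : in_curves X <-> has is_line ks.
Proof.
split=> [[ch _]|h]; last by split; [exact: curveX|exact: growth_no_chain].
by apply: contraT => /finiteX /finite_no_curve.
Qed.

Lemma in_points_quadruples : in_points X <-> ~~ has is_line ks && has is_point ks.
Proof.
split=> [[X0 fin]|/andP [nl]].
  have nl : ~~ has is_line ks by apply/negP => /curveX; exact: finite_no_curve.
  rewrite nl andTb; move: X0 nl; rewrite /X union_ofI // ksE !has_map => -[M [ij hij hM]] /hasPn /(_ ij hij) nl.
  apply/hasP; exists ij => //; have [h1 h2 h3] := idxP hij; have := itab_cases h1 h2 h3.
  move: hM nl; rewrite /= /intersection_piece; case: (itab _ _) => [c|] // _ nl.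
  by case=> // lc; rewrite lc in nl.
rewrite {1}ksE has_map => /hasP [ij hij /= h]; split; last exact: finiteX.
have [h1 h2 h3] := idxP hij.
have [[M hM] _] := (intersection_points h1 h2 h3).2 h.
by exists M; exact: (sub hij).
Qed.

End Pair.

Lemma quadruple_inj q r : (q < 16)%N -> (r < 16)%N -> @quadruple R q = @quadruple R r -> q = r.
Proof.
move=> hq hr e; have : @quadruple R r (@component R (4 * q)) by rewrite -e; exists 0%N; rewrite ?addn0.
move=> [i hi /component_inj h]; have {h} := h (quad_index hr hi) _.
by move: hi => /= hi; lia.
Qed.

Definition facet_of (Q : set (set 'M[R]_5)) : seq nat :=
  nth [::] facets (find (fun q => `[< Q = @quadruple R q >]) (iota 0 16)).

Lemma facet_of_quadruple q : (q < 16)%N -> facet_of (@quadruple R q) = nth [::] facets q.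
Proof.
move=> hq; rewrite /facet_of; set P := fun _ => _.
have hP : has P (iota 0 16) by apply/hasP; exists q; rewrite ?mem_iota //; exact/asboolP.
have := nth_find 0%N hP; have := hP; rewrite has_find size_iota => lt.
by rewrite nth_iota // add0n => /asboolP /(quadruple_inj hq lt) <-.
Qed.

Lemma facets_uniq : uniq facets && (size facets == 16%N).
Proof. by have [_ _ ->] := polytope_counts. Qed.

Lemma torus_quadruplesE Q : torus_quadruples R Q <->
  exists2 q, (q < 16)%N & ~~ btype q /\ Q = @quadruple R q.
Proof.
split=> [[/quadruplesE [q hq ->] sub]|[q hq [tq ->]]].
  exists q => //; split=> //; rewrite btypeE //.
  have := sub (@component R (4 * q)); move=> /(_ (ex_intro2 _ _ 0%N isT (congr1 _ (addn0 _)))).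
  by rewrite component_torus; lia.
split; first by apply/quadruplesE; exists q.
move=> _ [i /= hi <-]; apply/component_torus; first exact: quad_index.
by move: tq; rewrite btypeE //; lia.
Qed.

Lemma SOcirc_quadruplesE Q : SOcirc_quadruples R Q <->
  exists2 q, (q < 16)%N & btype q /\ Q = @quadruple R q.
Proof.
split=> [[/quadruplesE [q hq ->] sub]|[q hq [tq ->]]].
  exists q => //; split=> //; rewrite btypeE //.
  have := sub (@component R (4 * q)); move=> /(_ (ex_intro2 _ _ 0%N isT (congr1 _ (addn0 _)))).
  by rewrite component_SOcirc; lia.
split; first by apply/quadruplesE; exists q.
move=> _ [i /= hi <-]; apply/component_SOcirc; first exact: quad_index.
by move: tq; rewrite btypeE //; lia.
Qed.

Lemma card_image_nat (T : Type) (f : nat -> T) n (A : set T) :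
  (forall i j, (i < n)%N -> (j < n)%N -> f i = f j -> i = j) ->
  (forall x, A x <-> exists2 i, (i < n)%N & x = f i) -> (A #= `I_n)%card.
Proof.
move=> inj AE; have -> : A = f @` `I_n.
  by apply/seteqP; split=> x; [move=> /AE [i hi ->]; exists i|move=> [i hi <-]; apply/AE; exists i].
by apply: inj_card_eq => i j /set_mem hi /set_mem hj; exact: inj.
Qed.

End Quadruples.

Theorem theorem5p1 (R : realType) :
  [/\ SOstar R = \bigcup_(C in components R) C,
      (components R #= `I_64)%card,
      forall C, components R C -> dimension C 2,
      forall C, components R C ->
        (torus C /\ real_degree C 4) \/ (SOcirc_copy C /\ real_degree C 8)
    & ([set C | components R C /\ torus C] #= `I_32)%card /\
      ([set C | components R C /\ SOcirc_copy C] #= `I_32)%card]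
  /\
  [/\ (quadruples R #= `I_16)%card,
      forall Q, quadruples R Q -> (Q #= `I_4)%card,
      (torus_quadruples R #= `I_8)%card
    & (SOcirc_quadruples R #= `I_8)%card]
  /\
  (exists phi : set (set 'M[R]_5) -> seq nat,
    [/\ set_bij (quadruples R) [set F | F \in facets] phi,
        phi @` torus_quadruples R =
          [set F | F \in facets /\ three_degree_four F],
        phi @` SOcirc_quadruples R =
          [set F | F \in facets /\ ~~ three_degree_four F],
        forall Q Q', quadruples R Q -> quadruples R Q' -> Q <> Q' ->
          (in_curves (union_of Q `&` union_of Q') <-> share_edge (phi Q) (phi Q'))
      & forall Q Q', quadruples R Q -> quadruples R Q' -> Q <> Q' ->
          (in_points (union_of Q `&` union_of Q') <->
             meet_in_vertex (phi Q) (phi Q'))])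
  /\
  (forall C C', components R C -> components R C' -> C <> C' ->
     in_curves (C `&` C') ->
     SO2_copy (C `&` C') /\ isomorphic (C `&` C') (unit_circle R))
  /\
  (forall C C', components R C -> components R C' -> C <> C' ->
     in_points (C `&` C') ->
     exists M : 'M[R]_5,
       [/\ C `&` C' = [set M], signed_permutation M & \det M = 1]).
Proof.
have cinj := @component_inj R.
split; [split|split; [split|split; [|split]]].
- apply/seteqP; split=> M.
    by move=> /SOstar_components [k hk kM]; exists (@component R k) => //; apply/componentsE; exists k.
  by move=> [C /componentsE [k hk ->] kM]; apply/SOstar_components; exists k.
- by apply: (@card_image_nat _ (@component R)) => [i j|C]; [exact: cinj|exact: componentsE].
- by move=> C /componentsE [k hk ->]; apply: simage_dimension; exact: csmx_readable.
- move=> C /componentsE [k hk ->]; have := component_degree R hk; case: ltnP => h d.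
    by right; split=> //; apply/component_SOcirc.
  by left; split=> //; apply/component_torus.
- split.
    apply: (@card_image_nat _ (fun i => @component R (32 + i))) => [i j hi hj /cinj e|C].
      by move: (e (ltac:(lia)) (ltac:(lia))); lia.
    split=> [[/componentsE [k hk ->] /(component_torus _ hk) k32]|[i hi ->]].
      by exists (k - 32)%N; [lia|rewrite subnKC].
    have hk : (32 + i < 64)%N by lia.
    by split; [apply/componentsE; exists (32 + i)%N|apply/component_torus => //; lia].
  apply: (@card_image_nat _ (@component R)) => [i j hi hj|C].
    by apply: cinj; lia.
  split=> [[/componentsE [k hk ->] /(component_SOcirc _ hk) k32]|[i hi ->]]; first by exists k.
  have hk : (i < 64)%N by lia.
  by split; [apply/componentsE; exists i|apply/component_SOcirc].
- by apply: (@card_image_nat _ (@quadruple R)) => [i j|Q]; [exact: quadruple_inj|exact: quadruplesE].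
- move=> Q /quadruplesE [q hq ->].
  apply: (@card_image_nat _ (fun i => @component R (4 * q + i))) => [i j hi hj /cinj e|C].
    by apply: (addnI (e _ _)); exact: quad_index.
  by split=> [[i hi <-]|[i hi ->]]; exists i.
- apply: (@card_image_nat _ (fun i => @quadruple R (8 + i))) => [i j hi hj /quadruple_inj e|Q].
    by apply: (addnI (e _ _)); lia.
  split=> [/torus_quadruplesE [q hq [tq ->]]|[i hi ->]].
    by exists (q - 8)%N; move: tq; rewrite btypeE //; [lia|move=> h; rewrite subnKC //; lia].
  by apply/torus_quadruplesE; exists (8 + i)%N; [lia|rewrite btypeE; [split=> //; lia|lia]].
- apply: (@card_image_nat _ (@quadruple R)) => [i j hi hj /quadruple_inj e|Q].
    by apply: e; lia.
  split=> [/SOcirc_quadruplesE [q hq [tq ->]]|[i hi ->]].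
    by exists q => //; move: tq; rewrite btypeE.
  by apply/SOcirc_quadruplesE; exists i; [lia|rewrite btypeE; [split=> //; lia|lia]].
- exists (@facet_of R); have /andP [uF /eqP sF] := facets_uniq.
  have t3 q : (q < 16)%N -> three_degree_four (nth [::] facets q) = ~~ btype q.
    by move=> hq; have := allP three_degree_four_facets q; rewrite mem_iota => /(_ hq) /eqP.
  have rel q r : (q < 16)%N -> (r < 16)%N -> q <> r ->
      let ks := [seq itab (4 * q + i) (4 * r + j) | i <- iota 0 4, j <- iota 0 4] in
      has is_line ks = share_edge (nth [::] facets q) (nth [::] facets r) /\
      ~~ has is_line ks && has is_point ks = meet_in_vertex (nth [::] facets q) (nth [::] facets r).
    move=> hq hr qr; have /allP /(_ q) := itab_facets; rewrite mem_iota => /(_ hq) /allP /(_ r).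
    rewrite mem_iota => /(_ hr) /orP [/eqP //|/andP [/eqP h1 /eqP h2]].
    by split.
  split.
  + split.
    * by move=> Q /quadruplesE [q hq ->] /=; rewrite facet_of_quadruple // mem_nth ?sF.
    * move=> Q Q' /set_mem /quadruplesE [q hq ->] /set_mem /quadruplesE [r hr ->].
      rewrite !facet_of_quadruple // => /eqP; rewrite nth_uniq ?sF // => /eqP ->; by [].
    * move=> F /= FF; exists (@quadruple R (index F facets)).
        by apply/quadruplesE; exists (index F facets); rewrite // -sF index_mem.
      by rewrite facet_of_quadruple ?nth_index // -sF index_mem.
  + apply/seteqP; split=> F.
      move=> [_ /torus_quadruplesE [q hq [tq ->]] <-] /=.
      by rewrite facet_of_quadruple // mem_nth ?sF // t3.
    move=> /= [FF]; have hF : (index F facets < 16)%N by rewrite -sF index_mem.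
    rewrite -{1}(nth_index [::] FF) t3 // => tF.
    exists (@quadruple R (index F facets)); last by rewrite facet_of_quadruple ?nth_index.
    by apply/torus_quadruplesE; exists (index F facets).
  + apply/seteqP; split=> F.
      move=> [_ /SOcirc_quadruplesE [q hq [tq ->]] <-] /=.
      by rewrite facet_of_quadruple // mem_nth ?sF // t3 // negbK.
    move=> /= [FF]; have hF : (index F facets < 16)%N by rewrite -sF index_mem.
    rewrite -{1}(nth_index [::] FF) t3 // negbK => tF.
    exists (@quadruple R (index F facets)); last by rewrite facet_of_quadruple ?nth_index.
    by apply/SOcirc_quadruplesE; exists (index F facets).
  + move=> _ _ /quadruplesE [q hq ->] /quadruplesE [r hr ->] qr.
    have nqr : q <> r by move=> e; apply: qr; rewrite e.
    by rewrite !facet_of_quadruple // in_curves_quadruples // (rel q r hq hr nqr).1.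
  + move=> _ _ /quadruplesE [q hq ->] /quadruplesE [r hr ->] qr.
    have nqr : q <> r by move=> e; apply: qr; rewrite e.
    by rewrite !facet_of_quadruple // in_points_quadruples // (rel q r hq hr nqr).2.
- move=> _ _ /componentsE [k hk ->] /componentsE [l hl ->] kl; apply: component_curves => //.
  by apply/eqP => e; apply: kl; rewrite e.
- move=> _ _ /componentsE [k hk ->] /componentsE [l hl ->] kl; apply: component_points => //.
  by apply/eqP => e; apply: kl; rewrite e.
Qed.
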